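(* Let $\tilde Q$ be the Weil-Petersson Riemannian curvature operator on the universal Teichmüller space $T_H(1)$ (with its Hilbert structure). Then: (1) $\tilde Q$ is non-positive definite on $\wedge^2TT_H(1)$, i.e. $\tilde Q(C,C)\le 0$ for every $C\in\wedge^2TT_H(1)$. (2) For $C\in\wedge^2TT_H(1)$, one has $\tilde Q(C,C)=0$ if and only if there is an element $E\in\wedge^2TT_H(1)$ such that $C=E-\mathbf J\circ E$.
   Context: Setting. $\mathbb D$ is the unit disk with hyperbolic metric $\rho(z)|dz|^2$, $\rho(z)=\frac{4}{(1-|z|^2)^2}$, area element $dA=\rho|dz|^2$ ($|dz|^2$ is Lebesgue measure), Laplacian $\Delta_\rho=\frac{4}{\rho}\partial_z\partial_{\bar z}$. $D=-2(\Delta_\rho-2)^{-1}$: for a bounded smooth $f$, $D(f)$ is the bounded smooth solution $u$ of $(\Delta_\rho-2)u=-2f$; it is given by a Green's function, $D(f)(z)=\int_{\mathbb D}G(z,w)f(w)\,dA(w)$, with $G>0$, $G(z,w)=G(w,z)$, $\int_{\mathbb D}G(z,w)\,dA(w)=1$. $H^{-1,1}(\mathbb D)$ is the complex Hilbert space of functions $\nu=\bar q/\rho$ with $q$ holomorphic on $\mathbb D$ and $\int_{\mathbb D}|q|^2\rho^{-1}|dz|^2<\infty$, with inner product $\langle\mu,\nu\rangle=\int_{\mathbb D}\mu\bar\nu\,dA$. It has the orthonormal basis $\mu_{n-1}(z)=\frac{(1-|z|^2)^2}{4}\sqrt{\frac{2n^3-2n}{\pi}}\,\bar z^{\,n-2}$,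 $n\ge2$. $T_H(1)$ is the universal Teichmüller space with the Takhtajan–Teo Hilbert manifold structure: a complex Hilbert manifold whose holomorphic tangent space at each point $P$ is identified with $H^{-1,1}(\mathbb D)$, the Weil-Petersson metric at $P$ being the inner product $\langle\mu,\nu\rangle=\int_{\mathbb D}\mu\bar\nu\,dA$ on $H^{-1,1}(\mathbb D)$. Near $P$ take holomorphic coordinates $t_i=x_i+\mathbf i y_i$ ($i\ge1$) with $\frac{\partial}{\partial t_i}|_P=\mu_i$; $\frac{\partial}{\partial x_i}=\frac{\partial}{\partial t_i}+\frac{\partial}{\partial\bar t_i}$, $\frac{\partial}{\partial y_i}=\mathbf i\big(\frac{\partial}{\partial t_i}-\frac{\partial}{\partial\bar t_i}\big)$. The real tangent space has orthonormal basis $\{\frac{\partial}{\partial x_i},\frac{\partial}{\partial y_i}\}_{i\ge1}$ at $P$. The curvature tensor $R$ of this Kähler metric, extended complex multilinearly, has the usual Riemannian symmetries (antisymmetric in the first two and in the last two arguments, symmetric under exchanging the two pairs), vanishes when its first two arguments (or its last two) are both of type $(1,0)$ or both of type $(0,1)$, and satisfies $R_{i\bar jk\bar\ell}=R(\frac{\partial}{\partial t_i},\frac{\partial}{\partial\bar t_j},\frac{\partial}{\partial t_k},\frac{\partial}{\partial\bar t_\ell})=\int_{\mathbb D}D(\mu_i\bar\mu_j)\mu_k\bar\mu_\ell\,dA+\int_{\mathbb D}D(\mu_i\bar\mu_\ell)\mu_k\bar\mu_j\,dA$. $\wedge^2TT_H(1)$ (at $P$) is the real Hilbert space spanned by $\frac{\partial}{\partial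 x_i}\wedge\frac{\partial}{\partial x_j}$, $\frac{\partial}{\partial x_i}\wedge\frac{\partial}{\partial y_j}$, $\frac{\partial}{\partial y_i}\wedge\frac{\partial}{\partial y_j}$ (closed span, square-summable coefficients), with inner product $\langle V_1\wedge V_2,V_3\wedge V_4\rangle_{eu}=\langle V_1,V_3\rangle\langle V_2,V_4\rangle-\langle V_1,V_4\rangle\langle V_2,V_3\rangle$. The curvature operator $\tilde Q$ is the symmetric bilinear form with $\tilde Q(V_1\wedge V_2,V_3\wedge V_4)=R(V_1,V_2,V_3,V_4)$ for real tangent vectors, extended bilinearly (and to infinite sums as the limit over truncations $i,j\le N$, $N\to\infty$). The action $\mathbf J\circ$ on $\wedge^2TT_H(1)$ is the linear (continuous) map with $\mathbf J\circ\frac{\partial}{\partial x_i}\wedge\frac{\partial}{\partial x_j}=\frac{\partial}{\partial y_i}\wedge\frac{\partial}{\partial y_j}$, $\mathbf J\circ\frac{\partial}{\partial x_i}\wedge\frac{\partial}{\partial y_j}=-\frac{\partial}{\partial y_i}\wedge\frac{\partial}{\partial x_j}=\frac{\partial}{\partial x_j}\wedge\frac{\partial}{\partial y_i}$, $\mathbf J\circ\frac{\partial}{\partial y_i}\wedge\frac{\partial}{\partial y_j}=\frac{\partial}{\partial x_i}\wedge\frac{\partial}{\partial x_j}$. *)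

(* Defs.v *)
From HB Require Import structures.
From mathcomp Require Import all_boot all_order all_algebra.
From mathcomp Require Import all_classical all_reals all_analysis.
From mathcomp Require Import complex ring.
Set Implicit Arguments.
Unset Strict Implicit.
Unset Printing Implicit Defensive.
Import Order.TTheory GRing.Theory Num.Theory.
Import numFieldNormedType.Exports.
Local Open Scope classical_set_scope.
Local Open Scope complex_scope.
Local Open Scope ring_scope.

Section hyperbolic_disk.
Variable R : realType.
Local Notation C := R[i].

(* A point z = x + iy of the plane is the pair (x, y). *)
Definition cplx (p : R * R) : C := p.1 +i* p.2.

Definition sqnorm (p : R * R) : R := p.1 ^+ 2 + p.2 ^+ 2.

Definition disk : set (R * R) := [set p | sqnorm p < 1].

Definition rho (p : R * R) : R := 4 / (1 - sqnorm p) ^+ 2.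

Definition re_part (f : R * R -> C) (p : R * R) : R := complex.Re (f p).
Definition im_part (f : R * R -> C) (p : R * R) : R := complex.Im (f p).

(* Integral of f over the unit disk against the area dA = rho |dz|^2. *)
Definition area_int (f : R * R -> C) : C :=
  let lebesgue2 := (@lebesgue_measure R \x @lebesgue_measure R)%E in
  Rintegral lebesgue2 disk (fun p => re_part f p * rho p) +i*
  Rintegral lebesgue2 disk (fun p => im_part f p * rho p).

Definition ex : R * R := (1, 0).
Definition ey : R * R := (0, 1).

Fixpoint Ck_on_disk (k : nat) (u : R * R -> R) : Prop :=
  (forall p, disk p -> {for p, continuous u}) /\
  if k is k'.+1 then
    [/\ forall p, disk p -> derivable u p ex /\ derivable u p ey,
        Ck_on_disk k' (fun p => 'D_ex u p) &
        Ck_on_disk k' (fun p => 'D_ey u p)]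
  else True.

Definition smooth_on_disk (f : R * R -> C) : Prop :=
  forall k, Ck_on_disk k (re_part f) /\ Ck_on_disk k (im_part f).

Definition bounded_on_disk (f : R * R -> C) : Prop :=
  exists M : R, forall p, disk p -> `|f p| <= M%:C.

Definition partial (v : R * R) (f : R * R -> C) (p : R * R) : C :=
  'D_v (re_part f) p +i* 'D_v (im_part f) p.

Definition d_z (f : R * R -> C) (p : R * R) : C :=
  (partial ex f p - 'i%C * partial ey f p) / 2.

Definition d_zbar (f : R * R -> C) (p : R * R) : C :=
  (partial ex f p + 'i%C * partial ey f p) / 2.

Definition laplacian (f : R * R -> C) (p : R * R) : C :=
  (4 / rho p)%:C * d_z (d_zbar f) p.

(* D = -2 (Delta - 2)^-1.  Only the values on the disk are meaningful; they
   are unique by the maximum principle. *)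
Definition Dop (f : R * R -> C) : R * R -> C :=
  xget (fun=> 0) [set u | [/\ bounded_on_disk u, smooth_on_disk u &
    forall p, disk p -> laplacian u p - 2 * u p = - 2 * f p]].

(* The orthonormal basis of H^{-1,1}, indexed from 0: mu i is the element
   mu_{n-1} with n = i + 2. *)
Definition mu (i : nat) (p : R * R) : C :=
  let n : R := (i + 2)%:R in
  ((1 - sqnorm p) ^+ 2 / 4 * Num.sqrt ((2 * n ^+ 3 - 2 * n) / pi))%:C *
  (cplx p)^*%C ^+ i.

Definition curv4 (a b c d : R * R -> C) : C :=
  area_int (fun p => Dop (fun q => a q * (b q)^*%C) p * c p * (d p)^*%C) +
  area_int (fun p => Dop (fun q => a q * (d q)^*%C) p * c p * (b p)^*%C).

End hyperbolic_disk.

(* The tangent space of T_H(1) at a point P is H^{-1,1} with the Weil-Petersson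
   inner product, whatever P is, so the data below do not mention P.  rdir
   indexes the orthonormal basis d/dx_i, d/dy_i of the real tangent space, cdir
   the basis d/dt_i, d/dtbar_i of its complexification (d/dt_i = mu i). *)
Definition rdir : Type := (nat + nat)%type.
Definition dx (i : nat) : rdir := inl i.
Definition dy (i : nat) : rdir := inr i.

Definition cdir : Type := (nat + nat)%type.
Definition dt (i : nat) : cdir := inl i.
Definition dtbar (i : nat) : cdir := inr i.

Section curvature_operator.
Variable R : realType.
Local Notation C := R[i].

(* The components of the curvature tensor: those of type (i jbar k lbar) are
   given by the integral formula, the others by antisymmetry in each pair of
   arguments and vanishing on pairs of equal type. *)
Definition curv_cplx (a b c d : cdir) : C :=
  let K i j k l := curv4 (@mu R i) (@mu R j) (@mu R k) (@mu R l) in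
  match a, b, c, d with
  | inl i, inr j, inl k, inr l => K i j k l
  | inr j, inl i, inl k, inr l => - K i j k l
  | inl i, inr j, inr l, inl k => - K i j k l
  | inr j, inl i, inr l, inl k => K i j k l
  | _, _, _, _ => 0
  end.

(* d/dx = d/dt + d/dtbar and d/dy = i (d/dt - d/dtbar). *)
Definition in_cdir (e : rdir) : seq (C * cdir) :=
  match e with
  | inl i => [:: (1, dt i); (1, dtbar i)]
  | inr i => [:: ('i%C, dt i); (- 'i%C, dtbar i)]
  end.

(* The value of the curvature tensor on real basis vectors is real, so taking
   the real part loses nothing. *)
Definition curv_real (e f g h : rdir) : R :=
  complex.Re (\sum_(a <- in_cdir e) \sum_(b <- in_cdir f)
    \sum_(c <- in_cdir g) \sum_(d <- in_cdir h)
      a.1 * b.1 * c.1 * d.1 * curv_cplx a.2 b.2 c.2 d.2).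

(* A bivector is the antisymmetric family of its coefficients in the real
   basis: A stands for 1/2 \sum_(e, f) A (e, f) (e /\ f), that is, the sum of
   A (e, f) (e /\ f) over unordered pairs {e, f}.  The e /\ f being
   orthonormal, the Hilbert space consists of the square-summable families. *)
Definition bivector := rdir * rdir -> R.

Definition wedge2 : set bivector :=
  [set A | (forall e f, A (e, f) = - A (f, e)) /\
           summable [set: rdir * rdir] (fun p => (A p ^+ 2)%:E)].

Definition wedge (e f : rdir) : bivector :=
  fun p => (p == (e, f))%:R - (p == (f, e))%:R.

Definition truncated_basis (N : nat) : seq rdir :=
  map dx (iota 0 N) ++ map dy (iota 0 N).

(* Bilinear extension of Q (e /\ f) (g /\ h) = R(e, f, g, h); the factor 1/4
   comes from counting each pair {e, f} and {g, h} twice. *)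
Definition Qtrunc (N : nat) (A B : bivector) : R :=
  4^-1 * \sum_(e <- truncated_basis N) \sum_(f <- truncated_basis N)
         \sum_(g <- truncated_basis N) \sum_(h <- truncated_basis N)
           A (e, f) * B (g, h) * curv_real e f g h.

Definition Qtilde (A B : bivector) : R := limn (fun N => Qtrunc N A B).

Definition Jact (A : bivector) : bivector := fun p =>
  match p with
  | (inl i, inl j) => A (dy i, dy j)
  | (inr i, inr j) => A (dx i, dx j)
  | (inl i, inr j) => - A (dy i, dx j)
  | (inr i, inl j) => - A (dx i, dy j)
  end.

Lemma wedgeC e f : wedge f e = - wedge e f.
Proof. by apply/funext => p; rewrite /wedge fctE opprB. Qed.

Lemma Jact_dx_dx i j : Jact (wedge (dx i) (dx j)) = wedge (dy i) (dy j).
Proof.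
by apply/funext => -[[a|a] [b|b]]; rewrite /Jact /wedge /dx /dy !xpair_eqE /=
  ?andbF ?andFb ?subrr ?oppr0.
Qed.

Lemma Jact_dy_dx i j : Jact (wedge (dy i) (dx j)) = - wedge (dx i) (dy j).
Proof.
by apply/funext => -[[a|a] [b|b]]; rewrite /Jact fctE /wedge /dx /dy
  !xpair_eqE /= ?andbF ?andFb ?subrr ?oppr0.
Qed.

Lemma Jact_dx_dy i j : Jact (wedge (dx i) (dy j)) = wedge (dx j) (dy i).
Proof.
have JN A : Jact (- A) = - Jact A.
  by apply/funext => -[[a|a] [b|b]]; rewrite /Jact /= !fctE.
by rewrite wedgeC JN Jact_dy_dx opprK.
Qed.

Lemma Jact_dy_dy i j : Jact (wedge (dy i) (dy j)) = wedge (dx i) (dx j).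
Proof.
by apply/funext => -[[a|a] [b|b]]; rewrite /Jact /wedge /dx /dy !xpair_eqE /=
  ?andbF ?andFb ?subrr ?oppr0.
Qed.

Lemma curv_realNl e f g h : curv_real f e g h = - curv_real e f g h.
Proof.
have cN a b c d : curv_cplx b a c d = - curv_cplx a b c d.
  by case: a b c d => [a|a] [b|b] [c|c] [d|d] /=; rewrite ?oppr0 ?opprK.
rewrite /curv_real -raddfN /= exchange_big -sumrN; congr complex.Re.
apply: eq_bigr => a _; rewrite -sumrN; apply: eq_bigr => b _.
rewrite -sumrN; apply: eq_bigr => c _; rewrite -sumrN; apply: eq_bigr => d _.
by rewrite cN mulrN (mulrC b.1).
Qed.

Lemma curv_realNr e f g h : curv_real e f h g = - curv_real e f g h.
Proof.
have cN a b c d : curv_cplx a b d c = - curv_cplx a b c d.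
  by case: a b c d => [a|a] [b|b] [c|c] [d|d] /=; rewrite ?oppr0 ?opprK.
rewrite /curv_real -raddfN /= -sumrN; congr complex.Re.
apply: eq_bigr => a _; rewrite -sumrN; apply: eq_bigr => b _.
rewrite -sumrN exchange_big; apply: eq_bigr => c _.
rewrite -sumrN; apply: eq_bigr => d _.
by rewrite cN mulrN (mulrAC (a.1 * b.1)).
Qed.

Lemma Qtilde_wedge e f g h :
  Qtilde (wedge e f) (wedge g h) = curv_real e f g h.
Proof.
pose bd (x : rdir) := match x with inl i | inr i => i end.
have mem x N : (bd x < N)%N -> x \in truncated_basis N.
  move=> xN; rewrite mem_cat; apply/orP.
  by case: x xN => i iN; [left|right]; apply: map_f; rewrite mem_iota.
have un N : uniq (truncated_basis N).
  rewrite cat_uniq !map_inj_uniq ?iota_uniq; try by move=> ? ? [].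
  rewrite andbT /=; apply/hasPn => _ /mapP[i _ ->].
  by apply/negP => /mapP[].
have pick N x (F : rdir -> R) : (bd x < N)%N ->
    \sum_(y <- truncated_basis N) (y == x)%:R * F y = F x.
  move=> xN; rewrite (bigD1_seq x) ?mem ?un //= eqxx mul1r big1 ?addr0 //.
  by move=> y /negbTE ->; rewrite mul0r.
have dbl N x y (F : rdir -> rdir -> R) : (bd x < N)%N -> (bd y < N)%N ->
    \sum_(a <- truncated_basis N) \sum_(b <- truncated_basis N)
      wedge x y (a, b) * F a b = F x y - F y x.
  have one u v : (bd u < N)%N -> (bd v < N)%N ->
      \sum_(a <- truncated_basis N) \sum_(b <- truncated_basis N)
        ((a, b) == (u, v))%:R * F a b = F u v.
    move=> uN vN; rewrite -[RHS](pick N u (F^~ v)) //; apply: eq_bigr => a _.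
    rewrite -(pick N v (F a)) // mulr_sumr; apply: eq_bigr => b _.
    by rewrite xpair_eqE mulrA -natrM mulnb.
  move=> xN yN; rewrite -[F x y]one // -[F y x]one // -sumrB.
  apply: eq_bigr => a _; rewrite -sumrB; apply: eq_bigr => b _.
  by rewrite /wedge mulrBl.
apply: cvg_lim => //; apply: cvg_near_cst.
near=> N.
have [eN fN gN hN] : [/\ (bd e < N)%N, (bd f < N)%N, (bd g < N)%N & (bd h < N)%N].
  by split; near: N; exact: nbhs_infty_gt.
rewrite /Qtrunc.
transitivity (4^-1 * \sum_(a <- truncated_basis N) \sum_(b <- truncated_basis N)
    wedge e f (a, b) * (curv_real a b g h - curv_real a b h g)).
  congr (_ * _); apply: eq_bigr => a _; apply: eq_bigr => b _.
  rewrite -(dbl N g h (curv_real a b)) // mulr_sumr; apply: eq_bigr => c _.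
  by rewrite mulr_sumr; apply: eq_bigr => d _; rewrite mulrA.
rewrite (dbl N e f (fun a b => curv_real a b g h - curv_real a b h g)) //.
rewrite (curv_realNr e f) (curv_realNr f e) (curv_realNl e f) !opprK.
set X := curv_real _ _ _ _.
by field.
Unshelve. all: by end_near. Qed.

End curvature_operator.

(* Main.v *)
(** The bivector [A] has a coefficient matrix [F] (its (1,1) part), which is
   anti-Hermitian, and with [H(w, z) = sum F_ij mu_i(w) conj(mu_j(z))] one has
     Q(A, A) = - int D(h) conj(h) dA - int D(|H(., z)|^2)(z) dA(z),
   where [h(z) = H(z, z)].  The first integral is nonnegative
   by Green's formula.  For the second one, no Green function is needed: for fixed [z] the maximum
   principle gives [|H(., z)|^2 / 3 <= D(|H(., z)|^2) <= sup |H(., z)|^2], so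
   the form is at most [- 1/3 int |h|^2 dA], and it is bounded for the Hilbert norm
   since [sum |mu_i|^2] is bounded on the disk.  Boundedness makes the
   truncations converge; if the limit is zero then [h] vanishes, and so does [F]
   because [z] and [zbar] are independent.  Finally [F = 0] means [J o A = - A].
   The operator [D] is explicit on the products [mu_i conj(mu_j)]: with
   [t = 1 - |z|^2], [D] maps them to [t^2] times polynomials in [z], [zbar]. *)
From HB Require Import structures.
Require Import Defs.
From mathcomp Require Import all_boot all_order all_algebra.
From mathcomp Require Import all_classical all_reals all_analysis.
From mathcomp Require Import measurable_realfun complex ring lra zify.
Set Implicit Arguments.
Unset Strict Implicit.
Unset Printing Implicit Defensive.
Import Order.TTheory GRing.Theory Num.Theory.
Import numFieldNormedType.Exports.
Local Open Scope classical_set_scope.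
Local Open Scope complex_scope.
Local Open Scope ring_scope.

(** * Polynomial functions on the plane *)

(** The infinite kernel [H] is never formed. Estimates are made for the truncation at [N], with
    constants independent of [N], and only the numbers [qform N], [hs_norm N] and [diag_norm N] go
    to the limit. For finite [N] everything is a polynomial in the coordinates once the powers of
    [t] are split off, so smoothness, bounds and integrability come by construction, and Green's
    formula only concerns polynomials vanishing on the unit circle. General smooth functions occur
    in one place: [Dop] chooses among all bounded smooth solutions, so uniqueness must be proved in
    that class. Origin of 1/3: [H(., z)] is [t^2] times an antiholomorphic function, so
    [phi = |H(., z)|^2] satisfies [(Delta - 2) phi >= - 6 phi], whence [(Delta - 2) (phi / 3) >=
    (Delta - 2) D(phi)]. For a null bivector one only knows that [diag_norm N] tends to 0. The
    independence of [z] and [zbar] is therefore used in quantitative form: every off-diagonal of [F]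
    is tested by integrals whose tails are bounded uniformly in [N]. *)

Section poly_functions.
Variable R : realType.
Local Notation C := R[i].
Implicit Types (p v : R * R) (f g : R * R -> R).

(** A predicate on plain functions: each analytic property of polynomials becomes one induction, and
    the functions of the definitions are used as they are. *)
Inductive rpoly : (R * R -> R) -> Prop :=
| rpoly_cst c : rpoly (fun=> c)
| rpoly_fst : rpoly fst
| rpoly_snd : rpoly snd
| rpolyD f g : rpoly f -> rpoly g -> rpoly (fun p => f p + g p)
| rpolyM f g : rpoly f -> rpoly g -> rpoly (fun p => f p * g p).

Lemma rpoly_ext f g : f =1 g -> rpoly f -> rpoly g.
Proof. by move=> /funext ->. Qed.

Lemma rpolyN f : rpoly f -> rpoly (fun p => - f p).
Proof.
by move=> fP; apply: rpoly_ext (rpolyM (rpoly_cst (-1)) fP) => p;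
  rewrite mulN1r.
Qed.

Lemma rpolyB f g : rpoly f -> rpoly g -> rpoly (fun p => f p - g p).
Proof. by move=> fP gP; exact: rpolyD fP (rpolyN gP). Qed.

Lemma is_derive_fst p v : is_derive p v (fst : R * R -> R) v.1.
Proof.
have E : h^-1 *: ((h *: v + p).1 - p.1) @[h --> 0^'] --> v.1.
  apply: cvg_near_cst; near=> h => /=.
  have h0 : h != 0 by near: h; exact: nbhs_dnbhs_neq.
  by rewrite addrK /GRing.scale /= mulKf.
split; first by apply/cvg_ex; exists v.1.
exact: cvg_lim E.
Unshelve. all: by end_near. Qed.

Lemma is_derive_snd p v : is_derive p v (snd : R * R -> R) v.2.
Proof.
have E : h^-1 *: ((h *: v + p).2 - p.2) @[h --> 0^'] --> v.2.
  apply: cvg_near_cst; near=> h => /=.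
  have h0 : h != 0 by near: h; exact: nbhs_dnbhs_neq.
  by rewrite addrK /GRing.scale /= mulKf.
split; first by apply/cvg_ex; exists v.2.
exact: cvg_lim E.
Unshelve. all: by end_near. Qed.

Lemma rpoly_derivable f : rpoly f -> forall p v, derivable f p v.
Proof.
elim=> [c|||{}f g _ fd _ gd|{}f g _ fd _ gd] p v.
- exact: derivable_cst.
- by have [] := is_derive_fst p v.
- by have [] := is_derive_snd p v.
- exact: derivableD.
- exact: derivableM.
Qed.

Lemma rpoly_is_derive f : rpoly f -> forall p v, is_derive p v f ('D_v f p).
Proof. by move=> fP p v; apply/derivableP/rpoly_derivable. Qed.

Lemma rpoly_derive f v : rpoly f -> rpoly (fun p => 'D_v f p).
Proof.
elim=> [c|||{}f g fP fd gP gd|{}f g fP fd gP gd].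
- apply: rpoly_ext (rpoly_cst 0) => p; exact/esym/derive_cst.
- apply: rpoly_ext (rpoly_cst v.1) => p.
  by have [_ ->] := is_derive_fst p v.
- apply: rpoly_ext (rpoly_cst v.2) => p.
  by have [_ ->] := is_derive_snd p v.
- apply: rpoly_ext (rpolyD fd gd) => p /=.
  by rewrite (deriveD (@rpoly_derivable _ fP p v) (@rpoly_derivable _ gP p v)).
- apply: rpoly_ext (rpolyD (rpolyM fP gd) (rpolyM gP fd)) => p /=.
  by rewrite (deriveM (@rpoly_derivable _ fP p v) (@rpoly_derivable _ gP p v)).
Qed.

Lemma rpoly_continuous f : rpoly f -> continuous f.
Proof.
elim=> [c|||{}f g _ fc _ gc|{}f g _ fc _ gc] p.
- exact: cvg_cst.
- exact: cvg_fst.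
- exact: cvg_snd.
- exact: (cvgD (fc p) (gc p)).
- exact: (cvgM (fc p) (gc p)).
Qed.

Lemma rpoly_measurable f : rpoly f -> measurable_fun setT f.
Proof.
elim=> [c|||{}f g _ fm _ gm|{}f g _ fm _ gm].
- exact: measurable_cst.
- exact: measurable_fst.
- exact: measurable_snd.
- exact: measurable_funD.
- exact: measurable_funM.
Qed.

Lemma disk_coord p : disk p -> `|p.1| <= 1 /\ `|p.2| <= 1.
Proof.
rewrite /disk /sqnorm /= => p1.
split; rewrite -(ler_pXn2r (n := 2)) ?nnegrE // expr1n real_normK ?num_real //.
  by have := sqr_ge0 p.2; lra.
by have := sqr_ge0 p.1; lra.
Qed.

Lemma rpoly_bounded f : rpoly f -> exists M, forall p, disk p -> `|f p| <= M.
Proof.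
elim=> [c|||{}f g _ [M fM] _ [N gN]|{}f g _ [M fM] _ [N gN]].
- by exists `|c|.
- by exists 1 => p /disk_coord[].
- by exists 1 => p /disk_coord[].
- exists (M + N) => p pD; apply: le_trans (ler_normD _ _) _.
  by rewrite lerD ?fM ?gN.
- exists (M * N) => p pD; rewrite normrM.
  by rewrite ler_pM ?fM ?gN.
Qed.

Lemma rpoly_Ck k f : rpoly f -> Ck_on_disk k f.
Proof.
elim: k f => [|k IH] f fP; split=> //.
- by move=> p _; exact: rpoly_continuous.
- by move=> p _; exact: rpoly_continuous.
- split=> [p _||].
  + by split; exact: rpoly_derivable.
  + exact/IH/rpoly_derive.
  + exact/IH/rpoly_derive.
Qed.

(** * Complex-valued polynomial functions and Wirtinger calculus *)

Definition cpoly (F : R * R -> C) := rpoly (re_part F) /\ rpoly (im_part F).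

Implicit Types F G : R * R -> C.

Lemma cpoly_ext F G : F =1 G -> cpoly F -> cpoly G.
Proof. by move=> /funext ->. Qed.

Lemma cpoly_cst c : cpoly (fun=> c).
Proof. by split; exact: rpoly_cst. Qed.

Lemma cpoly_real f : rpoly f -> cpoly (fun p => (f p)%:C).
Proof. by move=> fP; split => //; exact: rpoly_cst. Qed.

Lemma cpolyD F G : cpoly F -> cpoly G -> cpoly (fun p => F p + G p).
Proof.
move=> [F1 F2] [G1 G2]; split.
  by apply: rpoly_ext (rpolyD F1 G1) => p; rewrite /re_part raddfD.
by apply: rpoly_ext (rpolyD F2 G2) => p; rewrite /im_part raddfD.
Qed.

Lemma ReM (a b : C) : complex.Re (a * b) =
  complex.Re a * complex.Re b - complex.Im a * complex.Im b.
Proof. by case: a b => [a a'] [b b']. Qed.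

Lemma ImM (a b : C) : complex.Im (a * b) =
  complex.Re a * complex.Im b + complex.Im a * complex.Re b.
Proof. by case: a b => [a a'] [b b']. Qed.

Lemma cpolyM F G : cpoly F -> cpoly G -> cpoly (fun p => F p * G p).
Proof.
move=> [F1 F2] [G1 G2]; split.
  apply: rpoly_ext (rpolyB (rpolyM F1 G1) (rpolyM F2 G2)) => p.
  by rewrite /re_part ReM.
apply: rpoly_ext (rpolyD (rpolyM F1 G2) (rpolyM F2 G1)) => p.
by rewrite /im_part ImM.
Qed.

Lemma cpolyN F : cpoly F -> cpoly (fun p => - F p).
Proof.
by move=> FP; apply: cpoly_ext (cpolyM (cpoly_cst (-1)) FP) => p;
  rewrite mulN1r.
Qed.

Lemma cpolyB F G : cpoly F -> cpoly G -> cpoly (fun p => F p - G p).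
Proof. by move=> FP GP; exact: cpolyD FP (cpolyN GP). Qed.

Lemma cpoly_conj F : cpoly F -> cpoly (fun p => (F p)^*%C).
Proof.
move=> [F1 F2]; split.
  by apply: rpoly_ext F1 => p; rewrite /re_part; case: (F p).
by apply: rpoly_ext (rpolyN F2) => p; rewrite /im_part; case: (F p).
Qed.

Lemma cpoly_sum I (r : seq I) (P : pred I) (F : I -> R * R -> C) :
  (forall i, cpoly (F i)) -> cpoly (fun p => \sum_(i <- r | P i) F i p).
Proof.
move=> FP; elim: r => [|i r IH].
  by apply: cpoly_ext (cpoly_cst 0) => p; rewrite big_nil.
apply: (@cpoly_ext (fun p => (if P i then F i p else 0) +
    \sum_(j <- r | P j) F j p)) => [p|].
  by rewrite big_cons; case: ifP; rewrite ?add0r.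
by apply: cpolyD => //; case: (P i); [exact: FP|exact: cpoly_cst].
Qed.

Lemma cpolyX F n : cpoly F -> cpoly (fun p => F p ^+ n).
Proof.
move=> FP; elim: n => [|n IH]; first exact: cpoly_cst.
by apply: cpoly_ext (cpolyM FP IH) => p; rewrite exprS.
Qed.

Lemma cpoly_cplx : cpoly (@cplx R).
Proof. by split; [exact: rpoly_fst|exact: rpoly_snd]. Qed.

Lemma cpoly_smooth F : cpoly F -> smooth_on_disk F.
Proof. by move=> [F1 F2] k; split; exact: rpoly_Ck. Qed.

Lemma d_zE F p : d_z F p =
  ((('D_(ex R) (re_part F) p + 'D_(ey R) (im_part F) p) / 2)
   +i* (('D_(ex R) (im_part F) p - 'D_(ey R) (re_part F) p) / 2)).
Proof.
rewrite /d_z /partial; move: ('D_(ex R) _ _) ('D_(ex R) _ _) => a b.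
move: ('D_(ey R) _ _) ('D_(ey R) _ _) => c d.
have -> : (2 : C)^-1 = (2^-1)%:C
  by rewrite rmorphV ?unitfE ?pnatr_eq0 // rmorph_nat.
by apply/eqP; rewrite eq_complex /=; apply/andP; split; apply/eqP; ring.
Qed.

Lemma d_zbarE F p : d_zbar F p =
  ((('D_(ex R) (re_part F) p - 'D_(ey R) (im_part F) p) / 2)
   +i* (('D_(ex R) (im_part F) p + 'D_(ey R) (re_part F) p) / 2)).
Proof.
rewrite /d_zbar /partial; move: ('D_(ex R) _ _) ('D_(ex R) _ _) => a b.
move: ('D_(ey R) _ _) ('D_(ey R) _ _) => c d.
have -> : (2 : C)^-1 = (2^-1)%:C
  by rewrite rmorphV ?unitfE ?pnatr_eq0 // rmorph_nat.
by apply/eqP; rewrite eq_complex /=; apply/andP; split; apply/eqP; ring.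
Qed.

Lemma cpoly_d_z F : cpoly F -> cpoly (d_z F).
Proof.
move=> [F1 F2]; split.
  apply: rpoly_ext (rpolyM (rpolyD (rpoly_derive (ex R) F1)
    (rpoly_derive (ey R) F2)) (rpoly_cst 2^-1)) => p.
  by rewrite /re_part d_zE.
apply: rpoly_ext (rpolyM (rpolyB (rpoly_derive (ex R) F2)
  (rpoly_derive (ey R) F1)) (rpoly_cst 2^-1)) => p.
by rewrite /im_part d_zE.
Qed.

Lemma cpoly_d_zbar F : cpoly F -> cpoly (d_zbar F).
Proof.
move=> [F1 F2]; split.
  apply: rpoly_ext (rpolyM (rpolyB (rpoly_derive (ex R) F1)
    (rpoly_derive (ey R) F2)) (rpoly_cst 2^-1)) => p.
  by rewrite /re_part d_zbarE.
apply: rpoly_ext (rpolyM (rpolyD (rpoly_derive (ex R) F2)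
  (rpoly_derive (ey R) F1)) (rpoly_cst 2^-1)) => p.
by rewrite /im_part d_zbarE.
Qed.

Lemma derive_conj F v p : cpoly F ->
  'D_v (re_part (fun p => (F p)^*%C)) p = 'D_v (re_part F) p /\
  'D_v (im_part (fun p => (F p)^*%C)) p = - 'D_v (im_part F) p.
Proof.
move=> [F1 F2]; split.
  by congr ('D_v _ p); apply/funext => q; rewrite /re_part; case: (F q).
rewrite -deriveN; last exact: rpoly_derivable.
by congr ('D_v _ p); apply/funext => q; rewrite fctE /im_part; case: (F q).
Qed.

Lemma d_z_conj F p : cpoly F -> d_z (fun p => (F p)^*%C) p = (d_zbar F p)^*%C.
Proof.
move=> FP; rewrite d_zE d_zbarE.
have [-> ->] := derive_conj (ex R) p FP.
have [-> ->] := derive_conj (ey R) p FP.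
move: ('D_(ex R) _ _) ('D_(ex R) _ _) ('D_(ey R) _ _) ('D_(ey R) _ _) => a b c
  d.
by apply/eqP; rewrite eq_complex /=; apply/andP; split; apply/eqP; ring.
Qed.

Lemma d_zbar_conj F p : cpoly F -> d_zbar (fun p => (F p)^*%C) p = (d_z F
  p)^*%C.
Proof.
move=> FP; rewrite d_zE d_zbarE.
have [-> ->] := derive_conj (ex R) p FP.
have [-> ->] := derive_conj (ey R) p FP.
move: ('D_(ex R) _ _) ('D_(ex R) _ _) ('D_(ey R) _ _) ('D_(ey R) _ _) => a b c
  d.
by apply/eqP; rewrite eq_complex /=; apply/andP; split; apply/eqP; ring.
Qed.

Lemma derive_addC F G v p : cpoly F -> cpoly G ->
  'D_v (re_part (fun p => F p + G p)) p =
    'D_v (re_part F) p + 'D_v (re_part G) p /\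
  'D_v (im_part (fun p => F p + G p)) p =
    'D_v (im_part F) p + 'D_v (im_part G) p.
Proof.
move=> [F1 F2] [G1 G2]; split.
  rewrite -deriveD; try exact: rpoly_derivable.
  by congr ('D_v _ p); apply/funext => q; rewrite /re_part raddfD.
rewrite -deriveD; try exact: rpoly_derivable.
by congr ('D_v _ p); apply/funext => q; rewrite /im_part raddfD.
Qed.

Lemma derive_mulC F G v p : cpoly F -> cpoly G ->
  'D_v (re_part (fun p => F p * G p)) p =
    (re_part F p * 'D_v (re_part G) p + re_part G p * 'D_v (re_part F) p) -
    (im_part F p * 'D_v (im_part G) p + im_part G p * 'D_v (im_part F) p) /\
  'D_v (im_part (fun p => F p * G p)) p =
    (re_part F p * 'D_v (im_part G) p + im_part G p * 'D_v (re_part F) p) +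
    (im_part F p * 'D_v (re_part G) p + re_part G p * 'D_v (im_part F) p).
Proof.
move=> [F1 F2] [G1 G2]; split.
  rewrite -!deriveM -?deriveB; try exact: rpoly_derivable;
    try (apply: rpoly_derivable; exact: rpolyM).
  by congr ('D_v _ p); apply/funext => q; rewrite /re_part ReM.
rewrite -!deriveM -?deriveD; try exact: rpoly_derivable;
    try (apply: rpoly_derivable; exact: rpolyM).
by congr ('D_v _ p); apply/funext => q; rewrite /im_part ImM.
Qed.

Lemma d_zD F G p : cpoly F -> cpoly G ->
  d_z (fun p => F p + G p) p = d_z F p + d_z G p.
Proof.
move=> FP GP; rewrite !d_zE.
have [-> ->] := derive_addC (ex R) p FP GP.
have [-> ->] := derive_addC (ey R) p FP GP.
move: ('D_(ex R) (re_part F) p) ('D_(ex R) (im_part F) p) => a b.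
move: ('D_(ey R) (re_part F) p) ('D_(ey R) (im_part F) p) => c d.
move: ('D_(ex R) (re_part G) p) ('D_(ex R) (im_part G) p) => a' b'.
move: ('D_(ey R) (re_part G) p) ('D_(ey R) (im_part G) p) => c' d'.
by apply/eqP; rewrite eq_complex /=; apply/andP; split; apply/eqP; ring.
Qed.

Lemma d_zM F G p : cpoly F -> cpoly G ->
  d_z (fun p => F p * G p) p = d_z F p * G p + F p * d_z G p.
Proof.
move=> FP GP; rewrite !d_zE.
have [-> ->] := derive_mulC (ex R) p FP GP.
have [-> ->] := derive_mulC (ey R) p FP GP.
move: ('D_(ex R) (re_part F) p) ('D_(ex R) (im_part F) p) => a b.
move: ('D_(ey R) (re_part F) p) ('D_(ey R) (im_part F) p) => c d.
move: ('D_(ex R) (re_part G) p) ('D_(ex R) (im_part G) p) => a' b'.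
move: ('D_(ey R) (re_part G) p) ('D_(ey R) (im_part G) p) => c' d'.
rewrite /re_part /im_part; case: (F p) (G p) => [x y] [x' y'].
by apply/eqP; rewrite eq_complex /=; apply/andP; split; apply/eqP; ring.
Qed.

Lemma d_z_cst (c : C) p : d_z (fun=> c) p = 0.
Proof.
rewrite d_zE /re_part /im_part !derive_cst.
by rewrite subrr addr0 mul0r.
Qed.

Lemma d_z_cplx p : d_z (@cplx R) p = 1.
Proof.
rewrite d_zE.
have -> : re_part (@cplx R) = fst by [].
have -> : im_part (@cplx R) = snd by [].
have [_ ->] := is_derive_fst p (ex R).
have [_ ->] := is_derive_fst p (ey R).
have [_ ->] := is_derive_snd p (ex R).
have [_ ->] := is_derive_snd p (ey R).
by apply/eqP; rewrite eq_complex /=; apply/andP; split; apply/eqP; field.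
Qed.

Lemma d_zbar_cplx p : d_zbar (@cplx R) p = 0.
Proof.
rewrite d_zbarE.
have -> : re_part (@cplx R) = fst by [].
have -> : im_part (@cplx R) = snd by [].
have [_ ->] := is_derive_fst p (ex R).
have [_ ->] := is_derive_fst p (ey R).
have [_ ->] := is_derive_snd p (ex R).
have [_ ->] := is_derive_snd p (ey R).
by apply/eqP; rewrite eq_complex /=; apply/andP; split; apply/eqP; field.
Qed.

(** Conjugation exchanges the two Wirtinger derivatives, so the rules for [d_zbar] are transported
    from those for [d_z]. *)
Lemma d_zbar_via_conj F p : cpoly F ->
  d_zbar F p = (d_z (fun p => (F p)^*%C) p)^*%C.
Proof. by move=> FP; rewrite d_z_conj // conjcK. Qed.

Lemma d_zbarD F G p : cpoly F -> cpoly G ->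
  d_zbar (fun p => F p + G p) p = d_zbar F p + d_zbar G p.
Proof.
move=> FP GP; rewrite !d_zbar_via_conj //; last exact: cpolyD.
rewrite -rmorphD -d_zD; try exact: cpoly_conj.
by congr ((d_z _ p)^*%C); apply/funext => q; rewrite rmorphD.
Qed.

Lemma d_zbarM F G p : cpoly F -> cpoly G ->
  d_zbar (fun p => F p * G p) p = d_zbar F p * G p + F p * d_zbar G p.
Proof.
move=> FP GP; rewrite !d_zbar_via_conj //; last exact: cpolyM.
rewrite -[G p]conjcK -[F p]conjcK -!rmorphM -rmorphD.
rewrite -(d_zM p (cpoly_conj FP) (cpoly_conj GP)).
by congr ((d_z _ p)^*%C); apply/funext => q; rewrite rmorphM.
Qed.

Lemma d_zbar_cst (c : C) p : d_zbar (fun=> c) p = 0.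
Proof. by rewrite d_zbar_via_conj ?d_z_cst ?rmorph0 //; exact: cpoly_cst. Qed.

Lemma d_zbar_zbar p : d_zbar (fun p : R * R => (cplx p)^*%C) p = 1.
Proof. by rewrite d_zbar_conj ?d_z_cplx ?rmorph1 //; exact: cpoly_cplx. Qed.

Lemma d_z_zbar p : d_z (fun p : R * R => (cplx p)^*%C) p = 0.
Proof. by rewrite d_z_conj ?d_zbar_cplx ?rmorph0 //; exact: cpoly_cplx. Qed.

Lemma d_zZ (c : C) F p : cpoly F -> d_z (fun p => c * F p) p = c * d_z F p.
Proof. by move=> FP; rewrite d_zM ?d_z_cst ?mul0r ?add0r //;
  exact: cpoly_cst. Qed.

Lemma d_zbarZ (c : C) F p : cpoly F ->
  d_zbar (fun p => c * F p) p = c * d_zbar F p.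
Proof.
by move=> FP; rewrite d_zbarM ?d_zbar_cst ?mul0r ?add0r //; exact: cpoly_cst.
Qed.

Lemma d_zB F G p : cpoly F -> cpoly G ->
  d_z (fun p => F p - G p) p = d_z F p - d_z G p.
Proof.
move=> FP GP.
have -> : (fun p => F p - G p) = (fun p => F p + (-1) * G p).
  by apply/funext => q; rewrite mulN1r.
have NGP : cpoly (fun p => -1 * G p) by apply: cpolyM => //; exact: cpoly_cst.
by rewrite d_zD // d_zZ // mulN1r.
Qed.

Lemma d_zbarB F G p : cpoly F -> cpoly G ->
  d_zbar (fun p => F p - G p) p = d_zbar F p - d_zbar G p.
Proof.
move=> FP GP.
have -> : (fun p => F p - G p) = (fun p => F p + (-1) * G p).
  by apply/funext => q; rewrite mulN1r.
have NGP : cpoly (fun p => -1 * G p) by apply: cpolyM => //; exact: cpoly_cst.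
by rewrite d_zbarD // d_zbarZ // mulN1r.
Qed.

Lemma d_zX F n p : cpoly F ->
  d_z (fun p => F p ^+ n) p = n%:R * F p ^+ n.-1 * d_z F p.
Proof.
move=> FP; elim: n => [|n IH]; first by rewrite d_z_cst !mul0r.
have -> : (fun p => F p ^+ n.+1) = (fun p => F p * F p ^+ n).
  by apply/funext => q; rewrite exprS.
rewrite d_zM //; last exact: cpolyX.
rewrite IH /= -nat1r; case: n {IH} => [|n] /=; first by rewrite !expr0; ring.
by rewrite exprS; ring.
Qed.

Lemma d_zbarX F n p : cpoly F ->
  d_zbar (fun p => F p ^+ n) p = n%:R * F p ^+ n.-1 * d_zbar F p.
Proof.
move=> FP; rewrite d_zbar_via_conj; last exact: cpolyX.
have -> : (fun p => ((F p) ^+ n)^*%C) = (fun p => (F p)^*%C ^+ n).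
  by apply/funext => q; rewrite rmorphXn.
rewrite d_zX; last exact: cpoly_conj.
have conjE (x y : C) k : (n%:R * (x^*)%C ^+ k * (y^*)%C)^*%C = n%:R * x ^+ k *
  y.
  by rewrite !rmorphM rmorph_nat rmorphXn /= !conjcK.
by rewrite d_z_conj // conjE.
Qed.

Lemma d_z_sum I (r : seq I) (F : I -> R * R -> C) p :
  (forall i, cpoly (F i)) ->
  d_z (fun p => \sum_(i <- r) F i p) p = \sum_(i <- r) d_z (F i) p.
Proof.
move=> FP; elim: r => [|i r IH].
  rewrite big_nil -[RHS](d_z_cst 0 p).
  have -> // : (fun p => \sum_(i <- [::]) F i p) = fun=> 0.
  by apply/funext => q; rewrite big_nil.
rewrite big_cons -IH -(d_zD p (FP i) (cpoly_sum r xpredT FP)).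
have -> // : (fun p => \sum_(j <- i :: r) F j p) =
  (fun p => F i p + \sum_(j <- r) F j p).
by apply/funext => q; rewrite big_cons.
Qed.

Lemma d_zbar_sum I (r : seq I) (F : I -> R * R -> C) p :
  (forall i, cpoly (F i)) ->
  d_zbar (fun p => \sum_(i <- r) F i p) p = \sum_(i <- r) d_zbar (F i) p.
Proof.
move=> FP; elim: r => [|i r IH].
  rewrite big_nil -[RHS](d_zbar_cst 0 p).
  have -> // : (fun p => \sum_(i <- [::]) F i p) = fun=> 0.
  by apply/funext => q; rewrite big_nil.
rewrite big_cons -IH -(d_zbarD p (FP i) (cpoly_sum r xpredT FP)).
have -> // : (fun p => \sum_(j <- i :: r) F j p) =
  (fun p => F i p + \sum_(j <- r) F j p).
by apply/funext => q; rewrite big_cons.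
Qed.

End poly_functions.

(** * Solving (Delta - 2) u = -2 f for monomials *)

Ltac cpoly_tac := repeat match goal with
  | H : cpoly ?F |- cpoly ?F => exact H
  | H : forall i, cpoly (?F i) |- cpoly (?F _) => exact (H _)
  | |- cpoly (@cplx _) => exact: cpoly_cplx
  | |- cpoly (fun=> ?c) => exact: (cpoly_cst c)
  | |- cpoly (d_z _) => apply: cpoly_d_z
  | |- cpoly (d_zbar _) => apply: cpoly_d_zbar
  | |- cpoly (fun p => @?F p + - @?G p) => apply: (@cpolyB _ F G)
  | |- cpoly (fun p => @?F p + @?G p) => apply: (@cpolyD _ F G)
  | |- cpoly (fun p => @?F p * @?G p) => apply: (@cpolyM _ F G)
  | |- cpoly (fun p => - @?F p) => apply: (@cpolyN _ F)
  | |- cpoly (fun p => @?F p ^+ ?n) => apply: (@cpolyX _ F n)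
  | |- cpoly (fun p => ((@?F p)^*)%C) => apply: (@cpoly_conj _ F)
  | |- cpoly (fun p => \sum_(i <- _ | _) _) => apply: cpoly_sum => ?
  | |- cpoly (fun p => ?f p) => change (cpoly f)
  end.

(* [t = 1 - |z|^2] as a complex number; [tR] below is its real version. *)
Definition tC (R : realType) (p : R * R) : R[i] := (1 - sqnorm p)%:C.

(** Derivatives, [cplx p] and [tC p] become variables first, so that [ring] faces a polynomial
    identity over [R[i]]. *)
Ltac cring := intros; repeat match goal with
  | |- context [d_z ?F ?p] => generalize (d_z F p); intro
  | |- context [d_zbar ?F ?p] => generalize (d_zbar F p); intro
  | |- context [Defs.cplx ?p] => generalize (cplx p); intro
  | |- context [tC ?p] => generalize (tC p); intro
  end; ring.

Section resolvent.
Variable R : realType.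
Local Notation C := R[i].
Implicit Types (p : R * R) (F G : R * R -> C).

Lemma tCE p : tC p = 1 - cplx p * (cplx p)^*%C.
Proof.
by apply/eqP; rewrite eq_complex /=; apply/andP; split; apply/eqP;
  rewrite /sqnorm; ring.
Qed.

Lemma cpoly_tC : cpoly (@tC R).
Proof.
have : cpoly (fun p : R * R => 1 - cplx p * (cplx p)^*%C) by cpoly_tac.
by apply: cpoly_ext => p; rewrite tCE.
Qed.

Lemma d_z_tC p : d_z (@tC R) p = - (cplx p)^*%C.
Proof.
have -> : @tC R = fun p => 1 - cplx p * (cplx p)^*%C by apply/funext => q;
  exact: tCE.
rewrite d_zB ?d_z_cst ?d_zM ?d_z_cplx ?d_z_zbar; cpoly_tac.
by rewrite mul1r mulr0 addr0 sub0r.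
Qed.

Lemma d_zbar_tC p : d_zbar (@tC R) p = - cplx p.
Proof.
have -> : @tC R = fun p => 1 - cplx p * (cplx p)^*%C by apply/funext => q;
  exact: tCE.
rewrite d_zbarB ?d_zbar_cst ?d_zbarM ?d_zbar_cplx ?d_zbar_zbar; cpoly_tac.
by ring.
Qed.

(* This is [(Delta - 2) F], because [4 / rho = t^2]. *)
Definition Lop F p : C := tC p ^+ 2 * d_z (d_zbar F) p - 2 * F p.

Lemma LopD F G p : cpoly F -> cpoly G ->
  Lop (fun p => F p + G p) p = Lop F p + Lop G p.
Proof.
move=> FP GP; rewrite /Lop.
have -> : d_zbar (fun p => F p + G p) = fun p => d_zbar F p + d_zbar G p.
  by apply/funext => q; exact: d_zbarD.
by rewrite d_zD; cpoly_tac; cring.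
Qed.

Lemma LopZ c F p : cpoly F -> Lop (fun p => c * F p) p = c * Lop F p.
Proof.
move=> FP; rewrite /Lop.
have -> : d_zbar (fun p => c * F p) = fun p => c * d_zbar F p.
  by apply/funext => q; exact: d_zbarZ.
by rewrite d_zZ; cpoly_tac; cring.
Qed.

Lemma Lop_sum I (r : seq I) (F : I -> R * R -> C) p : (forall i, cpoly (F i)) ->
  Lop (fun p => \sum_(i <- r) F i p) p = \sum_(i <- r) Lop (F i) p.
Proof.
move=> FP; rewrite /Lop.
have -> : d_zbar (fun p => \sum_(i <- r) F i p) =
    fun p => \sum_(i <- r) d_zbar (F i) p.
  by apply/funext => q; exact: d_zbar_sum.
rewrite d_z_sum => [|i]; last exact: cpoly_d_zbar.
by rewrite !mulr_sumr -sumrB.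
Qed.

Definition zpow (b : bool) (m : nat) p : C :=
  (if b then cplx p else (cplx p)^*%C) ^+ m.

Lemma cpoly_zpow b m : cpoly (zpow b m).
Proof. by rewrite /zpow; case: b; cpoly_tac. Qed.

(* [Delta - 2] is triangular on the span of the [z^m t^k] ([zpow false] being a
   power of [zbar]), hence invertible there by recursion on [k]. *)
Lemma Lop_zpow b m k p :
  Lop (fun p => tC p ^+ 2 * (zpow b m p * tC p ^+ k)) p =
  (k * (k + 3))%:R * (zpow b m p * tC p ^+ (k + 2)) -
  ((k + 2) * (k + 2 + m))%:R * (zpow b m p * tC p ^+ (k + 3)).
Proof.
have tP := cpoly_tC.
have -> : (fun p => tC p ^+ 2 * (zpow b m p * tC p ^+ k)) =
    fun p => zpow b m p * tC p ^+ (k + 2).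
  by apply/funext => q; rewrite exprD; cring.
rewrite /Lop /zpow; case: b.
- have -> : d_zbar (fun p => cplx p ^+ m * tC p ^+ (k + 2)) =
      fun p => (k + 2)%:R * - (cplx p ^+ m.+1 * tC p ^+ k.+1).
    apply/funext => q; rewrite d_zbarM; cpoly_tac.
    rewrite !d_zbarX ?d_zbar_cplx ?d_zbar_tC; cpoly_tac.
    by rewrite addnS addn1 -pred_Sn (exprS (cplx q)); cring.
  have -> : d_z (fun p => (k + 2)%:R * - (cplx p ^+ m.+1 * tC p ^+ k.+1)) p =
      (k + 2)%:R * - (m.+1%:R * cplx p ^+ m * tC p ^+ k.+1 +
        cplx p ^+ m.+1 * (k.+1%:R * tC p ^+ k * - (cplx p)^*%C)).
    rewrite d_zZ; cpoly_tac; congr (_ * _).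
    have -> : (fun p : R * R => - (cplx p ^+ m.+1 * tC p ^+ k.+1)) =
       (fun p => -1 * (cplx p ^+ m.+1 * tC p ^+ k.+1)).
      by apply/funext => q; rewrite mulN1r.
    rewrite d_zZ ?d_zM ?d_zX ?d_z_cplx ?d_z_tC; cpoly_tac.
    by rewrite /= mulN1r mulr1.
  (* The product [z zbar] is replaced by [1 - t]; this keeps the image inside the span of the
     [z^m t^k]. *)
  have -> : cplx p ^+ m.+1 * (k.+1%:R * tC p ^+ k * - (cplx p)^*%C) =
    cplx p ^+ m * (k.+1%:R * tC p ^+ k * (tC p - 1)).
    by rewrite tCE exprS; cring.
  rewrite !natrM !natrD -!natr1 !exprD ?(exprS _ k.+1) !(exprS _ k) ?(exprS _
    m); cring.
- have -> : d_zbar (fun p => (cplx p)^*%C ^+ m * tC p ^+ (k + 2)) =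
      fun p => m%:R * (cplx p)^*%C ^+ m.-1 * tC p ^+ k.+2 -
        (k + 2)%:R * (cplx p * (cplx p)^*%C ^+ m * tC p ^+ k.+1).
    apply/funext => q; rewrite d_zbarM; cpoly_tac.
    rewrite !d_zbarX ?d_zbar_zbar ?d_zbar_tC; cpoly_tac.
    by rewrite addnS addn1 -pred_Sn; cring.
  have -> : d_z (fun p => m%:R * (cplx p)^*%C ^+ m.-1 * tC p ^+ k.+2 -
        (k + 2)%:R * (cplx p * (cplx p)^*%C ^+ m * tC p ^+ k.+1)) p =
      m%:R * (cplx p)^*%C ^+ m.-1 * (k.+2%:R * tC p ^+ k.+1 * - (cplx p)^*%C) -
      (k + 2)%:R * ((cplx p)^*%C ^+ m * tC p ^+ k.+1 +
        cplx p * (cplx p)^*%C ^+ m * (k.+1%:R * tC p ^+ k * - (cplx p)^*%C)).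
    rewrite d_zB; cpoly_tac.
    rewrite d_zM; cpoly_tac; rewrite d_zZ; cpoly_tac; rewrite d_zX; cpoly_tac.
    rewrite d_z_zbar d_zX; cpoly_tac; rewrite d_z_tC.
    rewrite d_zZ; cpoly_tac; rewrite d_zM; cpoly_tac; rewrite d_zM; cpoly_tac.
    rewrite d_zX; cpoly_tac; rewrite d_z_zbar d_zX; cpoly_tac.
    by rewrite d_z_tC d_z_cplx /=; cring.
  have -> : cplx p * (cplx p)^*%C ^+ m * (k.+1%:R * tC p ^+ k * - (cplx p)^*%C)
    =
    (cplx p)^*%C ^+ m * (k.+1%:R * tC p ^+ k * (tC p - 1)).
    by rewrite tCE; cring.
  (* For [m = 0] the truncated predecessor is harmless: the factor [m] kills both sides. *)
  have -> : m%:R * (cplx p)^*%C ^+ m.-1 *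
      (k.+2%:R * tC p ^+ k.+1 * - (cplx p)^*%C) =
      - (m%:R * (cplx p)^*%C ^+ m * (k.+2%:R * tC p ^+ k.+1)).
    by case: m => [|m] /=; rewrite ?exprS; cring.
  rewrite !natrM !natrD -!natr1 !exprD ?(exprS _ k.+1) !(exprS _ k) ?(exprS _
    m); cring.
Qed.

(** The factor [t^2] is the boundary decay of a bounded solution: [Delta - 2] acts on [t^s] with
    leading coefficient [(s - 2)(s + 1)], and the other root [-1] blows up. *)
Definition solvable F := exists2 W, cpoly W &
  forall p, Lop (fun p => tC p ^+ 2 * W p) p = - 2 * F p.

Lemma solvableD F G : solvable F -> solvable G -> solvable (fun p => F p + G p).
Proof.
have tP := cpoly_tC.
move=> [V VP VE] [W WP WE]; exists (fun p => V p + W p); first by cpoly_tac.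
move=> p; rewrite mulrDr -VE -WE -LopD; cpoly_tac.
have -> // : (fun p => tC p ^+ 2 * (V p + W p)) =
  (fun p => tC p ^+ 2 * V p + tC p ^+ 2 * W p).
by apply/funext => q; rewrite mulrDr.
Qed.

Lemma solvableZ c F : solvable F -> solvable (fun p => c * F p).
Proof.
have tP := cpoly_tC.
move=> [V VP VE]; exists (fun p => c * V p); first by cpoly_tac.
move=> p; rewrite mulrCA -VE -LopZ; cpoly_tac.
have -> // : (fun p => tC p ^+ 2 * (c * V p)) = (fun p => c * (tC p ^+ 2 * V
  p)).
by apply/funext => q; rewrite mulrCA.
Qed.

Lemma solvable_ext F G : F =1 G -> solvable F -> solvable G.
Proof. by move=> /funext ->. Qed.

Lemma solvable_Lop W : cpoly W -> solvable (Lop (fun p => tC p ^+ 2 * W p)).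
Proof.
move=> WP; apply: (@solvable_ext (fun p => - 2^-1 *
  (- 2 * Lop (fun p => tC p ^+ 2 * W p) p))) => [p|].
  by rewrite mulrA mulrNN mulVf ?mul1r // pnatr_eq0.
apply: solvableZ; exists (fun p => -2 * (-2 * W p))  => [|p].
  by cpoly_tac.
have tP := cpoly_tC.
have -> : (fun p => tC p ^+ 2 * (-2 * (-2 * W p))) =
  (fun p => (-2) * ((-2) * (tC p ^+ 2 * W p))) by apply/funext => q; cring.
by rewrite !LopZ; cpoly_tac.
Qed.

(** In [Lop_zpow] the coefficient [k (k + 3)] vanishes at [k = 0], which solves the source [z^m t^3]
    outright. Each higher power of [t] follows by dividing by the nonzero coefficient of the top
    term. *)
Lemma solvable_zpow b m k : solvable (fun p => zpow b m p * tC p ^+ (k + 3)).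
Proof.
have tP := cpoly_tC; have zP := cpoly_zpow b m.
elim: k => [|k IH].
  apply: (@solvable_ext (fun p => - ((2 * (2 + m))%:R)^-1 *
      Lop (fun p => tC p ^+ 2 * (zpow b m p * tC p ^+ 0)) p)) => [p|].
    rewrite Lop_zpow mul0n !add0n mul0r sub0r mulrNN mulKf //.
  by apply/solvableZ/solvable_Lop; cpoly_tac.
apply: (@solvable_ext (fun p => (- ((k.+1 + 2) * (k.+1 + 2 + m))%:R)^-1 *
    (Lop (fun p => tC p ^+ 2 * (zpow b m p * tC p ^+ k.+1)) p +
    - (k.+1 * (k.+1 + 3))%:R * (zpow b m p * tC p ^+ (k + 3))))) => [p|].
  rewrite Lop_zpow; set a := _%:R * (zpow b m p * tC p ^+ (k.+1 + 2)).
  have -> : - (k.+1 * (k.+1 + 3))%:R * (zpow b m p * tC p ^+ (k + 3)) = - a.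
    by rewrite /a (addSnnS k 2) mulNr.
  rewrite addrAC subrr add0r -mulNr mulKf //.
apply/solvableZ/solvableD; last exact: solvableZ.
by apply: solvable_Lop; cpoly_tac.
Qed.

(** A factor [|z|^2 = 1 - t] is traded for a difference of two consecutive powers of [t], so the
    induction on [i] runs over all [k]. *)
Lemma solvable_zpow_sq b m k i : solvable (fun p =>
  zpow b m p * tC p ^+ (k + 3) * (cplx p * (cplx p)^*%C) ^+ i).
Proof.
elim: i k => [|i IH] k.
  by apply: solvable_ext (solvable_zpow b m k) => p; rewrite expr0 mulr1.
apply: solvable_ext (solvableD (IH k) (solvableZ (-1) (IH k.+1))) => p.
by rewrite addSn (exprS (tC p)) (exprS (_ * _)) tCE; cring.
Qed.

Lemma solvable_zzbar i j : solvable (fun p =>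
  tC p ^+ 4 * ((cplx p)^*%C ^+ i * cplx p ^+ j)).
Proof.
case: (leqP i j) => ij.
- apply: solvable_ext (solvable_zpow_sq true (j - i) 1 i) => p.
  rewrite /zpow -[in X in _ = X](subnKC ij) (exprD _ i) exprMn; cring.
- apply: solvable_ext (solvable_zpow_sq false (i - j) 1 j) => p.
  rewrite /zpow -[in X in _ = X](subnKC (ltnW ij)) (exprD _ j) exprMn; cring.
Qed.

End resolvent.

(** * Calculus along lines *)

Section lines.
Variable R : realType.
Implicit Types (p q v w : R * R) (f g : R * R -> R).

Lemma is_derive_line f q v h d : is_derive (h *: v + q) v f d ->
  is_derive h 1 (fun s : R => f (s *: v + q)) d.
Proof.
move=> [fd <-];
  have E : (fun k : R => k^-1 *: (((fun s : R => f (s *: v + q)) \o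
      shift h) (k *: 1) - f (h *: v + q))) =
    (fun k : R => k^-1 *: ((f \o shift (h *: v + q)) (k *: v) - f (h *: v +
      q))).
  apply/funext => k /=; congr (_ *: (f _ - _)).
  by rewrite scalerDl addrA [k%:A]mulr1.
split; first by rewrite /derivable E.
by rewrite /derive E.
Qed.

Lemma is_derive_shift f q v a d : is_derive (q + a) v f d ->
  is_derive q v (fun s => f (s + a)) d.
Proof.
move=> [fd <-]; have E : (fun k : R => k^-1 *: (((fun s => f (s + a)) \o
      shift q) (k *: v) - f (q + a))) =
    (fun k : R => k^-1 *: ((f \o shift (q + a)) (k *: v) - f (q + a))).
  by apply/funext => k /=; rewrite addrA.
split; first by rewrite /derivable E.
by rewrite /derive E.
Qed.

Lemma line_mvt f df q v h : 0 < h ->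
  (forall s, 0 <= s <= h -> is_derive (s *: v + q) v f (df (s *: v + q))) ->
  exists2 c, 0 <= c <= h & f (h *: v + q) - f q = h * df (c *: v + q).
Proof.
move=> h0 fd; pose g (s : R) := f (s *: v + q).
have gd s : 0 <= s <= h -> is_derive s 1 g (df (s *: v + q)).
  by move=> sh; apply/is_derive_line/fd.
have [| |c ch E] := @MVT R g (fun s => df (s *: v + q)) 0 h h0.
- by move=> s /itvP sh; apply: gd; rewrite !sh.
- apply: derivable_within_continuous => s /itvP sh.
  by have [] := gd s _; rewrite ?sh.
exists c; first by rewrite !(itvP ch).
by move: E; rewrite /g scale0r add0r subr0 mulrC.
Qed.

Lemma near_plane p v w (U : set (R * R)) : nbhs p U ->
  exists2 r, 0 < r & forall s t, `|s| <= r -> `|t| <= r -> U (s *: v + (t *: w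
    + p)).
Proof.
move=> /nbhs_ballP[e /= e0 eU].
pose r := e / (`|v| + `|w| + 1).
have d0 : 0 < `|v| + `|w| + 1 by rewrite ltr_wpDl // addr_ge0.
have r0 : 0 < r by rewrite divr_gt0.
exists r => // s t sr tR; apply: eU; rewrite -ball_normE /ball_ /=.
rewrite addrA [_ + p]addrC opprD addrA subrr sub0r normrN.
apply: le_lt_trans (ler_normD _ _) _; rewrite !normrZ.
have -> : e = r * `|v| + r * `|w| + r.
  by rewrite -[X in _ + X]mulr1 -!mulrDr divfK // gt_eqF.
by rewrite ltr_pwDr // lerD // ler_wpM2r.
Qed.

(** Mean value theorem for [q |-> f (q + h w) - f q] along [v], then for [fv] along [w]. The
    left-hand side is symmetric in [v] and [w]. *)
Lemma mixed_mvt f fv fvw p v w h : 0 < h ->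
  (forall s t, 0 <= s <= h -> 0 <= t <= h ->
    is_derive (s *: v + (t *: w + p)) v f (fv (s *: v + (t *: w + p)))) ->
  (forall s t, 0 <= s <= h -> 0 <= t <= h ->
    is_derive (s *: v + (t *: w + p)) w fv (fvw (s *: v + (t *: w + p)))) ->
  exists s t, [/\ 0 <= s <= h, 0 <= t <= h &
    f (h *: v + (h *: w + p)) - f (h *: v + p) - f (h *: w + p) + f p =
    h * (h * fvw (s *: v + (t *: w + p)))].
Proof.
move=> h0 d1 d2.
have h00 : (0 : R) <= 0 <= h by rewrite lexx ltW.
have h01 : 0 <= h <= h by rewrite lexx ltW.
pose g q := f (q + h *: w) - f q.
have [s sh|s sh E1] :=
    @line_mvt g (fun q => fv (q + h *: w) - fv q) p v h h0.
  have A1 : is_derive (s *: v + p) v (fun q => f (q + h *: w))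
      (fv (s *: v + p + h *: w)).
    apply: is_derive_shift; rewrite -addrA [p + _]addrC.
    exact: d1.
  have A2 : is_derive (s *: v + p) v f (fv (s *: v + p)).
    by have := d1 s 0 sh h00; rewrite scale0r add0r.
  exact: is_deriveB A1 A2.
have [t th|t th E2] := @line_mvt fv fvw (s *: v + p) w h h0.
  by have := d2 s t sh th; rewrite addrCA.
exists s, t; split=> //.
rewrite [in RHS]addrCA -E2.
transitivity (g (h *: v + p) - g p).
  rewrite /g [p + _]addrC -[h *: v + p + _]addrA [p + _]addrC; ring.
by rewrite E1 [_ + h *: w]addrC.
Qed.

(** Schwarz's theorem: by [mixed_mvt] in both orders, the same second difference is [h^2] times
    [fvw] at one point and [fwv] at another, both close to [p]; continuity concludes. *)
Lemma mixed_derivatives f fv fw fvw fwv p v w (U : set (R * R)) :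
  nbhs p U ->
  (forall q, U q -> [/\ is_derive q v f (fv q), is_derive q w f (fw q),
     is_derive q w fv (fvw q) & is_derive q v fw (fwv q)]) ->
  {for p, continuous fvw} -> {for p, continuous fwv} -> fvw p = fwv p.
Proof.
move=> pU d c1 c2; apply/eqP; rewrite -subr_eq0 -normr_eq0; apply/eqP.
apply/le_anti; rewrite normr_ge0 andbT; apply/ler_addgt0Pl => e e0.
rewrite addr0.
have e20 : 0 < e / 2 by rewrite divr_gt0.
have nU : nbhs p [set q | [/\ U q, `|fvw p - fvw q| < e / 2 &
    `|fwv p - fwv q| < e / 2]].
  near=> q; split; near: q => //.
  - by move/cvgrPdist_lt : c1; apply.
  - by move/cvgrPdist_lt : c2; apply.
have [r r0 rU] := near_plane v w nU.
have rr s : 0 <= s <= r -> `|s| <= r by move=> /andP[s0 sr]; rewrite ger0_norm.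
have rw s t : 0 <= s <= r -> 0 <= t <= r ->
  [/\ U (s *: v + (t *: w + p)), `|fvw p - fvw (s *: v + (t *: w + p))| < e / 2
    &
    `|fwv p - fwv (s *: v + (t *: w + p))| < e / 2].
  by move=> sr tR; apply: rU; exact: rr.
have [||s [t [sr tR E1]]] := @mixed_mvt f fv fvw p v w r r0.
- by move=> s t sr tR; have [/d[]] := rw s t sr tR.
- by move=> s t sr tR; have [/d[]] := rw s t sr tR.
have [||s' [t' [sr' tr' E2]]] := @mixed_mvt f fw fwv p w v r r0.
- by move=> s' t' sr' tr'; rewrite addrCA; have [/d[]] := rw t' s' tr' sr'.
- by move=> s' t' sr' tr'; rewrite addrCA; have [/d[]] := rw t' s' tr' sr'.
have E : fvw (s *: v + (t *: w + p)) = fwv (t' *: v + (s' *: w + p)).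
  apply: (mulfI (lt0r_neq0 r0)); apply: (mulfI (lt0r_neq0 r0)).
  by rewrite -E1 [t' *: v + _]addrCA -E2 [r *: w + (r *: v + p)]addrCA; ring.
have [_ B1 _] := rw s t sr tR.
have [_ _ B2] := rw t' s' tr' sr'.
rewrite -E in B2.
have -> : fvw p - fwv p = (fvw p - fvw (s *: v + (t *: w + p))) -
    (fwv p - fvw (s *: v + (t *: w + p))) by ring.
by apply: le_trans (ler_normB _ _) _; rewrite [leRHS](splitr e) lerD // ltW.
Unshelve. all: by end_near. Qed.

(** As [f' 0 = 0] at the minimum, [c < 0] would make [f'] negative just to the right of 0, and [f]
    would drop below [f 0]. *)
Lemma second_derivative_min (f f' : R -> R) (c r : R) : 0 < r ->
  (forall s : R, `|s| < r -> is_derive s 1 f (f' s)) -> is_derive (0 : R) 1 f'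
    c ->
  (forall s, `|s| < r -> f 0 <= f s) -> 0 <= c.
Proof.
move=> r0 fd [f'd f'c] fmin; rewrite leNgt; apply/negP => c0.
have in_r (s : R) : s \in `](- r), r[ -> `|s| < r
  by rewrite in_itv /= ltr_norml.
have f'0 : f' 0 = 0.
  have Z : is_derive (0 : R) 1 f 0.
    apply: (@derive1_at_min _ f (- r) r).
    - by rewrite ge0_cp // ltW.
    - by move=> s /in_r /fd[].
    - by rewrite in_itv /= oppr_lt0 r0.
    - by move=> s /in_r /fmin.
  have [|_ <-] := fd 0; first by rewrite normr0.
  by have [_ ->] := Z.
have : \forall h \near (0 : R)^', h^-1 *: (f' (h *: 1 + 0) - f' 0) < 0.
  move: f'd => /(@cvgr_lt _ _ _ _ (fun h => h^-1 *: (f' (h *: 1 + 0) - f' 0)) _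
    ).
  by apply; rewrite -/(derive f' 0 1) f'c.
move=> /nbhs_ballP[d /= d0 dP].
pose h := Num.min d r / 2.
have dr0 : 0 < Num.min d r by rewrite lt_min d0 r0.
have h0 : 0 < h by rewrite divr_gt0.
have hd : h < Num.min d r by rewrite ltr_pdivrMr // ltr_pMr // ltr1n.
move: (hd); rewrite lt_min => /andP[hd1 hr1].
have neg (s : R) : 0 < s <= h -> f' s < 0.
  move=> /andP[s0 sh].
  have := dP s; rewrite /ball /= sub0r normrN gtr0_norm //.
  move=> /(_ (le_lt_trans sh hd1) (lt0r_neq0 s0)).
  rewrite addr0 f'0 subr0 [s *: 1]mulr1 /GRing.scale /=.
  by rewrite pmulr_rlt0 // invr_gt0.
have abs (s : R) : 0 <= s <= h -> `|s| < r.
  by move=> /andP[s0 sh]; rewrite ger0_norm // (le_lt_trans sh).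
have [||s sh E] := @MVT R f f' 0 h h0.
- by move=> s /itvP sh; apply: fd; apply: abs; rewrite !sh.
- apply: derivable_within_continuous => s /itvP sh.
  by have [] := fd s _; first by apply: abs; rewrite !sh.
have h0h : 0 <= h <= h by rewrite lexx ltW.
have := fmin h (abs h h0h).
by rewrite -subr_ge0 E subr0 pmulr_lge0 // leNgt neg // (itvP sh) ltW ?(itvP
  sh).
Qed.

End lines.

(** * The maximum principle *)

Section maximum_principle.
Variable R : realType.
Local Notation C := R[i].
Implicit Types (p q v w : R * R).

Lemma rpoly_sqnorm : rpoly (@sqnorm R).
Proof.
have := rpolyD (rpolyM (rpoly_fst R) (rpoly_fst R))
  (rpolyM (rpoly_snd R) (rpoly_snd R)).
by apply: rpoly_ext => p; rewrite /sqnorm !expr2.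
Qed.

Lemma sqnorm_ge0 p : 0 <= sqnorm p.
Proof. by rewrite addr_ge0 ?sqr_ge0. Qed.

Lemma disk_gt0 p : disk p -> 0 < 1 - sqnorm p.
Proof. by rewrite subr_gt0. Qed.

Lemma nbhs_disk p : disk p -> nbhs p (@disk R).
Proof.
move=> pD; have := @rpoly_continuous R _ rpoly_sqnorm p.
by move=> /(_ [set x | x < 1]); apply; exact: lt_nbhsl.
Qed.

Lemma disk_line p v : disk p ->
  exists2 r, 0 < r & forall s : R, `|s| < r -> disk (s *: v + p).
Proof.
move=> /nbhs_disk /(near_plane v v)[r r0 rP]; exists r => // s sr.
by have := rP s 0; rewrite scale0r add0r normr0; apply; rewrite ltW.
Qed.

Lemma is_derive_sqnorm p v :
  is_derive p v (@sqnorm R) (2 * (p.1 * v.1 + p.2 * v.2)).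
Proof.
have d1 := is_derive_fst p v; have d2 := is_derive_snd p v.
have := is_deriveD (is_deriveM d1 d1) (is_deriveM d2 d2).
have -> : (fst * fst + snd * snd : R * R -> R) = @sqnorm R.
  by apply/funext => q; rewrite /sqnorm !expr2.
by move=> H; apply: (is_derive_eq H); rewrite /GRing.scale /=; ring.
Qed.

Lemma is_derive_inv_t p v : disk p ->
  is_derive p v (fun q : R * R => (1 - sqnorm q)^-1)
    (2 * (p.1 * v.1 + p.2 * v.2) * (1 - sqnorm p) ^- 2).
Proof.
move=> pD; have n0 : 1 - sqnorm p != 0 by rewrite gt_eqF ?disk_gt0.
have d := is_deriveB (is_derive_cst (1 : R) p v) (is_derive_sqnorm p v).
have dv : derivable (fun q => 1 - sqnorm q) p v by case: d.
apply: DeriveDef;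
  first exact: (@derivableV _ _ (fun q => 1 - sqnorm q) p v n0 dv).
rewrite (@deriveV _ _ (fun q => 1 - sqnorm q) p v n0 dv).
have [_ ->] := d.
by rewrite /GRing.scale /=; field.
Qed.

Let barrier p : R := 2 * (1 - sqnorm p)^-1 - 1.
Let barrier_d v p : R :=
  4 * (p.1 * v.1 + p.2 * v.2) * ((1 - sqnorm p)^-1 * (1 - sqnorm p)^-1).
Let barrier_dd v p : R :=
  4 * (v.1 ^+ 2 + v.2 ^+ 2) * (1 - sqnorm p) ^- 2 +
  16 * (p.1 * v.1 + p.2 * v.2) ^+ 2 * (1 - sqnorm p) ^- 3.

Lemma is_derive_barrier p v : disk p -> is_derive p v barrier (barrier_d v p).
Proof.
move=> pD; have n0 : 1 - sqnorm p != 0 by rewrite gt_eqF ?disk_gt0.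
have := is_deriveB (is_deriveM (is_derive_cst (2 : R) p v) (is_derive_inv_t v
  pD))
  (is_derive_cst (1 : R) p v).
move=> H; apply: (is_derive_eq H); rewrite /barrier_d /GRing.scale /=; field.
exact: n0.
Qed.

Lemma is_derive_barrier_d p v : disk p ->
  is_derive p v (barrier_d v) (barrier_dd v p).
Proof.
move=> pD; have n0 : 1 - sqnorm p != 0 by rewrite gt_eqF ?disk_gt0.
have d1 := is_derive_fst p v; have d2 := is_derive_snd p v.
have c1 := is_derive_cst v.1 p v; have c2 := is_derive_cst v.2 p v.
have c4 := is_derive_cst (4 : R) p v.
have di := is_derive_inv_t v pD.
have := is_deriveM (is_deriveM c4 (is_deriveD (is_deriveM d1 c1)
  (is_deriveM d2 c2))) (is_deriveM di di).
move=> H; apply: (is_derive_eq H); rewrite /barrier_dd !fctE /GRing.scale /=;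
  field.
exact: n0.
Qed.

Lemma compact_sublevel (r : R) : compact [set p : R * R | sqnorm p <= r].
Proof.
have K := compact_setX (@segment_compact R (- (1 + `|r|)) (1 + `|r|))
  (@segment_compact R (- (1 + `|r|)) (1 + `|r|)).
apply: subclosed_compact K _.
  apply: (@preimage_closed _ _ (@sqnorm R) [set x : R | x <= r]).
    by move=> p _; exact: rpoly_continuous rpoly_sqnorm p.
  exact: closed_le.
have bnd (x : R) : x ^+ 2 <= r -> x \in `[- (1 + `|r|), 1 + `|r|].
  move=> xr; rewrite in_itv /= -ler_norml.
  rewrite -(ler_pXn2r (n := 2)) ?nnegrE // ?addr_ge0 // real_normK ?num_real //.
  by apply: (le_trans xr); have := ler_norm r; have := normr_ge0 r; nra.
move=> p /= pr; split; apply: bnd; apply: le_trans pr; rewrite /sqnorm.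
  by rewrite lerDl sqr_ge0.
by rewrite lerDr sqr_ge0.
Qed.

(* The barrier [2 / t - 1] is the radial solution of [(Delta - 2) u = 0] that
   blows up at the boundary; adding a small multiple of it to [w] forces the
   minimum to be attained inside the disk. *)
Lemma maximum_principle (w : R * R -> R) (wd wdd : R * R -> R * R -> R)
  (M : R) :
  (forall p, disk p -> {for p, continuous w}) ->
  (forall v p, v = ex R \/ v = ey R -> disk p ->
    is_derive p v w (wd v p) /\ is_derive p v (wd v) (wdd v p)) ->
  (forall p, disk p -> - M <= w p) ->
  (forall p, disk p ->
    (1 - sqnorm p) ^+ 2 / 4 * (wdd (ex R) p + wdd (ey R) p) <= 2 * w p) ->
  forall p, disk p -> 0 <= w p.
Proof.
move=> wc wD wM wL p0 p0D; rewrite leNgt; apply/negP => wp0.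
wlog M0 : M wM / 0 < M.
  move=> /(_ (`|M| + 1)); apply; last by rewrite ltr_wpDl.
  move=> p pD; apply: le_trans (wM p pD).
  by rewrite lerN2; have := ler_norm M; lra.
pose t p : R := 1 - sqnorm p.
have t0 p : disk p -> 0 < t p by exact: disk_gt0.
(* Chosen so that [e * (2 / t p0)] is [- w p0 / 2]: the barrier cancels only half of the negative
   value at [p0]. *)
pose e := - w p0 * t p0 / 4.
have e0 : 0 < e by rewrite divr_gt0 // mulr_gt0 ?t0 // oppr_gt0.
pose we p := w p + e * barrier p.
have we0 : we p0 < 0.
  have -> : we p0 = w p0 / 2 - e.
    rewrite /we /barrier -/(t p0) /e; field; by rewrite gt_eqF ?t0.
  by rewrite subr_lt0 (lt_trans _ e0) // pmulr_llt0.
(* Where [t <= d], [e * (2 / t - 1)] is at least [(M + e) - e = M], which outweighs the lower bound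
   [- M] of [w]. A negative minimum must thus lie in the compact set [t >= d]. *)
pose d := 2 * e / (M + e).
have Me0 : 0 < M + e by rewrite addr_gt0.
have d0 : 0 < d by rewrite divr_gt0 // mulr_gt0.
have outside p : disk p -> t p <= d -> 0 <= we p.
  move=> pD tp; have tp0 := t0 p pD.
  have : (M + e) / (2 * e) <= (t p)^-1.
    by rewrite -[X in X <= _]invrK invf_div lef_pV2 // posrE.
  move=> /(ler_wpM2l (ltW e0)) h2.
  have E : e * ((M + e) / (2 * e)) = (M + e) / 2 by field; rewrite gt_eqF.
  rewrite E in h2.
  have := wM p pD; rewrite /we /barrier -/(t p); lra.
pose K := [set p : R * R | sqnorm p <= 1 - d].
have KD p : K p -> disk p by rewrite /K /disk /= => /le_lt_trans; apply;
  rewrite gtrBl.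
have Kp0 : K p0.
  rewrite /K /= leNgt; apply/negP => h.
  have := outside p0 p0D; rewrite /t => /(_ _)/(lt_le_trans we0).
  rewrite ltxx => F; apply: notF; apply: F; lra.
have bc p : disk p -> {for p, continuous barrier}.
  move=> pD; have [bd _] := is_derive_barrier (ex R) pD.
  apply: cvgB; last exact: cvg_cst.
  apply: cvgM; first exact: cvg_cst.
  apply: cvgV; first by rewrite gt_eqF // disk_gt0.
  apply: cvgB; first exact: cvg_cst.
  exact: (@rpoly_continuous R _ rpoly_sqnorm p).
have [||p1 p1K p1min] :=
  @compact_EVT_min _ R we K _ (@compact_sublevel (1 - d)).
- by exists p0.
- apply/continuous_in_subspaceT => p; rewrite inE => /KD pD.
  apply: cvgD; first exact: wc.
  by apply: cvgM; [exact: cvg_cst|exact: bc].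
rewrite inE in p1K.
have p1D := KD _ p1K.
have p1min' p : disk p -> we p1 <= we p.
  move=> pD; have [pK|pK] := leP (sqnorm p) (1 - d).
    by apply: p1min; rewrite inE.
  apply: le_trans (p1min p0 _) _; first by rewrite inE.
  apply: le_trans (ltW we0) (outside p pD _); rewrite /t; lra.
have wep1 : we p1 < 0 by apply: le_lt_trans we0; exact: p1min'.
have dd v : v = ex R \/ v = ey R -> 0 <= wdd v p1 + e * barrier_dd v p1.
  move=> vxy; have [r r0 rD] := disk_line v p1D.
  pose f' p := wd v p + e * barrier_d v p.
  have wed p : disk p -> is_derive p v we (f' p).
    move=> pD; have [d1 _] := wD v p vxy pD.
    have := is_deriveD d1 (is_deriveM (is_derive_cst e p v) (is_derive_barrier
      v pD)).
    by move=> H; apply: (is_derive_eq H); rewrite /f' /GRing.scale /=; ring.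
  apply: (@second_derivative_min R (fun s => we (s *: v + p1))
      (fun s => f' (s *: v + p1)) _ r) => //.
  - by move=> s /rD sD; apply/is_derive_line/wed.
  - apply: is_derive_line; rewrite scale0r add0r.
    have [_ d2] := wD v p1 vxy p1D.
    have := is_deriveD d2 (is_deriveM (is_derive_cst e p1 v)
      (is_derive_barrier_d v p1D)).
    by move=> H; apply: (is_derive_eq H); rewrite /GRing.scale /=; ring.
  - by move=> s /rD sD; rewrite scale0r add0r; exact: p1min'.
have dx0 := dd _ (or_introl erefl); have dy0 := dd _ (or_intror erefl).
have := wL p1 p1D; apply/negP; rewrite -ltNge.
have tp := t0 _ p1D.
have bL : (t p1) ^+ 2 / 4 * (barrier_dd (ex R) p1 + barrier_dd (ey R) p1) =
    2 * barrier p1.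
  rewrite /barrier /barrier_dd /ex /ey /= /t /sqnorm; field.
  by rewrite -/(sqnorm p1) -/(t p1) gt_eqF.
(* At the minimum the Laplacian of [we] is nonnegative, yet the differential inequality bounds it by
   [2 * we p1 < 0]. *)
have : 0 <= t p1 ^+ 2 / 4 * (wdd (ex R) p1 + e * barrier_dd (ex R) p1 +
    (wdd (ey R) p1 + e * barrier_dd (ey R) p1)).
  by apply: mulr_ge0; [rewrite divr_ge0 ?sqr_ge0|exact: addr_ge0].
have -> : t p1 ^+ 2 / 4 * (wdd (ex R) p1 + e * barrier_dd (ex R) p1 +
    (wdd (ey R) p1 + e * barrier_dd (ey R) p1)) =
  t p1 ^+ 2 / 4 * (wdd (ex R) p1 + wdd (ey R) p1) + e * (2 * barrier p1).
  by rewrite -bL; ring.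
by move: wep1; rewrite /we -/(t p1); lra.
Qed.

End maximum_principle.

(** * Uniqueness of D *)

Section uniqueness.
Variable R : realType.
Local Notation C := R[i].
Implicit Types (p q v w : R * R) (F G : R * R -> C).

Lemma Ck_on_disk2 (f : R * R -> R) v w p : Ck_on_disk 2 f ->
  v = ex R \/ v = ey R -> w = ex R \/ w = ey R -> disk p ->
  [/\ {for p, continuous f}, is_derive p v f ('D_v f p),
    is_derive p w ('D_v f) ('D_w ('D_v f) p) &
    {for p, continuous (fun q => 'D_w ('D_v f) q)}].
Proof.
move=> [fc [fd [_ [xd [xxc _] [xyc _]]] [_ [yd [yxc _] [yyc _]]]]] hv hw pD.
have [fx fy] := fd _ pD; have [fxx fxy] := xd _ pD; have [fyx fyy] := yd _ pD.
split; first exact: fc.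
- by case: hv => ->; [exact: (derivableP fx)|exact: (derivableP fy)].
- case: hv => ->; case: hw => ->.
  + exact: (derivableP fxx).
  + exact: (derivableP fxy).
  + exact: (derivableP fyx).
  + exact: (derivableP fyy).
- case: hv => ->; case: hw => ->.
  + exact: (xxc p pD).
  + exact: (xyc p pD).
  + exact: (yxc p pD).
  + exact: (yyc p pD).
Qed.

Lemma derive_mixed (f : R * R -> R) p : Ck_on_disk 2 f -> disk p ->
  'D_(ey R) ('D_(ex R) f) p = 'D_(ex R) ('D_(ey R) f) p.
Proof.
move=> f2 pD.
have hx : ex R = ex R \/ ex R = ey R by left.
have hy : ey R = ex R \/ ey R = ey R by right.
apply: (@mixed_derivatives R f ('D_(ex R) f) ('D_(ey R) f)
  (fun q => 'D_(ey R) ('D_(ex R) f) q) (fun q => 'D_(ex R) ('D_(ey R) f) q)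
  p (ex R) (ey R) (@disk R)).
- exact: nbhs_disk.
- move=> q qD.
  have [_ d1 d2 _] := Ck_on_disk2 f2 hx hy qD.
  have [_ d3 d4 _] := Ck_on_disk2 f2 hy hx qD.
  exact: And4 d1 d3 d2 d4.
- have [_ _ _ c1] := Ck_on_disk2 f2 hx hy pD; exact: c1.
- have [_ _ _ c2] := Ck_on_disk2 f2 hy hx pD; exact: c2.
Qed.

Definition lapR (f : R * R -> R) p : R :=
  'D_(ex R) ('D_(ex R) f) p + 'D_(ey R) ('D_(ey R) f) p.

(** Expanding leaves differences of mixed derivatives of each part, which cancel by Schwarz's
    theorem. For non-polynomial [F] this is where [C^2] regularity enters. *)
Lemma d_z_d_zbar_smooth F p : smooth_on_disk F -> disk p ->
  d_z (d_zbar F) p = (lapR (re_part F) p / 4) +i* (lapR (im_part F) p / 4).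
Proof.
move=> /(_ 2)[a2 b2] pD.
have hx : ex R = ex R \/ ex R = ey R by left.
have hy : ey R = ex R \/ ey R = ey R by right.
rewrite d_zE.
have Ere : re_part (d_zbar F) = 2^-1 \*:
    ('D_(ex R) (re_part F) - 'D_(ey R) (im_part F)).
  by apply/funext => q; rewrite /re_part d_zbarE /= mulrC.
have Eim : im_part (d_zbar F) = 2^-1 \*:
    ('D_(ex R) (im_part F) + 'D_(ey R) (re_part F)).
  by apply/funext => q; rewrite /im_part d_zbarE /= mulrC.
have D f v w : Ck_on_disk 2 f -> v = ex R \/ v = ey R ->
    w = ex R \/ w = ey R -> derivable ('D_v f) p w.
  by move=> f2 hv hw; have [_ _ [fd _] _] := Ck_on_disk2 f2 hv hw pD; exact: fd.
have DB (f g : R * R -> R) w : derivable f p w -> derivable g p w ->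
    'D_w (2^-1 \*: (f - g)) p = 2^-1 * ('D_w f p - 'D_w g p).
  move=> fd gd; rewrite (deriveZ _ (derivableB fd gd)).
  by rewrite (deriveB fd gd).
have DD (f g : R * R -> R) w : derivable f p w -> derivable g p w ->
    'D_w (2^-1 \*: (f + g)) p = 2^-1 * ('D_w f p + 'D_w g p).
  move=> fd gd; rewrite (deriveZ _ (derivableD fd gd)).
  by rewrite (deriveD fd gd).
rewrite Ere Eim.
rewrite (DB _ _ _ (D _ _ _ a2 hx hx) (D _ _ _ b2 hy hx)).
rewrite (DB _ _ _ (D _ _ _ a2 hx hy) (D _ _ _ b2 hy hy)).
rewrite (DD _ _ _ (D _ _ _ b2 hx hx) (D _ _ _ a2 hy hx)).
rewrite (DD _ _ _ (D _ _ _ b2 hx hy) (D _ _ _ a2 hy hy)).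
have key (axx ayy bxx byy axy ayx bxy byx : R) : ayx = axy -> byx = bxy ->
    ((2^-1 * (axx - bxy) + 2^-1 * (byx + ayy)) / 2) +i*
    ((2^-1 * (bxx + axy) - 2^-1 * (ayx - byy)) / 2) =
    ((axx + ayy) / 4) +i* ((bxx + byy) / 4).
  by move=> -> ->; congr (_ +i* _); field.
exact: key (derive_mixed a2 pD) (derive_mixed b2 pD).
Qed.

Lemma laplacian_smooth F p : smooth_on_disk F -> disk p ->
  laplacian F p = ((1 - sqnorm p) ^+ 2 / 4 * lapR (re_part F) p) +i*
                  ((1 - sqnorm p) ^+ 2 / 4 * lapR (im_part F) p).
Proof.
move=> Fs pD; rewrite /laplacian d_z_d_zbar_smooth // /rho.
have t0 : 1 - sqnorm p != 0 by rewrite gt_eqF ?disk_gt0.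
move: (1 - sqnorm p) (lapR _ p) (lapR _ p) t0 => t x y t0.
by apply/eqP; rewrite eq_complex /=; apply/andP; split; apply/eqP; field.
Qed.

(** The difference of two bounded solutions is annihilated by [Delta - 2], and the maximum principle
    applies. Exchanging [a] and [b] turns the inequality into equality. *)
Lemma Dop_unique_real (a b g : R * R -> R) (M N : R) :
  Ck_on_disk 2 a -> Ck_on_disk 2 b ->
  (forall p, disk p -> `|a p| <= M) -> (forall p, disk p -> `|b p| <= N) ->
  (forall p, disk p -> (1 - sqnorm p) ^+ 2 / 4 * lapR a p - 2 * a p = g p) ->
  (forall p, disk p -> (1 - sqnorm p) ^+ 2 / 4 * lapR b p - 2 * b p = g p) ->
  forall p, disk p -> a p <= b p.
Proof.
move=> a2 b2 aM bN aE bE p pD; rewrite -subr_ge0.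
have := @maximum_principle R (b - a) (fun v q => 'D_v b q - 'D_v a q)
  (fun v q => 'D_v ('D_v b) q - 'D_v ('D_v a) q) (N + M).
apply=> // [q qD|v q hv qD|q qD|q qD].
- have hx : ex R = ex R \/ ex R = ey R by left.
  have [ac _ _ _] := Ck_on_disk2 a2 hx hx qD.
  have [bc _ _ _] := Ck_on_disk2 b2 hx hx qD.
  exact: cvgB bc ac.
- have [_ a1 a3 _] := Ck_on_disk2 a2 hv hv qD.
  have [_ b1 b3 _] := Ck_on_disk2 b2 hv hv qD.
  by split; exact: is_deriveB.
- have := ler_normlP _ _ (aM q qD); have := ler_normlP _ _ (bN q qD).
  by rewrite !fctE => -[? ?] [? ?]; lra.
- have key (t x y x' y' c d h : R) : t * (x + y) - 2 * c = h ->
      t * (x' + y') - 2 * d = h -> t * (x' - x + (y' - y)) <= 2 * (d - c).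
    move=> h1 h2.
    have -> : t * (x' - x + (y' - y)) = t * (x' + y') - t * (x + y) by ring.
    by lra.
  exact: key (aE q qD) (bE q qD).
Qed.

Lemma bounded_re_im F : bounded_on_disk F -> exists M : R, forall p, disk p ->
  `|re_part F p| <= M /\ `|im_part F p| <= M.
Proof.
move=> [M FM]; exists M => p /FM; rewrite normc_def lecR => h.
have M0 : 0 <= M by apply: le_trans h; exact: sqrtr_ge0.
rewrite /re_part /im_part;
  have : complex.Re (F p) ^+ 2 + complex.Im (F p) ^+ 2 <= M ^+ 2.
  by rewrite -[leLHS]sqr_sqrtr ?addr_ge0 ?sqr_ge0 // ler_pXn2r // nnegrE //
    sqrtr_ge0.
move=> {}h; split;
  rewrite -(ler_pXn2r (n := 2)) ?nnegrE // real_normK ?num_real //.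
  by apply: le_trans h; rewrite lerDl sqr_ge0.
by apply: le_trans h; rewrite lerDr sqr_ge0.
Qed.

(** [u] and the solution picked by [xget] solve the same equation. The operator is real, so real and
    imaginary parts are compared separately. *)
Lemma DopE F u : bounded_on_disk u -> smooth_on_disk u ->
  (forall p, disk p -> laplacian u p - 2 * u p = - 2 * F p) ->
  forall p, disk p -> Dop F p = u p.
Proof.
move=> ub us uE p pD; rewrite /Dop.
set P := [set _ | _]; have Pu : P u by split.
move: (xget _ P) (xgetI (fun=> 0) Pu) => v [vb vs vE].
have [M uM] := bounded_re_im ub; have [N vN] := bounded_re_im vb.
have E (w : R * R -> C) : smooth_on_disk w -> (forall q, disk q ->
    laplacian w q - 2 * w q = - 2 * F q) -> forall q, disk q ->
    ((1 - sqnorm q) ^+ 2 / 4 * lapR (re_part w) q - 2 * re_part w q =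
     - 2 * re_part F q) /\
    ((1 - sqnorm q) ^+ 2 / 4 * lapR (im_part w) q - 2 * im_part w q =
     - 2 * im_part F q).
  move=> ws wE q qD; have := wE q qD;
    rewrite laplacian_smooth // /re_part /im_part.
  move: (lapR _ q) (lapR _ q) => x y.
  case: (w q) (F q) => [c d] [c' d'] /eqP;
    rewrite eq_complex /= => /andP[/eqP h1 /eqP h2].
  by split; [move: h1|move: h2]; lra.
have us2 := us 2%N; have vs2 := vs 2%N.
have uR q : disk q -> `|re_part u q| <= M by move=> /uM[].
have uI q : disk q -> `|im_part u q| <= M by move=> /uM[].
have vR q : disk q -> `|re_part v q| <= N by move=> /vN[].
have vI q : disk q -> `|im_part v q| <= N by move=> /vN[].
have Eu1 q (qD : disk q) := (E u us uE q qD).1.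
have Eu2 q (qD : disk q) := (E u us uE q qD).2.
have Ev1 q (qD : disk q) := (E v vs vE q qD).1.
have Ev2 q (qD : disk q) := (E v vs vE q qD).2.
apply/eqP; rewrite eq_complex; apply/andP; split; rewrite eq_le.
  by rewrite (Dop_unique_real vs2.1 us2.1 vR uR Ev1 Eu1)
    ?(Dop_unique_real us2.1 vs2.1 uR vR Eu1 Ev1).
by rewrite (Dop_unique_real vs2.2 us2.2 vI uI Ev2 Eu2)
  ?(Dop_unique_real us2.2 vs2.2 uI vI Eu2 Ev2).
Qed.

Lemma cpoly_bounded F : cpoly F -> bounded_on_disk F.
Proof.
move=> [F1 F2].
have [M FM] := rpoly_bounded F1; have [N FN] := rpoly_bounded F2.
exists (M + N) => p pD; rewrite [F p]complexE.
have nr (x : R) : `|x%:C| = `|x|%:C.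
  by rewrite normc_def /= expr0n addr0 sqrtr_sqr.
have ni : `|'i%C : C| = 1 by rewrite normc_def /= expr0n expr1n add0r sqrtr1.
apply: le_trans (ler_normD _ _) _; rewrite normrM ni mul1r !nr rmorphD.
by apply: lerD; rewrite lecR; [exact: FM|exact: FN].
Qed.

Lemma laplacian_Lop F p : laplacian F p - 2 * F p = Lop F p.
Proof.
rewrite /laplacian /Lop; congr (_ * _ - _).
rewrite /rho /tC; rewrite -rmorphXn /=; congr (_%:C).
by rewrite invf_div mulrC divfK // pnatr_eq0.
Qed.

Lemma Dop_cpoly F u p : cpoly u -> (forall p, Lop u p = - 2 * F p) ->
  disk p -> Dop F p = u p.
Proof.
move=> uP uE; apply: DopE.
- exact: cpoly_bounded.
- exact: cpoly_smooth.
- by move=> q _; rewrite laplacian_Lop.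
Qed.

(** This replaces the positivity of the Green function: inequalities between values of [D] are read
    off inequalities between sources. *)
Lemma Lop_supersolution u p : cpoly u ->
  (forall p, disk p -> complex.Re (Lop u p) <= 0) -> disk p ->
  0 <= complex.Re (u p).
Proof.
move=> uP uL; have us := cpoly_smooth uP.
have [M uM] := bounded_re_im (cpoly_bounded uP).
move: p; apply: (@maximum_principle R (re_part u) (fun v q => 'D_v (re_part u)
  q)
  (fun v q => 'D_v ('D_v (re_part u)) q) M) => // [p _|v p hv pD|p pD|p pD].
- exact: rpoly_continuous uP.1 p.
- by have [_ ? ? _] := Ck_on_disk2 (us 2%N).1 hv hv pD.
- by have [/ler_normlP[]] := uM p pD; rewrite lerNl.
- have key (s x y : R) (z : C) : complex.Re ((s * x) +i* (s * y) - 2 * z) <= 0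
  ->
      s * x <= 2 * complex.Re z by case: z => a b /=; lra.
  by have := uL p pD; rewrite -laplacian_Lop laplacian_smooth // => /key.
Qed.

End uniqueness.

(** * Integration over the disk *)

Section disk_integrals.
Variable R : realType.
Local Notation C := R[i].
Implicit Types (p q v w : R * R) (f g : R * R -> R) (F G : R * R -> C).

Local Notation leb2 := (@lebesgue_measure R \x @lebesgue_measure R)%E.

Lemma measurable_disk : measurable (@disk R).
Proof.
have -> : @disk R = setT `&` (@sqnorm R) @^-1` `]-oo, 1[%classic.
  by apply/seteqP; split=> p /=; rewrite in_itv /=; [move=> ?; split|case].
by apply: (rpoly_measurable (@rpoly_sqnorm R)) => //; exact: measurable_itv.
Qed.

Lemma disk_finite_measure : (leb2 (@disk R) < +oo)%E.
Proof.
pose A : set R := `[-1, 1]%classic.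
have m : measurable A by exact: measurable_itv.
have sub : @disk R `<=` A `*` A.
  move=> p /disk_coord[h1 h2]; split; rewrite /A /= in_itv /=.
    by rewrite -ler_norml.
  by rewrite -ler_norml.
have : (leb2 (A `*` A) < +oo)%E.
  have mE : lebesgue_measure A = (1 - - 1)%:E.
    by rewrite /A lebesgue_measure_itv /= lte_fin ifT // gtrN.
  by rewrite product_measure1E //= mE -EFinM ltry.
by apply: le_lt_trans; apply: le_measure => //; rewrite inE;
  [exact: measurable_disk|exact: measurableX].
Qed.

Lemma rpoly_integrable f : rpoly f -> leb2.-integrable (@disk R) (EFin \o f).
Proof.
move=> fP; apply: measurable_bounded_integrable.
- exact: measurable_disk.
- exact: disk_finite_measure.
- by apply: measurable_funTS; exact: rpoly_measurable.
- have [M fM] := rpoly_bounded fP.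
  exists M; split; first exact: num_real.
  by move=> N MN p pD; apply: le_trans (ltW MN); exact: fM.
Qed.

Definition rint f : R := Rintegral leb2 (@disk R) f.

Lemma rintD f g : rpoly f -> rpoly g ->
  rint (fun p => f p + g p) = rint f + rint g.
Proof.
by move=> fP gP; apply: RintegralD;
  [exact: measurable_disk|exact: rpoly_integrable..].
Qed.

Lemma rintZ c f : rpoly f -> rint (fun p => c * f p) = c * rint f.
Proof.
by move=> fP; apply: RintegralZl;
  [exact: measurable_disk|exact: rpoly_integrable].
Qed.

Lemma rint_le f g : rpoly f -> rpoly g ->
  (forall p, disk p -> f p <= g p) -> rint f <= rint g.
Proof.
by move=> fP gP fg; apply: le_Rintegral => //;
  [exact: measurable_disk|exact: rpoly_integrable..].
Qed.

Lemma rint_eq f g : (forall p, disk p -> f p = g p) -> rint f = rint g.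
Proof. by move=> fg; apply: eq_Rintegral => p; rewrite inE; exact: fg. Qed.

Lemma rint_ge0 f : (forall p, disk p -> 0 <= f p) -> 0 <= rint f.
Proof. by move=> f0; rewrite /rint; apply: Rintegral_ge0. Qed.

Lemma rint1_gt0 : 0 < rint (fun=> 1).
Proof.
rewrite /rint Rintegral_cst ?mul1r; last exact: measurable_disk.
rewrite fine_gt0 // disk_finite_measure andbT.
pose A : set R := `[0, 2^-1]%classic.
have m : measurable A by exact: measurable_itv.
have sub : A `*` A `<=` @disk R.
  move=> p []; rewrite /A /= !in_itv /= => /andP[x0 x1] /andP[y0 y1].
  by rewrite /disk /sqnorm /=; nra.
have : (0 < leb2 (A `*` A))%E.
  have mE : lebesgue_measure A = (2^-1 - 0)%:E.
    by rewrite /A lebesgue_measure_itv /= lte_fin ifT // invr_gt0.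
  by rewrite product_measure1E //= mE subr0 -EFinM lte_fin mulr_gt0 // invr_gt0.
move=> /lt_le_trans; apply; apply: le_measure => //; rewrite inE.
  exact: measurableX.
exact: measurable_disk.
Qed.

Lemma integral_slice0 g q v (r : R) : rpoly g -> 0 < r ->
  g (r *: v + q) = 0 -> g (- r *: v + q) = 0 ->
  (\int[@lebesgue_measure R]_(x in [set` `](- r)%R, r[%R]) ('D_v g (x *: v +
    q))%:E = 0)%E.
Proof.
move=> gP r0 g1 g2.
pose h x := g (x *: v + q).
have hd (x : R) : is_derive x 1 h ('D_v g (x *: v + q)).
  exact/is_derive_line/rpoly_is_derive.
have hc f : rpoly f -> continuous (fun x : R => f (x *: v + q)).
  move=> fP x.
  have d : derivable (fun s : R => f (s *: v + q)) x 1.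
    by have [] := is_derive_line (rpoly_is_derive fP (x *: v + q) v).
  by move/derivable1_diffP : d => /differentiable_continuous.
have dP := rpoly_derive v gP.
have mf (D : set R) : measurable_fun D (fun x => ('D_v g (x *: v + q))%:E).
  apply/measurable_EFinP/measurable_funTS.
  exact: continuous_measurable_fun (hc _ dP).
rewrite integral_itv_bndo_bndc // integral_itv_obnd_cbnd //.
rewrite (@continuous_FTC2 R _ h) ?ge0_cp //.
- by rewrite /h g1 g2 subee.
- by rewrite gtrN.
- exact/continuous_subspaceT/(hc _ dP).
- split.
  + by move=> x _; have [] := hd x.
  + by apply: cvg_at_right_filter; exact: hc gP _.
  + by apply: cvg_at_left_filter; exact: hc gP _.
- by move=> x _; rewrite derive1E; have [] := hd x.
Qed.

Lemma in_itv_sqrt (x y : R) : y ^+ 2 < 1 ->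
  (x \in `]- Num.sqrt (1 - y ^+ 2), Num.sqrt (1 - y ^+ 2)[) = (x ^+ 2 + y ^+ 2
    < 1).
Proof.
move=> y1; rewrite in_itv /= -ltr_norml -ltrBrDr -[in RHS]real_normK ?num_real
  //.
rewrite -[1 - y ^+ 2 in RHS]sqr_sqrtr ?subr_ge0 ?ltW // ltr_pXn2r // nnegrE //.
Qed.

(** Divergence theorem by Fubini: the disk is cut into chords parallel to [v], of half-length
    [sqrt (1 - y^2)], and on each the fundamental theorem of calculus sees [g] vanish at both
    ends. *)
Lemma rint_derive v g : v = ex R \/ v = ey R -> rpoly g ->
  (forall p, sqnorm p = 1 -> g p = 0) -> rint (fun p => 'D_v g p) = 0.
Proof.
move=> vxy gP g0; have dP := rpoly_derive v gP.
have I := rpoly_integrable dP.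
rewrite /rint /Rintegral integral_mkcond.
set f := _ \_ _.
have If : leb2.-integrable setT f.
  exact: (@integrable_mkcond _ _ _ leb2 (@disk R) _ measurable_disk).1 I.
have sq x : x ^+ 2 < 1 -> Num.sqrt (1 - x ^+ 2) ^+ 2 = 1 - x ^+ 2.
  by move=> x1; rewrite sqr_sqrtr // subr_ge0 ltW.
case: vxy => vE.
- rewrite -integral21_prod_meas1 // integral0_eq //= => y _; rewrite /fubini_G.
  have [y1|y1] := leP 1 (y ^+ 2).
    rewrite integral0_eq // => x _; rewrite /f patchE memNset //.
    by rewrite /disk /sqnorm /=; apply/negP; rewrite -leNgt ler_wpDl ?sqr_ge0.
  set r := Num.sqrt (1 - y ^+ 2).
  have lineE x : (x, y) = x *: v + (0, y).
    by rewrite vE; apply: injective_projections;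
      rewrite /= ?[_%:A]mulr1 ?scaler0 ?addr0 ?add0r.
  transitivity (\int[@lebesgue_measure R]_(x in [set` `](- r)%R, r[%R])
      ('D_v g (x *: v + (0, y)))%:E)%E.
    rewrite [RHS]integral_mkcond; apply: eq_integral => x _.
    rewrite /f !patchE -lineE.
    suff -> : ((x, y) \in @disk R) = (x \in `]- r, r[%classic) by [].
    by apply/idP/idP; rewrite !inE /= in_itv_sqrt.
  apply: integral_slice0 => //; first by rewrite sqrtr_gt0 subr_gt0.
    by apply: g0; rewrite -lineE /sqnorm /= sq // subrK.
  by apply: g0; rewrite -lineE /sqnorm /= sqrrN sq // subrK.
- rewrite -integral12_prod_meas1 // integral0_eq //= => y _; rewrite /fubini_F.
  have [y1|y1] := leP 1 (y ^+ 2).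
    rewrite integral0_eq // => x _; rewrite /f patchE memNset //.
    by rewrite /disk /sqnorm /=; apply/negP; rewrite -leNgt ler_wpDr ?sqr_ge0.
  set r := Num.sqrt (1 - y ^+ 2).
  have lineE x : (y, x) = x *: v + (y, 0).
    by rewrite vE; apply: injective_projections;
      rewrite /= ?[_%:A]mulr1 ?scaler0 ?addr0 ?add0r.
  transitivity (\int[@lebesgue_measure R]_(x in [set` `](- r)%R, r[%R])
      ('D_v g (x *: v + (y, 0)))%:E)%E.
    rewrite [RHS]integral_mkcond; apply: eq_integral => x _.
    rewrite /f !patchE -lineE.
    suff -> : ((y, x) \in @disk R) = (x \in `]- r, r[%classic) by [].
    by apply/idP/idP; rewrite !inE /= in_itv_sqrt // addrC.
  apply: integral_slice0 => //; first by rewrite sqrtr_gt0 subr_gt0.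
    by apply: g0; rewrite -lineE /sqnorm /= sq // subrKC.
  by apply: g0; rewrite -lineE /sqnorm /= sqrrN sq // subrKC.
Qed.

(** Integral against the flat area: the density [4 / t^2] is always absorbed in the integrand, which
    stays polynomial. *)
Definition cint F : C := rint (re_part F) +i* rint (im_part F).

Lemma Re_cint F : complex.Re (cint F) = rint (re_part F). Proof. by []. Qed.

Lemma cint_eq F G : (forall p, disk p -> F p = G p) -> cint F = cint G.
Proof.
by move=> FG; congr (_ +i* _); apply: rint_eq => p /FG;
  rewrite /re_part /im_part => ->.
Qed.

Lemma cintD F G : cpoly F -> cpoly G ->
  cint (fun p => F p + G p) = cint F + cint G.
Proof.
move=> [F1 F2] [G1 G2]; rewrite /cint.
have -> : re_part (fun p => F p + G p) = fun p => re_part F p + re_part G p.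
  by apply/funext => p; rewrite /re_part raddfD.
have -> : im_part (fun p => F p + G p) = fun p => im_part F p + im_part G p.
  by apply/funext => p; rewrite /im_part raddfD.
by rewrite !rintD.
Qed.

Lemma cintZ c F : cpoly F -> cint (fun p => c * F p) = c * cint F.
Proof.
move=> [F1 F2]; rewrite /cint; case: c => a b.
have -> : re_part (fun p => (a +i* b) * F p) =
    fun p => a * re_part F p + (- b) * im_part F p.
  by apply/funext => p; rewrite /re_part /im_part; case: (F p) => x y /=; ring.
have -> : im_part (fun p => (a +i* b) * F p) =
    fun p => a * im_part F p + b * re_part F p.
  by apply/funext => p; rewrite /re_part /im_part; case: (F p) => x y /=; ring.
rewrite !rintD ?rintZ; try (by apply: rpolyM => //; exact: rpoly_cst);
  try by [].
move: (rint _) (rint _) => x y.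
by apply/eqP; rewrite eq_complex /=; apply/andP; split; apply/eqP; ring.
Qed.

Lemma cint0 : cint (fun=> 0) = 0.
Proof.
rewrite -[RHS](mul0r (cint (fun=> 0))) -cintZ; last exact: cpoly_cst.
by apply: cint_eq => p _; rewrite mul0r.
Qed.

Lemma cint_sum I (r : seq I) (F_ : I -> R * R -> C) : (forall i, cpoly (F_ i))
  ->
  cint (fun p => \sum_(i <- r) F_ i p) = \sum_(i <- r) cint (F_ i).
Proof.
move=> FP; elim: r => [|i r IH].
  by rewrite big_nil -[RHS]cint0; apply: cint_eq => p _; rewrite big_nil.
rewrite big_cons -IH -cintD //; last exact: cpoly_sum.
by apply: cint_eq => p _; rewrite big_cons.
Qed.

Lemma cintB F G : cpoly F -> cpoly G ->
  cint (fun p => F p - G p) = cint F - cint G.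
Proof.
move=> FP GP; rewrite -mulN1r -cintZ // -cintD //; last by cpoly_tac.
by apply: cint_eq => p _; rewrite mulN1r.
Qed.

Lemma area_intE F G : (forall p, disk p -> F p * (rho p)%:C = G p) ->
  area_int F = cint G.
Proof.
move=> FG; rewrite /area_int /cint; congr (_ +i* _); apply: rint_eq => p pD;
  have := FG p pD; rewrite /re_part /im_part => <-; case: (F p) => a b /=; ring.
Qed.

Lemma tC_circle F p : sqnorm p = 1 ->
  re_part (fun p => tC p * F p) p = 0 /\ im_part (fun p => tC p * F p) p = 0.
Proof.
move=> p1; rewrite /re_part /im_part /tC p1 subrr.
by case: (F p) => a b /=; rewrite !mul0r addr0 subr0.
Qed.

(** The explicit factor [t] provides the vanishing on the circle required by [rint_derive]. *)
Lemma cint_d_z F : cpoly F -> cint (d_z (fun p => tC p * F p)) = 0.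
Proof.
move=> FP; have tP := @cpoly_tC R.
have GP : cpoly (fun p => tC p * F p) by cpoly_tac.
have E v : v = ex R \/ v = ey R ->
    rint (fun p => 'D_v (re_part (fun p => tC p * F p)) p) = 0 /\
    rint (fun p => 'D_v (im_part (fun p => tC p * F p)) p) = 0.
  move=> vxy; split; apply: rint_derive => //; try by case: GP.
    by move=> p /(tC_circle F)[].
  by move=> p /(tC_circle F)[].
have [x1 x2] := E _ (or_introl erefl); have [y1 y2] := E _ (or_intror erefl).
case: GP => G1 G2;
  move: (fun p => tC p * F p) G1 G2 x1 x2 y1 y2 => G G1 G2 x1 x2 y1 y2.
rewrite /cint.
have -> : re_part (d_z G) = fun p => 2^-1 * ('D_(ex R) (re_part G) p + 'D_(ey
  R) (im_part G) p).
  by apply/funext => p; rewrite /re_part d_zE /= mulrC.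
have -> : im_part (d_z G) = fun p => 2^-1 * ('D_(ex R) (im_part G) p + (-1) *
  'D_(ey R) (re_part G) p).
  by apply/funext => p; rewrite /im_part d_zE /= mulrC mulN1r.
have dP v f : rpoly f -> rpoly (fun p => 'D_v f p) by exact: rpoly_derive.
have d1 := dP (ex R) _ G1; have d2 := dP (ex R) _ G2.
have d3 := dP (ey R) _ G2; have d4 := dP (ey R) _ G1.
have d5 := rpolyM (rpoly_cst (-1)) d4.
rewrite !rintZ; [|exact: rpolyD..].
by rewrite !rintD // rintZ // x1 x2 y1 y2 mulr0 addr0 mulr0.
Qed.

Lemma cint_conj F : cpoly F -> cint (fun p => (F p)^*%C) = (cint F)^*%C.
Proof.
move=> [F1 F2]; rewrite /cint.
have -> : re_part (fun p => (F p)^*%C) = re_part F.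
  by apply/funext => p; rewrite /re_part; case: (F p).
have -> : im_part (fun p => (F p)^*%C) = fun p => (-1) * im_part F p.
  by apply/funext => p; rewrite /im_part mulN1r; case: (F p).
by rewrite rintZ // mulN1r.
Qed.

Lemma tC_conj p : (tC p)^*%C = tC p.
Proof. by rewrite /tC /= oppr0. Qed.

Lemma cint_d_zbar F : cpoly F -> cint (d_zbar (fun p => tC p * F p)) = 0.
Proof.
move=> FP; have tP := @cpoly_tC R.
have -> : d_zbar (fun p => tC p * F p) =
    fun p => (d_z (fun p => tC p * (F p)^*%C) p)^*%C.
  apply/funext => p; rewrite d_zbar_via_conj; last by cpoly_tac.
  have -> // : (fun p => (tC p * F p)^*%C) = (fun p => tC p * (F p)^*%C).
  by apply/funext => q; rewrite rmorphM; congr (_ * _); exact: tC_conj.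
rewrite cint_conj; last by cpoly_tac.
by rewrite cint_d_z ?rmorph0 //; cpoly_tac.
Qed.

End disk_integrals.

(** * The basis of H^{-1,1} and the beta integrals *)

Section basis.
Variable R : realType.
Local Notation C := R[i].
Implicit Types (p q : R * R).

Definition nu_coef (i : nat) : R :=
  Num.sqrt ((2 * (i + 2)%:R ^+ 3 - 2 * (i + 2)%:R) / pi) / 4.

(** For [n = i + 2], [n^3 - n] is [(i + 1)(i + 2)(i + 3)]. These numbers are the coefficients of
    [6 / (1 - s)^4], which is why the sum of all [|mu_i|^2] is bounded. *)
Lemma nu_coef_sqr i : nu_coef i ^+ 2 = (i.+1 * i.+2 * i.+3)%:R / (8 * pi).
Proof.
have pi0 : (pi : R) != 0 by rewrite gt_eqF // pi_gt0.
rewrite /nu_coef expr_div_n sqr_sqrtr.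
  rewrite !natrM natrD -[i.+3]addn3 -[i.+2]addn2 -[i.+1]addn1 !natrD.
  by move: (pi : R) pi0 => P P0; field.
apply: divr_ge0; last exact: pi_ge0.
have -> : 2 * (i + 2)%:R ^+ 3 - 2 * (i + 2)%:R =
    2 * (i.+1%:R * i.+2%:R * i.+3%:R) :> R
      by rewrite natrD -[i.+3]addn3 -[i.+2]addn2 -[i.+1]addn1 !natrD; ring.
by rewrite !mulr_ge0.
Qed.

Lemma nu_coef_gt0 i : 0 < nu_coef i.
Proof.
have g0 : 0 <= nu_coef i by rewrite divr_ge0 // sqrtr_ge0.
rewrite lt_def g0 andbT -sqrf_eq0 nu_coef_sqr gt_eqF //.
by rewrite divr_gt0 ?mulr_gt0 ?pi_gt0 // ltr0n.
Qed.

(* The factor [t^2] of [mu i] is split off, so that only polynomials are left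
   once [mu i] is integrated against the density [rho = 4 / t^2]. *)
Definition nu (i : nat) p : C := (nu_coef i)%:C * (cplx p)^*%C ^+ i.

Lemma cpoly_nu i : cpoly (nu i).
Proof. by rewrite /nu; cpoly_tac. Qed.

Lemma mu_nu i p : mu i p = tC p ^+ 2 * nu i p.
Proof.
rewrite /mu /nu /tC /nu_coef mulrA; set S := Num.sqrt _; set T := 1 - sqnorm p.
have -> : T ^+ 2 / 4 * S = T ^+ 2 * (S / 4) by rewrite mulrAC mulrA.
by rewrite rmorphM rmorphXn.
Qed.

Lemma rcM (a b : R) : (a * b)%:C = a%:C * b%:C :> C.
Proof. exact: rmorphM. Qed.

Lemma nu_conj j k p : nu j p * (nu k p)^*%C =
  (nu_coef j * nu_coef k)%:C * ((cplx p)^*%C ^+ j * cplx p ^+ k).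
Proof.
have cc (x : C) (g : R) : (g%:C * (x^*)%C ^+ k)^*%C = g%:C * x ^+ k.
  by rewrite rmorphM rmorphXn /= conjcK oppr0.
by rewrite /nu cc rcM mulrACA.
Qed.

Lemma conj_tCM n p (x : C) : (tC p ^+ n * x)^*%C = tC p ^+ n * x^*%C.
Proof. by rewrite rmorphM rmorphXn; congr (_ ^+ _ * _); exact: tC_conj. Qed.

Lemma solvable_mu i j : solvable (fun p => mu i p * (mu j p)^*%C).
Proof.
have := solvableZ (nu_coef i * nu_coef j)%:C (solvable_zzbar R i j).
apply: solvable_ext => p; rewrite mulrCA -nu_conj !mu_nu.
by rewrite conj_tCM; cring.
Qed.

(* [D (mu i * conj (mu j))] is [t^2] times this polynomial. *)
Definition Dnu (i j : nat) : R * R -> C := s2val (cid2 (solvable_mu i j)).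

Lemma cpoly_Dnu i j : cpoly (Dnu i j).
Proof. by rewrite /Dnu; case: (cid2 _). Qed.

Lemma Lop_Dnu i j p : Lop (fun p => tC p ^+ 2 * Dnu i j p) p =
  - 2 * (mu i p * (mu j p)^*%C).
Proof. by rewrite /Dnu; case: (cid2 _). Qed.

Lemma tC_neq0 p : disk p -> tC p != 0.
Proof.
by move=> /disk_gt0 t0; rewrite /tC eq_complex /= eqxx andbT gt_eqF.
Qed.

Lemma rho_tC p : (rho p)%:C = 4 / tC p ^+ 2.
Proof.
by rewrite /rho /tC rmorphM fmorphV rmorphXn rmorph_nat.
Qed.

(** Count of powers: [t^2] from [D], [t^4] from the two remaining basis elements, and [4 / t^2] from
    the density. *)
Lemma curv4E i j k l :
  curv4 (@mu R i) (@mu R j) (@mu R k) (@mu R l) =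
  cint (fun p => 4 * tC p ^+ 4 * (Dnu i j p * nu k p * (nu l p)^*%C)) +
  cint (fun p => 4 * tC p ^+ 4 * (Dnu i l p * nu k p * (nu j p)^*%C)).
Proof.
have key a b c d p : disk p ->
    Dop (fun q => mu a q * (mu b q)^*%C) p * mu c p * (mu d p)^*%C * (rho p)%:C
      =
    4 * tC p ^+ 4 * (Dnu a b p * nu c p * (nu d p)^*%C).
  move=> pD; have WP := cpoly_Dnu a b; have tP := @cpoly_tC R.
  rewrite (@Dop_cpoly R _ (fun p => tC p ^+ 2 * Dnu a b p)) //; first last.
  - by move=> q; exact: Lop_Dnu.
  - by cpoly_tac.
  rewrite !mu_nu conj_tCM rho_tC.
  have := tC_neq0 pD;
    move: (tC p) (Dnu a b p) (nu c p) ((nu d p)^*%C) => t w m n t0.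
  by field.
rewrite /curv4; congr (_ + _); apply: area_intE => p pD; exact: key.
Qed.

(* [cint (t^b z^a zbar^c)] vanishes for [a <> c]: integrating the two
   divergences [d_z (t^(b+1) z^(a+1) zbar^c)] and
   [d_zbar (t^(b+1) z^a zbar^(c+1))] and subtracting leaves [(a - c)] times the integral. *)
Lemma cint_d_z_monomial a b c :
  b.+1%:R * cint (fun p => tC p ^+ b * (cplx p ^+ a.+1 * (cplx p)^*%C ^+ c.+1))
    =
  a.+1%:R * cint (fun p => tC p ^+ b.+1 * (cplx p ^+ a * (cplx p)^*%C ^+ c)) :>
    C.
Proof.
have tP := @cpoly_tC R.
have FP : cpoly (fun p : R * R => tC p ^+ b * (cplx p ^+ a.+1 * (cplx p)^*%C ^+
  c)).
  by cpoly_tac.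
rewrite -!cintZ; cpoly_tac; apply/eqP; rewrite eq_sym -subr_eq0 -cintB;
  cpoly_tac.
apply/eqP; rewrite -[RHS](cint_d_z FP); apply: cint_eq => p _.
have -> : (fun p => tC p * (tC p ^+ b * (cplx p ^+ a.+1 * (cplx p)^*%C ^+ c))) =
    (fun p => tC p ^+ b.+1 * (cplx p ^+ a.+1 * (cplx p)^*%C ^+ c)).
  by apply/funext => q; rewrite mulrA -exprS.
rewrite d_zM; cpoly_tac; rewrite d_zX // d_z_tC d_zM; cpoly_tac.
rewrite d_zX; cpoly_tac; rewrite d_z_cplx d_zX; cpoly_tac; rewrite d_z_zbar.
by rewrite -!pred_Sn !(exprS _ c); cring.
Qed.

Lemma cint_d_zbar_monomial a b c :
  b.+1%:R * cint (fun p => tC p ^+ b * (cplx p ^+ a.+1 * (cplx p)^*%C ^+ c.+1))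
    =
  c.+1%:R * cint (fun p => tC p ^+ b.+1 * (cplx p ^+ a * (cplx p)^*%C ^+ c)) :>
    C.
Proof.
have tP := @cpoly_tC R.
have FP : cpoly (fun p : R * R => tC p ^+ b * (cplx p ^+ a * (cplx p)^*%C ^+
  c.+1)).
  by cpoly_tac.
rewrite -!cintZ; cpoly_tac; apply/eqP; rewrite eq_sym -subr_eq0 -cintB;
  cpoly_tac.
apply/eqP; rewrite -[RHS](cint_d_zbar FP); apply: cint_eq => p _.
have -> : (fun p => tC p * (tC p ^+ b * (cplx p ^+ a * (cplx p)^*%C ^+ c.+1))) =
    (fun p => tC p ^+ b.+1 * (cplx p ^+ a * (cplx p)^*%C ^+ c.+1)).
  by apply/funext => q; rewrite mulrA -exprS.
rewrite d_zbarM; cpoly_tac; rewrite d_zbarX // d_zbar_tC d_zbarM; cpoly_tac.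
rewrite d_zbarX; cpoly_tac; rewrite d_zbar_cplx d_zbarX; cpoly_tac;
  rewrite d_zbar_zbar.
by rewrite -!pred_Sn !(exprS _ a); cring.
Qed.

Lemma cint_monomial0 a b c : a != c ->
  cint (fun p => tC p ^+ b.+1 * (cplx p ^+ a * (cplx p)^*%C ^+ c)) = 0 :> C.
Proof.
move=> ac; have := cint_d_zbar_monomial a b c; rewrite cint_d_z_monomial.
move/eqP; rewrite -subr_eq0 -mulrBl mulf_eq0 subr_eq0 eqr_nat eqSS (negbTE ac).
by move=> /eqP.
Qed.

(** * Beta integrals and the norm of the basis *)

Definition tR p : R := 1 - sqnorm p.

(** In polar coordinates this is [pi] times the Beta function at [(j + 1, b + 1)]. Only its two
    recursions and its sign are used: [beta_int_shift] is an integration by parts, [beta_int_split]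
    is [t + |z|^2 = 1]. *)
Definition beta_int (j b : nat) : R :=
  rint (fun p => tR p ^+ b * sqnorm p ^+ j).

Lemma rpoly_tR_pow j b : rpoly (fun p => tR p ^+ b * sqnorm p ^+ j).
Proof.
have X f n : rpoly f -> rpoly (fun p : R * R => f p ^+ n).
  move=> fP; elim: n => [|n IH]; first exact: rpoly_cst.
  by apply: rpoly_ext (rpolyM fP IH) => p; rewrite exprS.
have sP := rpoly_sqnorm R.
by apply: rpolyM; apply: X => //; apply: rpolyB => //; exact: rpoly_cst.
Qed.

Lemma cplx_conj p : cplx p * (cplx p)^*%C = (sqnorm p)%:C.
Proof.
by apply/eqP; rewrite eq_complex /=; apply/andP; split; apply/eqP;
  rewrite /sqnorm; ring.
Qed.

Lemma cint_monomial_diag b j :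
  cint (fun p => tC p ^+ b * (cplx p ^+ j * (cplx p)^*%C ^+ j)) =
  (beta_int j b)%:C.
Proof.
have E p : tC p ^+ b * (cplx p ^+ j * (cplx p)^*%C ^+ j) =
    (tR p ^+ b * sqnorm p ^+ j)%:C.
  by rewrite -exprMn cplx_conj rcM !rmorphXn.
rewrite /cint /beta_int; congr (_ +i* _).
  by apply: rint_eq => p _; rewrite /re_part E.
transitivity (rint (fun p : R * R => 0 * 1)).
  by apply: rint_eq => p _; rewrite /im_part E mul0r.
by rewrite rintZ ?mul0r //; exact: rpoly_cst.
Qed.

Lemma beta_int_shift j b : b.+1%:R * beta_int j.+1 b = j.+1%:R * beta_int j
  b.+1.
Proof.
have := cint_d_z_monomial j b j;
  rewrite !cint_monomial_diag => /(congr1 (@complex.Re R)).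
by rewrite -!(rmorph_nat (real_complex R)) -!rcM.
Qed.

Lemma beta_int_split j b : beta_int j b = beta_int j b.+1 + beta_int j.+1 b.
Proof.
rewrite /beta_int -rintD; try exact: rpoly_tR_pow.
by apply: rint_eq => p _; rewrite !exprS /tR; ring.
Qed.

Lemma beta_int_ge0 j b : 0 <= beta_int j b.
Proof.
apply: rint_ge0 => p /disk_gt0 t0; apply: mulr_ge0; apply: exprn_ge0.
  exact: ltW.
exact: sqnorm_ge0.
Qed.

(** The start is the area of the disk. For [b = 0], a zero at [j + 1] would propagate to [j] through
    the two recursions; the shift then raises [b]. *)
Lemma beta_int_gt0 j b : 0 < beta_int j b.
Proof.
have step j' b' : beta_int j' b'.+1 = b'.+1%:R / j'.+1%:R * beta_int j'.+1 b'.
  by rewrite mulrAC beta_int_shift mulrAC divff ?mul1r // pnatr_eq0.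
elim: b j => [|b IH] j; last by rewrite step mulr_gt0 // divr_gt0.
elim: j => [|j IH].
  have := rint1_gt0 R; congr (_ < _).
  by apply: rint_eq => p _; rewrite !expr0 mulr1.
rewrite lt_def beta_int_ge0 andbT; apply/eqP => h0.
have := beta_int_shift j 0; rewrite h0 mulr0 => /esym/eqP.
rewrite mulf_eq0 pnatr_eq0 /= => /eqP h1.
by move: IH; rewrite beta_int_split h0 h1 addr0 ltxx.
Qed.

(** The two recursions give [(j + 4) B(j + 1, 2) = (j + 1) B(j, 2)], so the product is independent
    of [j]: all the [mu j] have the same norm. *)
Lemma beta_int_weight2 j :
  (j.+1 * j.+2 * j.+3)%:R * beta_int j 2 = 6 * beta_int 0 2.
Proof.
elim: j => [|j IH]; first by [].
rewrite -IH.
have h1 := beta_int_split j 2; have h2 := beta_int_shift j 2.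
have -> : (j.+2 * j.+3 * j.+4)%:R * beta_int j.+1 2 =
    j.+2%:R * j.+3%:R * (j.+1%:R * beta_int j.+1 2 + 3 * beta_int j.+1 2).
  by rewrite !natrM -[j.+4]addn4 -[j.+1]addn1 !natrD; ring.
by rewrite h2 -mulrDr [beta_int j.+1 2 + _]addrC -h1 !natrM; ring.
Qed.

(** The common squared norm of the [mu j]. Its value is 1, but it is kept symbolic, and so the area
    of the disk is never evaluated. *)
Definition mu_norm : R := 3 * beta_int 0 2 / pi.

Lemma nu_orthogonal j k :
  cint (fun p => 4 * tC p ^+ 2 * (nu j p * (nu k p)^*%C)) =
  if j == k then mu_norm%:C else 0.
Proof.
have tP := @cpoly_tC R.
transitivity (4 * (nu_coef j * nu_coef k)%:C *
    cint (fun p => tC p ^+ 2 * (cplx p ^+ k * (cplx p)^*%C ^+ j))).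
  rewrite -cintZ; cpoly_tac; apply: cint_eq => p _.
  rewrite nu_conj; move: ((nu_coef j * nu_coef k)%:C) => g; cring.
case: eqVneq => [->|jk]; last by rewrite cint_monomial0 ?mulr0 // eq_sym.
rewrite cint_monomial_diag -expr2 nu_coef_sqr -(rmorph_nat (real_complex R))
  -!rcM.
congr (_%:C); rewrite /mu_norm.
have -> : 4 * ((k.+1 * k.+2 * k.+3)%:R / (8 * pi)) * beta_int k 2 =
   4 * ((k.+1 * k.+2 * k.+3)%:R * beta_int k 2) / (8 * pi) by ring.
rewrite beta_int_weight2; move: (beta_int _ _) => x.
have : (pi : R) != 0 by rewrite gt_eqF // pi_gt0.
by move: (pi : R) => P P0; field.
Qed.

End basis.

(** * Pointwise bounds for D *)

Section pointwise_bounds.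
Variable R : realType.
Local Notation C := R[i].
Implicit Types (p q : R * R) (z : C).

Definition normsq z : R := complex.Re z ^+ 2 + complex.Im z ^+ 2.

Lemma normsq_ge0 z : 0 <= normsq z.
Proof. by rewrite addr_ge0 ?sqr_ge0. Qed.

Lemma mul_conj z : z * z^*%C = (normsq z)%:C.
Proof.
case: z => a b; apply/eqP; rewrite eq_complex /=.
by apply/andP; split; apply/eqP; rewrite /normsq /=; ring.
Qed.

Lemma normsqM (a b : C) : normsq (a * b) = normsq a * normsq b.
Proof. by case: a b => [a a'] [b b']; rewrite /normsq /=; ring. Qed.

Lemma normsq_conj z : normsq (z^*%C) = normsq z.
Proof. by case: z => a b; rewrite /normsq /= sqrrN. Qed.

Lemma normsq_real (x : R) : normsq x%:C = x ^+ 2.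
Proof. by rewrite /normsq /= expr0n addr0. Qed.

Lemma normsqN z : normsq (- z) = normsq z.
Proof. by case: z => a b; rewrite /normsq /= !sqrrN. Qed.

Lemma normsq_eq0 z : normsq z = 0 -> z = 0.
Proof.
case: z => a b /eqP; rewrite /normsq paddr_eq0 ?sqr_ge0 //= !sqrf_eq0.
by move=> /andP[/eqP -> /eqP ->].
Qed.

Lemma Re_mul_conj_le (a b : C) :
  2 * complex.Re (a * b^*%C) <= normsq a + normsq b.
Proof.
case: a b => [a a'] [b b']; rewrite /normsq /= -subr_ge0.
have -> : a ^+ 2 + a' ^+ 2 + (b ^+ 2 + b' ^+ 2) - 2 * (a * b - a' * - b') =
  (a - b) ^+ 2 + (a' - b') ^+ 2 by ring.
by rewrite addr_ge0 ?sqr_ge0.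
Qed.

Lemma Re_mul_conj_sqr (a b : C) :
  complex.Re (a * b^*%C) ^+ 2 <= normsq a * normsq b.
Proof.
case: a b => [a a'] [b b']; rewrite /normsq /= -subr_ge0.
have -> : (a ^+ 2 + a' ^+ 2) * (b ^+ 2 + b' ^+ 2) - (a * b - a' * - b') ^+ 2 =
  (a * b' - a' * b) ^+ 2 by ring.
exact: sqr_ge0.
Qed.

Lemma rpoly_normsq (F : R * R -> C) : cpoly F -> rpoly (fun p => normsq (F p)).
Proof.
move=> [F1 F2]; apply: rpoly_ext (rpolyD (rpolyM F1 F1) (rpolyM F2 F2)) => p.
by rewrite /normsq /re_part /im_part !expr2.
Qed.

Lemma double_le_add (x y w : R) : 0 <= x -> 0 <= y -> w ^+ 2 <= x * y ->
  2 * w <= x + y.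
Proof.
move=> x0 y0 wxy; have [w0|w0] := leP w 0.
  by apply: le_trans (_ : 0 <= _); [rewrite pmulr_rle0|rewrite addr_ge0].
have w20 : 0 <= 2 * w by rewrite mulr_ge0 // ltW.
have xy0 : 0 <= x + y by rewrite addr_ge0.
rewrite -(ler_pXn2r (n := 2)) ?nnegrE //.
apply: (@le_trans _ _ (4 * (x * y))); first by rewrite exprMn; lra.
rewrite -subr_ge0 (_ : _ - _ = (x - y) ^+ 2) ?sqr_ge0 //; ring.
Qed.

Lemma cauchy_schwarz_normsq I (r : seq I) (a b : I -> C) :
  normsq (\sum_(i <- r) a i * b i) <=
  (\sum_(i <- r) normsq (a i)) * (\sum_(i <- r) normsq (b i)).
Proof.
elim: r => [|i r IH]; first by rewrite !big_nil mul0r /normsq /= expr0n addr0.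
rewrite !big_cons; move: IH; set A := \sum_(i <- r) normsq (a i).
set B := \sum_(i <- r) normsq (b i); set x := \sum_(i <- r) _ => IH.
have A0 : 0 <= A by apply: sumr_ge0 => k _; exact: normsq_ge0.
have B0 : 0 <= B by apply: sumr_ge0 => k _; exact: normsq_ge0.
have E : normsq (a i * b i + x) = normsq (a i) * normsq (b i) + normsq x +
    2 * complex.Re (x * (a i * b i)^*%C).
  rewrite -normsqM; case: (a i * b i) x {IH} => [c d] [e f].
  by rewrite /normsq /=; ring.
have h1 := Re_mul_conj_sqr x (a i * b i).
(* The squared cross term is at most the product of the two summands on the right; AM-GM then bounds
   it by their sum. *)
have h2 : 2 * complex.Re (x * (a i * b i)^*%C) <=
    A * normsq (b i) + B * normsq (a i).
  apply: double_le_add; rewrite ?mulr_ge0 ?normsq_ge0 //.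
  apply: le_trans h1 _; rewrite normsqM.
  have -> : A * normsq (b i) * (B * normsq (a i)) =
    A * B * (normsq (a i) * normsq (b i)) by ring.
  by rewrite ler_wpM2r // mulr_ge0 ?normsq_ge0.
by rewrite E; lra.
Qed.

(** Partial sums of the series of [6 / (1 - s)^4]. Each of the four multiplications by [1 - s]
    telescopes to the sum of the next lower degree, up to a nonpositive boundary term, with factors
    3, 2, 1 and 1. *)
Lemma negative_binomial_bound (s : R) n : 0 <= s -> s <= 1 ->
  (1 - s) ^+ 4 * \sum_(i < n) (i.+1 * i.+2 * i.+3)%:R * s ^+ i <= 6.
Proof.
move=> s0 s1; have t0 : 0 <= 1 - s by rewrite subr_ge0.
have sn k : 0 <= s ^+ k by rewrite exprn_ge0.
have h0 : (1 - s) * \sum_(i < n) s ^+ i <= 1.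
  suff -> : (1 - s) * \sum_(i < n) s ^+ i = 1 - s ^+ n by rewrite gerBl.
  elim: n => [|n IH]; first by rewrite big_ord0 mulr0 subrr.
  by rewrite big_ord_recr mulrDr /= IH exprS; ring.
have h1 : (1 - s) * \sum_(i < n) i.+1%:R * s ^+ i <= \sum_(i < n) s ^+ i.
  suff -> : (1 - s) * \sum_(i < n) i.+1%:R * s ^+ i =
      \sum_(i < n) s ^+ i - n%:R * s ^+ n by rewrite gerBl mulr_ge0.
  elim: n {h0} => [|n IH]; first by rewrite !big_ord0 mulr0 mul0r subrr.
  by rewrite !big_ord_recr mulrDr /= IH exprS -[n.+1]addn1 natrD; ring.
have h2 : (1 - s) * \sum_(i < n) (i.+1 * i.+2)%:R * s ^+ i <=
    2 * \sum_(i < n) i.+1%:R * s ^+ i.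
  suff -> : (1 - s) * \sum_(i < n) (i.+1 * i.+2)%:R * s ^+ i =
      2 * \sum_(i < n) i.+1%:R * s ^+ i - (n * n.+1)%:R * s ^+ n.
    by rewrite gerBl mulr_ge0.
  elim: n {h0 h1} => [|n IH];
    first by rewrite !big_ord0 !mulr0 mul0n mul0r subrr.
  rewrite !big_ord_recr mulrDr /= IH exprS !natrM.
  by rewrite -[n.+2]addn2 -[n.+1]addn1 !natrD; ring.
have h3 : (1 - s) * \sum_(i < n) (i.+1 * i.+2 * i.+3)%:R * s ^+ i <=
    3 * \sum_(i < n) (i.+1 * i.+2)%:R * s ^+ i.
  suff -> : (1 - s) * \sum_(i < n) (i.+1 * i.+2 * i.+3)%:R * s ^+ i =
      3 * \sum_(i < n) (i.+1 * i.+2)%:R * s ^+ i - (n * n.+1 * n.+2)%:R * s ^+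
        n.
    by rewrite gerBl mulr_ge0.
  elim: n {h0 h1 h2} => [|n IH];
    first by rewrite !big_ord0 !mulr0 !mul0n mul0r subrr.
  rewrite !big_ord_recr mulrDr /= IH exprS !natrM.
  by rewrite -[n.+3]addn3 -[n.+2]addn2 -[n.+1]addn1 !natrD; ring.
move: h0 h1 h2 h3.
move: (\sum_(i < n) s ^+ i) (\sum_(i < n) i.+1%:R * s ^+ i) => S0 S1.
move: (\sum_(i < n) _) (\sum_(i < n) _) => S3 S2 h0 h1 h2 h3.
have k1 : (1 - s) * ((1 - s) * S1) <= 1 by apply: le_trans h0; exact: ler_wpM2l.
have k2 : (1 - s) * ((1 - s) * ((1 - s) * S2)) <= 2.
  have k : (1 - s) * ((1 - s) * ((1 - s) * S2)) <= (1 - s) * ((1 - s) * (2 *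
    S1)).
    by do ?[apply: ler_wpM2l => //].
  by apply: le_trans k _; lra.
have k : (1 - s) ^+ 4 * S3 <= (1 - s) * ((1 - s) * ((1 - s) * (3 * S2))).
  have -> : (1 - s) ^+ 4 * S3 = (1 - s) * ((1 - s) * ((1 - s) * ((1 - s) *
    S3))).
    by ring.
  by do ?[apply: ler_wpM2l => //].
by apply: le_trans k _; lra.
Qed.

(** The constant value of the full sum of [|mu_i|^2], with 6 from the binomial series and [8 * pi]
    from [nu_coef_sqr]. *)
Definition mu_sup : R := 6 / (8 * pi).

Lemma mu_sup_ge0 : 0 <= mu_sup.
Proof. by rewrite divr_ge0 ?mulr_ge0 ?pi_ge0. Qed.

Lemma normsq_cplx p : normsq (cplx p) = sqnorm p.
Proof. by []. Qed.

Lemma normsqX z n : normsq (z ^+ n) = normsq z ^+ n.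
Proof.
elim: n => [|n IH]; first by rewrite !expr0 (normsq_real 1) expr1n.
by rewrite !exprS normsqM IH.
Qed.

Lemma normsq_tC n p : normsq (tC p ^+ n) = tR p ^+ (2 * n).
Proof. by rewrite normsqX normsq_real -exprM. Qed.

Lemma normsq_nu i p : normsq (nu i p) = nu_coef R i ^+ 2 * sqnorm p ^+ i.
Proof. by rewrite normsqM normsq_real normsqX normsq_conj normsq_cplx. Qed.

Lemma sum_normsq_nu N p : disk p -> tR p ^+ 4 * \sum_(i < N) normsq (nu i p) <=
  mu_sup.
Proof.
move=> pD.
have -> : \sum_(i < N) normsq (nu i p) =
    (8 * pi)^-1 * \sum_(i < N) (i.+1 * i.+2 * i.+3)%:R * sqnorm p ^+ i.
  rewrite mulr_sumr; apply: eq_bigr => i _.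
  by rewrite normsq_nu nu_coef_sqr mulrAC mulrC.
rewrite mulrCA /mu_sup [leRHS]mulrC ler_wpM2l ?invr_ge0 ?mulr_ge0 ?pi_ge0 //.
apply: negative_binomial_bound; first exact: sqnorm_ge0.
exact: ltW.
Qed.

Lemma conjM (x y : C) : (x * y)^*%C = x^*%C * y^*%C.
Proof. exact: rmorphM. Qed.

Lemma conjB (x y : C) : (x - y)^*%C = x^*%C - y^*%C.
Proof. exact: rmorphB. Qed.

Lemma conj_sum I (r : seq I) (F : I -> C) :
  (\sum_(i <- r) F i)^*%C = \sum_(i <- r) (F i)^*%C.
Proof. exact: rmorph_sum. Qed.

Lemma tRXE n p : (tR p ^+ n)%:C = tC p ^+ n.
Proof. exact: rmorphXn. Qed.

(* [D] of the squared modulus of an element of the span of the [mu i]. *)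
Definition Dsum (N : nat) (c : nat -> C) q : C :=
  \sum_(i < N) \sum_(l < N) (c i * (c l)^*%C) * (tC q ^+ 2 * Dnu i l q).

Definition Msum (N : nat) (c : nat -> C) q : C := \sum_(i < N) c i * nu i q.

Lemma cpoly_Msum N c : cpoly (Msum N c).
Proof.
have MP := @cpoly_nu R.
by rewrite /Msum; cpoly_tac.
Qed.

Lemma cpoly_Dsum N c : cpoly (Dsum N c).
Proof.
have WP := @cpoly_Dnu R; have tP := @cpoly_tC R.
apply: cpoly_sum => i; apply: cpoly_sum => l.
by have := WP i l => ?; cpoly_tac.
Qed.

Lemma Lop_Dsum N c q :
  Lop (Dsum N c) q = - 2 * (tC q ^+ 4 * (Msum N c q * (Msum N c q)^*%C)).
Proof.
have WP := @cpoly_Dnu R; have tP := @cpoly_tC R.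
have WP' i l : cpoly (fun q => tC q ^+ 2 * Dnu i l q).
  by have := WP i l => ?; cpoly_tac.
rewrite /Dsum Lop_sum => [|i]; last first.
  by apply: cpoly_sum => l; have := WP' i l => ?; cpoly_tac.
rewrite /Msum conj_sum mulr_suml !mulr_sumr; apply: eq_bigr => i _.
rewrite Lop_sum => [|l]; last by have := WP' i l => ?; cpoly_tac.
rewrite !mulr_sumr; apply: eq_bigr => l _.
rewrite LopZ; last exact: WP'.
rewrite Lop_Dnu !mu_nu conj_tCM (conjM (c l)).
by move: ((nu l q)^*%C) ((c l)^*%C) (nu i q) (tC q) => m d m' t; ring.
Qed.

Lemma d_z_Msum N c q : d_z (Msum N c) q = 0.
Proof.
have MP := @cpoly_nu R.
rewrite /Msum d_z_sum => [|i]; last by have := MP i => ?; cpoly_tac.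
apply: big1 => i _; rewrite d_zZ; last exact: MP.
rewrite /nu d_zZ; cpoly_tac; rewrite d_zX; cpoly_tac.
by rewrite d_z_zbar !mulr0.
Qed.

Lemma d_z_d_zbar_Msum N c q : d_z (d_zbar (Msum N c)) q = 0.
Proof.
have MP := @cpoly_nu R.
have -> : d_zbar (Msum N c) = fun q => \sum_(i < N)
    (c i * (nu_coef R i)%:C * i%:R) * (cplx q)^*%C ^+ i.-1.
  apply/funext => p; rewrite /Msum d_zbar_sum => [|i]; last first.
    by have := MP i => ?; cpoly_tac.
  apply: eq_bigr => i _; rewrite d_zbarZ; last exact: MP.
  rewrite /nu d_zbarZ; cpoly_tac; rewrite d_zbarX; cpoly_tac.
  by rewrite d_zbar_zbar mulr1 !mulrA.
rewrite d_z_sum => [|i]; last by cpoly_tac.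
apply: big1 => i _; rewrite d_zZ; cpoly_tac.
by rewrite d_zX; cpoly_tac; rewrite d_z_zbar !mulr0.
Qed.

(* For an antiholomorphic [F], [phi = t^4 |F|^2] satisfies
   [Delta phi + 4 phi = t^4 |t F' - 4 z F|^2 >= 0]; in other words
   [log phi] has constant Laplacian [-4] away from the zeros of [F]. *)
Lemma Lop_antiholomorphic (F : R * R -> C) q : cpoly F ->
  (forall p, d_z F p = 0) -> (forall p, d_z (d_zbar F) p = 0) ->
  Lop (fun p => tC p ^+ 4 * (F p * (F p)^*%C)) q =
  (tR q ^+ 4 * normsq (tC q * d_zbar F q - 4 * cplx q * F q))%:C -
  6 * (tC q ^+ 4 * (F q * (F q)^*%C)).
Proof.
move=> FP F1 F2; have tP := @cpoly_tC R.
have conj0 : forall p, d_zbar (fun p => (F p)^*%C) p = 0.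
  by move=> p; rewrite d_zbar_conj // F1 rmorph0.
rewrite /Lop.
have -> : d_zbar (fun p => tC p ^+ 4 * (F p * (F p)^*%C)) = fun p =>
    (-4) * (tC p ^+ 3 * (cplx p * (F p * (F p)^*%C))) +
    tC p ^+ 4 * (d_zbar F p * (F p)^*%C).
  apply/funext => p; rewrite d_zbarM; cpoly_tac.
  rewrite d_zbarM; cpoly_tac; rewrite conj0 d_zbarX // d_zbar_tC.
  move: ((F p)^*%C) (F p) => f' f; rewrite -pred_Sn; cring.
have -> : d_z (fun p => (-4) * (tC p ^+ 3 * (cplx p * (F p * (F p)^*%C))) +
    tC p ^+ 4 * (d_zbar F p * (F p)^*%C)) q =
  (-4) * (3 * tC q ^+ 2 * (- (cplx q)^*%C) * (cplx q * (F q * (F q)^*%C)) +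
     tC q ^+ 3 * (F q * (F q)^*%C + cplx q * (F q * (d_zbar F q)^*%C))) +
  (4 * tC q ^+ 3 * (- (cplx q)^*%C) * (d_zbar F q * (F q)^*%C) +
   tC q ^+ 4 * (d_zbar F q * (d_zbar F q)^*%C)).
  rewrite d_zD; cpoly_tac; congr (_ + _).
    rewrite d_zZ; cpoly_tac; congr (_ * _).
    rewrite d_zM; cpoly_tac; rewrite d_zX // d_z_tC d_zM; cpoly_tac.
    rewrite d_z_cplx d_zM; cpoly_tac;
      rewrite F1 mul0r add0r d_z_conj // -pred_Sn.
    by rewrite mul1r.
  rewrite d_zM; cpoly_tac; rewrite d_zX // d_z_tC d_zM; cpoly_tac.
  by rewrite F2 mul0r add0r d_z_conj // -pred_Sn.
rewrite rcM -mul_conj tRXE.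
have -> : (tC q * d_zbar F q - 4 * cplx q * F q)^*%C =
    tC q * (d_zbar F q)^*%C - 4 * (cplx q)^*%C * (F q)^*%C.
  rewrite conjB !conjM; congr (_ * _ - _ * _ * _); first exact: tC_conj.
  exact: (rmorph_nat (@conjc R)).
move: (tCE q); move: ((F q)^*%C) (F q) (d_zbar F q) ((d_zbar F q)^*%C).
move: (tC q) (cplx q) ((cplx q)^*%C) => t z z' f' f g g' ->.
ring.
Qed.

(** With [phi = t^4 |Msum|^2], [Lop_antiholomorphic] gives [(Delta - 2) phi >= - 6 phi], while
    [Dsum] has the source [phi]. Hence [Dsum - phi / 3] is a supersolution. *)
Lemma Dsum_lower N c q : disk q ->
  tR q ^+ 4 * normsq (Msum N c q) / 3 <= complex.Re (Dsum N c q).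
Proof.
move=> qD; have tP := @cpoly_tC R; have MP := @cpoly_Msum N c.
have DP := @cpoly_Dsum N c.
pose phi p := tC p ^+ 4 * (Msum N c p * (Msum N c p)^*%C).
have phiP : cpoly phi by rewrite /phi; cpoly_tac.
have phiE p : phi p = (tR p ^+ 4 * normsq (Msum N c p))%:C.
  by rewrite /phi mul_conj rcM tRXE.
pose u p := Dsum N c p + (- 3^-1)%:C * phi p.
have uP : cpoly u by rewrite /u; cpoly_tac.
have : 0 <= complex.Re (u q).
  apply: Lop_supersolution => // p pD; rewrite /u LopD; cpoly_tac.
  rewrite LopZ // Lop_Dsum -/(phi p) /phi Lop_antiholomorphic //; last first.
  - exact: d_z_d_zbar_Msum.
  - exact: d_z_Msum.
  rewrite -/(phi p) phiE.
  have := normsq_ge0 (tC p * d_zbar (Msum N c) p - 4 * cplx p * Msum N c p).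
  move: (normsq _) => x x0; move: (tR p ^+ 4 * normsq _) => y.
  have tp : 0 <= tR p ^+ 4 by rewrite exprn_ge0 // ltW // disk_gt0.
  have := mulr_ge0 tp x0; move: (_ * x) => w w0 /=; lra.
rewrite /u phiE -rcM raddfD /=; lra.
Qed.

(** Comparison with a constant [K]: [(Delta - 2) K = - 2 K], and [K] dominates the source by
    Cauchy-Schwarz and the bound on the sum of [|mu_i|^2]. *)
Lemma Dsum_upper N c q : disk q ->
  complex.Re (Dsum N c q) <= mu_sup * \sum_(i < N) normsq (c i).
Proof.
move=> qD; have DP := @cpoly_Dsum N c.
set K := mu_sup * _.
pose u p := K%:C + (-1) * Dsum N c p.
have uP : cpoly u by rewrite /u; cpoly_tac.
have : 0 <= complex.Re (u q).
  apply: Lop_supersolution => // p pD; rewrite /u LopD; cpoly_tac.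
  rewrite LopZ // Lop_Dsum mul_conj.
  have -> : Lop (fun=> K%:C) p = - 2 * K%:C.
    rewrite /Lop.
    have -> : d_zbar (fun=> K%:C : C) = (fun=> 0).
      by apply/funext => ?; exact: d_zbar_cst.
    by rewrite d_z_cst mulr0 add0r mulNr.
  have -> : tC p ^+ 4 * (normsq (Msum N c p))%:C =
      (tR p ^+ 4 * normsq (Msum N c p))%:C by rewrite rcM tRXE.
  have : tR p ^+ 4 * normsq (Msum N c p) <= K.
    have tp : 0 <= tR p ^+ 4 by rewrite exprn_ge0 // ltW // disk_gt0.
    apply: (@le_trans _ _ (tR p ^+ 4 * ((\sum_(i < N) normsq (c i)) *
        (\sum_(i < N) normsq (nu i p))))).
      by rewrite ler_wpM2l //; exact: cauchy_schwarz_normsq.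
    rewrite mulrCA /K [leRHS]mulrC ler_wpM2l //; last exact: sum_normsq_nu.
    by apply: sumr_ge0 => i _; exact: normsq_ge0.
  by move: (tR p ^+ 4 * normsq _) => x xK /=; lra.
by rewrite /u; case: (Dsum N c q) => a b /=; lra.
Qed.

End pointwise_bounds.

(** * The curvature form *)

Section curvature_form.
Variable R : realType.
Local Notation C := R[i].
Implicit Types (p q : R * R) (N : nat) (F G : nat -> nat -> C).

Lemma Re_natM n (x : C) : complex.Re (n%:R * x) = n%:R * complex.Re x.
Proof.
rewrite -(rmorph_nat (real_complex R)); case: x => a b /=.
by rewrite mul0r subr0.
Qed.

Lemma rc_sum I (r : seq I) (f : I -> R) :
  (\sum_(i <- r) f i)%:C = \sum_(i <- r) (f i)%:C :> C.
Proof. exact: (rmorph_sum (real_complex R)). Qed.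

Definition antiherm F := forall i j, F j i = - (F i j)^*%C.

Definition row_sum N F i p : C := \sum_(j < N) F i j * (nu j p)^*%C.

Definition diag_sum N F p : C := Msum N (fun i => row_sum N F i p) p.

Definition Dpot N F p : C := \sum_(i < N) \sum_(j < N) F i j * Dnu i j p.

Definition energy1 N F : R :=
  complex.Re (cint (fun p => 4 * tC p ^+ 4 * (Dpot N F p * (diag_sum N F
    p)^*%C))).

(** The coefficients are frozen at the same [p] at which the potential is evaluated: [D] acts on
    [w |-> |H(w, p)|^2] and the result is taken at [w = p]. The pointwise bounds for constant [c]
    therefore apply at each [p]. *)
Definition energy2 N F : R :=
  complex.Re (cint (fun p => 4 * tC p ^+ 2 * Dsum N (fun i => row_sum N F i p)
    p)).

(** A quarter of [int |h|^2 dA], since [h = t^4 diag_sum] and the density is [4 / t^2]. *)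
Definition diag_norm N F : R :=
  rint (fun p => tR p ^+ 6 * normsq (diag_sum N F p)).

Definition hs_norm N F : R := \sum_(i < N) \sum_(j < N) normsq (F i j).

Lemma cpoly_row_sum N F i : cpoly (row_sum N F i).
Proof.
have MP := @cpoly_nu R; apply: cpoly_sum => j.
by have := MP j => ?; cpoly_tac.
Qed.

Lemma cpoly_diag_sum N F : cpoly (diag_sum N F).
Proof.
rewrite /diag_sum /Msum; apply: cpoly_sum => i.
by have := cpoly_nu R i => ?; have := cpoly_row_sum N F i => ?; cpoly_tac.
Qed.

Lemma cpoly_Dpot N F : cpoly (Dpot N F).
Proof.
apply: cpoly_sum => i; apply: cpoly_sum => j.
by have := cpoly_Dnu R i j => ?; cpoly_tac.
Qed.

Lemma cpoly_Dsum_row N F : cpoly (fun p => Dsum N (fun i => row_sum N F i p) p).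
Proof.
have tP := @cpoly_tC R.
apply: cpoly_sum => i; apply: cpoly_sum => l.
have := cpoly_row_sum N F i => ?; have := cpoly_row_sum N F l => ?.
by have := cpoly_Dnu R i l => ?; cpoly_tac.
Qed.

Lemma rpoly_tRX n : rpoly (fun p : R * R => tR p ^+ n).
Proof.
by apply: rpoly_ext (rpoly_tR_pow R 0 n) => p; rewrite expr0 mulr1.
Qed.

Lemma Lop_Dpot N F p : Lop (fun p => tC p ^+ 2 * Dpot N F p) p =
  - 2 * (tC p ^+ 4 * diag_sum N F p).
Proof.
have tP := @cpoly_tC R.
have WP i j : cpoly (fun p => tC p ^+ 2 * Dnu i j p).
  by have := cpoly_Dnu R i j => ?; cpoly_tac.
have -> : (fun p => tC p ^+ 2 * Dpot N F p) = fun p =>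
    \sum_(i < N) \sum_(j < N) F i j * (tC p ^+ 2 * Dnu i j p).
  apply/funext => q; rewrite mulr_sumr; apply: eq_bigr => i _.
  by rewrite mulr_sumr; apply: eq_bigr => j _; rewrite mulrCA.
rewrite Lop_sum => [|i]; last first.
  by apply: cpoly_sum => j; have := WP i j => ?; cpoly_tac.
rewrite /diag_sum /Msum !mulr_sumr; apply: eq_bigr => i _.
rewrite Lop_sum => [|j]; last by have := WP i j => ?; cpoly_tac.
rewrite /row_sum mulr_suml !mulr_sumr; apply: eq_bigr => j _.
rewrite LopZ; last exact: WP.
rewrite Lop_Dnu !mu_nu conj_tCM.
by move: ((nu j p)^*%C) (nu i p) (tC p) => m m' t; ring.
Qed.

Lemma Re_cint_real (F : R * R -> C) (f : R * R -> R) :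
  (forall p, disk p -> F p = (f p)%:C) -> complex.Re (cint F) = rint f.
Proof. by move=> FE; apply: rint_eq => p pD; rewrite /re_part FE. Qed.

(* Green's formula: with [u = t^2 w], [w = Dpot], the energy
   [int D(h) conj(h) dA] equals [int |u|^2 dA + 2 int |d_zbar u|^2 |dz|^2]. *)
Lemma energy1_ge N F :
  4 * rint (fun p => tR p ^+ 2 * normsq (Dpot N F p)) <= energy1 N F.
Proof.
have tP := @cpoly_tC R; have wP := cpoly_Dpot N F;
  have hP := cpoly_diag_sum N F.
set w := Dpot N F in wP *; set h := diag_sum N F in hP *.
pose u p := tC p ^+ 2 * w p.
have uP : cpoly u by rewrite /u; cpoly_tac.
have u1P := cpoly_d_zbar uP.
pose g p := (d_zbar u p)^*%C.
have gP : cpoly g by rewrite /g; cpoly_tac.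
(* [t * v] is [u * conj (d_zbar u)], the field of Green's formula, with one factor [t] exposed so
   that its divergence integrates to 0. *)
pose v p := tC p * w p * g p.
have vP : cpoly v by rewrite /v; cpoly_tac.
have vE : (fun p => tC p * v p) = (fun p => u p * g p).
  by apply/funext => p; rewrite /v /u; move: (g p) => x; cring.
have tvP : cpoly (fun p => tC p * v p) by cpoly_tac.
have E p : disk p -> 4 * tC p ^+ 4 * (w p * (h p)^*%C) =
    (4 * (tR p ^+ 2 * normsq (w p)) + 2 * normsq (d_zbar u p))%:C +
    (- 2) * d_zbar (fun p => tC p * v p) p.
  move=> pD; have t0 := tC_neq0 pD.
  have zz : d_z (d_zbar u) p = 2 * (w p - tC p ^+ 2 * h p).
    have := Lop_Dpot N F p; rewrite -/w -/h -/u /Lop /u.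
    move: (d_z _ p) => x.
    move=> /eqP; rewrite subr_eq => /eqP xE.
    have t20 : tC p ^+ 2 != 0 by rewrite expf_neq0.
    by apply: (mulfI t20); rewrite xE; cring.
  rewrite vE d_zbarM // [d_zbar g p]d_zbar_conj // zz.
  have -> : ((2 * (w p - tC p ^+ 2 * h p))^*)%C =
      2 * ((w p)^*%C - tC p ^+ 2 * (h p)^*%C).
    rewrite conjM conjB conj_tCM; congr (_ * _).
    exact: (rmorph_nat (@conjc R)).
  have -> : (4 * (tR p ^+ 2 * normsq (w p)) + 2 * normsq (d_zbar u p))%:C =
      4 * (tC p ^+ 2 * (w p * (w p)^*%C)) + 2 * (d_zbar u p * g p).
    rewrite /g !mul_conj -tRXE -!(rmorph_nat (real_complex R)) -!rcM.
    exact: rmorphD.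
  rewrite /u; move: (g p) ((w p)^*%C) ((h p)^*%C) (w p) => x y z r; cring.
have -> : energy1 N F = complex.Re (cint (fun p =>
    (4 * (tR p ^+ 2 * normsq (w p)) + 2 * normsq (d_zbar u p))%:C +
    (- 2) * d_zbar (fun p => tC p * v p) p)).
  by congr complex.Re; apply: cint_eq.
have r1 : rpoly (fun p => tR p ^+ 2 * normsq (w p)).
  by apply: rpolyM; [exact: rpoly_tRX|exact: rpoly_normsq].
have r2 : rpoly (fun p => normsq (d_zbar u p)) by exact: rpoly_normsq.
have r3 : rpoly (fun p => 4 * (tR p ^+ 2 * normsq (w p)) + 2 * normsq (d_zbar u
  p)).
  by apply: rpolyD; (apply: rpolyM => //; exact: rpoly_cst).
rewrite cintD; [|exact: cpoly_real|by cpoly_tac].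
rewrite cintZ; last by cpoly_tac.
rewrite cint_d_zbar // mulr0 addr0.
rewrite (@Re_cint_real _ (fun p => 4 * (tR p ^+ 2 * normsq (w p)) +
  2 * normsq (d_zbar u p))) //.
rewrite rintD ?rintZ //; try by apply: rpolyM => //; exact: rpoly_cst.
rewrite lerDl mulr_ge0 //; apply: rint_ge0 => p _; exact: normsq_ge0.
Qed.

Lemma rpoly_diag_norm N F : rpoly (fun p => tR p ^+ 6 * normsq (diag_sum N F
  p)).
Proof. by apply: rpolyM;
  [exact: rpoly_tRX|apply/rpoly_normsq/cpoly_diag_sum]. Qed.

Lemma rpoly_Dpot_norm N F : rpoly (fun p => tR p ^+ 2 * normsq (Dpot N F p)).
Proof. by apply: rpolyM; [exact: rpoly_tRX|apply/rpoly_normsq/cpoly_Dpot]. Qed.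

Lemma tR_ge0 n p : disk p -> 0 <= tR p ^+ n.
Proof. by move=> /disk_gt0 t0; rewrite exprn_ge0 // ltW. Qed.

Lemma tR4_ge0 n p : disk p -> 0 <= 4 * tR p ^+ n.
Proof. by move=> pD; apply: mulr_ge0 => //; exact: tR_ge0. Qed.

Lemma energy1_ge0 N F : 0 <= energy1 N F.
Proof.
apply: le_trans (energy1_ge N F); apply: mulr_ge0 => //.
by apply: rint_ge0 => p pD; rewrite mulr_ge0 ?tR_ge0 ?normsq_ge0.
Qed.

(** [D] is a contraction: AM-GM bounds the energy by half of [int |D h|^2 dA] plus half of
    [int |h|^2 dA], and the former integral is absorbed by [energy1_ge]. *)
Lemma energy1_le N F : energy1 N F <= 4 * diag_norm N F.
Proof.
have wP := cpoly_Dpot N F; have hP := cpoly_diag_sum N F.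
have r1 := rpoly_Dpot_norm N F; have r2 := rpoly_diag_norm N F.
have c2 (x : R) : rpoly (fun _ : R * R => x) by exact: rpoly_cst.
have tP := @cpoly_tC R.
suff : energy1 N F <= 2 * rint (fun p => tR p ^+ 2 * normsq (Dpot N F p)) +
    2 * diag_norm N F by have := energy1_ge N F; lra.
have FP : cpoly (fun p => 4 * tC p ^+ 4 * (Dpot N F p * (diag_sum N F p)^*%C)).
  by cpoly_tac.
rewrite /diag_norm -!rintZ // -rintD //; try exact: rpolyM.
apply: rint_le; first by case: FP.
  by apply: rpolyD; exact: rpolyM.
move=> p pD; rewrite /re_part.
have := Re_mul_conj_le (tC p * Dpot N F p) (tC p ^+ 3 * diag_sum N F p).
rewrite (normsqM (tC p) (Dpot _ _ _)) (normsqM (tC p ^+ 3)) normsq_tC (_ :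
  normsq (tC p) = tR p ^+ 2); last first.
  by rewrite -[tC p]expr1 normsq_tC.
rewrite conj_tCM.
have -> : tC p * Dpot N F p * (tC p ^+ 3 * (diag_sum N F p)^*%C) =
    tC p ^+ 4 * (Dpot N F p * (diag_sum N F p)^*%C).
  by move: (Dpot N F p) ((diag_sum N F p)^*%C) => x y; cring.
have -> : complex.Re (4 * tC p ^+ 4 * (Dpot N F p * (diag_sum N F p)^*%C)) =
    4 * complex.Re (tC p ^+ 4 * (Dpot N F p * (diag_sum N F p)^*%C)).
  by rewrite -mulrA Re_natM.
by move: (complex.Re _) => x; lra.
Qed.

Lemma energy2E N F : energy2 N F = rint (fun p => 4 * tR p ^+ 2 *
  complex.Re (Dsum N (fun i => row_sum N F i p) p)).
Proof.
apply: rint_eq => p _;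
  rewrite /re_part -tRXE -(rmorph_nat (real_complex R)) -rcM.
by case: (Dsum _ _ _) => a b /=; ring.
Qed.

Lemma rpoly_energy2 N F : rpoly (fun p => 4 * tR p ^+ 2 *
  complex.Re (Dsum N (fun i => row_sum N F i p) p)).
Proof.
apply: rpolyM; last by case: (cpoly_Dsum_row N F).
by apply: rpolyM; [exact: rpoly_cst|exact: rpoly_tRX].
Qed.

Lemma energy2_ge N F : 4 / 3 * diag_norm N F <= energy2 N F.
Proof.
rewrite energy2E -rintZ; last exact: rpoly_diag_norm.
apply: rint_le.
- by apply: rpolyM; [exact: rpoly_cst|exact: rpoly_diag_norm].
- exact: rpoly_energy2.
move=> p pD.
have := Dsum_lower N (fun i => row_sum N F i p) pD.
rewrite -/(diag_sum N F p) => h.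
have -> : 4 / 3 * (tR p ^+ 6 * normsq (diag_sum N F p)) =
  4 * tR p ^+ 2 * (tR p ^+ 4 * normsq (diag_sum N F p) / 3) by ring.
by rewrite ler_wpM2l // mulr_ge0 // tR_ge0.
Qed.

Definition row_norm N F p : R := \sum_(i < N) normsq (row_sum N F i p).

Lemma rpoly_sum I (r : seq I) (f : I -> R * R -> R) :
  (forall i, rpoly (f i)) -> rpoly (fun p => \sum_(i <- r) f i p).
Proof.
move=> fP; elim: r => [|i r IH].
  by apply: rpoly_ext (rpoly_cst 0) => p; rewrite big_nil.
by apply: rpoly_ext (rpolyD (fP i) IH) => p; rewrite big_cons.
Qed.

Lemma rpoly_row_norm N F : rpoly (row_norm N F).
Proof. by apply: rpoly_sum => i; apply/rpoly_normsq/cpoly_row_sum. Qed.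

(** Parseval in the second variable of [H]. *)
Lemma rint_row_norm N F :
  rint (fun p => 4 * tR p ^+ 2 * row_norm N F p) = mu_norm R * hs_norm N F.
Proof.
have tP := @cpoly_tC R.
have MP j k : cpoly (fun p => 4 * tC p ^+ 2 * (nu k p * (nu j p)^*%C)).
  by have := cpoly_nu R j => ?; have := cpoly_nu R k => ?; cpoly_tac.
rewrite -(@Re_cint_real (fun p => \sum_(i < N) \sum_(j < N) \sum_(k < N)
  (F i j * (F i k)^*%C) * (4 * tC p ^+ 2 * (nu k p * (nu j p)^*%C))));
    last first.
  move=> p _; rewrite rcM.
  have -> : (4 * tR p ^+ 2)%:C = 4 * tC p ^+ 2 :> C.
    by rewrite rcM tRXE; congr (_ * _); exact: (rmorph_nat (real_complex R)).
  rewrite /row_norm rc_sum mulr_sumr; apply: eq_bigr => i _.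
  rewrite -mul_conj /row_sum conj_sum mulr_suml mulr_sumr;
    apply: eq_bigr => j _.
  rewrite mulr_sumr mulr_sumr; apply: eq_bigr => k _.
  rewrite (conjM (F i k)) conjcK.
  by move: ((F i k)^*%C) (nu k p) ((nu j p)^*%C) => x y z; cring.
rewrite cint_sum => [|i]; last first.
  by apply: cpoly_sum => j; apply: cpoly_sum => k; have := MP j k => ?;
    cpoly_tac.
rewrite /hs_norm mulr_sumr raddf_sum; apply: eq_bigr => i _.
rewrite cint_sum => [|j]; last first.
  by apply: cpoly_sum => k; have := MP j k => ?; cpoly_tac.
rewrite mulr_sumr raddf_sum; apply: eq_bigr => j _.
rewrite cint_sum => [|k]; last by have := MP j k => ?; cpoly_tac.
rewrite (bigD1 j) //= big1 => [|k kj]; rewrite cintZ ?nu_orthogonal //.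
  by rewrite eqxx addr0 mul_conj -rcM mulrC.
by move: kj; rewrite -val_eqE /= => /negbTE ->; rewrite mulr0.
Qed.

Lemma energy2_le N F : energy2 N F <= mu_sup R * (mu_norm R * hs_norm N F).
Proof.
rewrite energy2E -rint_row_norm -rintZ; last first.
  apply: rpolyM; last exact: rpoly_row_norm.
  by apply: rpolyM; [exact: rpoly_cst|exact: rpoly_tRX].
apply: rint_le.
- exact: rpoly_energy2.
- apply: rpolyM; first exact: rpoly_cst.
  apply: rpolyM; last exact: rpoly_row_norm.
  by apply: rpolyM; [exact: rpoly_cst|exact: rpoly_tRX].
move=> p pD; rewrite [leRHS]mulrCA ler_wpM2l ?tR4_ge0 //.
exact: (Dsum_upper N (fun i => row_sum N F i p) pD).
Qed.

(** Restriction to the diagonal is bounded: Cauchy-Schwarz in the first variable costs the sum of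
    [|mu_i|^2], and Parseval handles the second variable. *)
Lemma diag_norm_le N F : 4 * diag_norm N F <= mu_sup R * (mu_norm R * hs_norm N
  F).
Proof.
have r1 := rpoly_diag_norm N F.
have r2 : rpoly (fun p => 4 * tR p ^+ 2 * row_norm N F p).
  apply: rpolyM; last exact: rpoly_row_norm.
  by apply: rpolyM; [exact: rpoly_cst|exact: rpoly_tRX].
rewrite -rint_row_norm /diag_norm -!rintZ //.
apply: rint_le.
- by apply: rpolyM; [exact: rpoly_cst|exact: rpoly_diag_norm].
- apply: rpolyM; first exact: rpoly_cst.
  apply: rpolyM; last exact: rpoly_row_norm.
  by apply: rpolyM; [exact: rpoly_cst|exact: rpoly_tRX].
move=> p pD.
have -> : 4 * (tR p ^+ 6 * normsq (diag_sum N F p)) =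
  4 * tR p ^+ 2 * (tR p ^+ 4 * normsq (diag_sum N F p)) by ring.
rewrite [leRHS]mulrCA ler_wpM2l ?tR4_ge0 //.
apply: (@le_trans _ _ (tR p ^+ 4 * (row_norm N F p *
    (\sum_(i < N) normsq (nu i p))))).
  by rewrite ler_wpM2l ?tR_ge0 //; exact: cauchy_schwarz_normsq.
rewrite mulrCA [leRHS]mulrC ler_wpM2l //; last exact: sum_normsq_nu.
by apply: sumr_ge0 => i _; exact: normsq_ge0.
Qed.

(** * The curvature contraction as a sum of two energies *)

Definition curv_form N F G : C := \sum_(i < N) \sum_(j < N) F i j *
  \sum_(k < N) \sum_(l < N) G k l *
    curv4 (@mu R i) (@mu R j) (@mu R k) (@mu R l).

(** [curv_form] is bilinear, not sesquilinear; here and in [row_sum_conj] the anti-Hermitian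
    symmetry supplies the conjugates, and with them the minus sign of the curvature. *)
Lemma diag_sum_conj N F p : antiherm F ->
  (diag_sum N F p)^*%C = - diag_sum N F p.
Proof.
move=> FA.
have -> : diag_sum N F p =
    \sum_(i < N) \sum_(j < N) F i j * ((nu j p)^*%C * nu i p).
  apply: eq_bigr => i _; rewrite mulr_suml; apply: eq_bigr => j _.
  by rewrite mulrA.
transitivity (\sum_(i < N) \sum_(j < N)
    (F i j * ((nu j p)^*%C * nu i p))^*%C).
  by rewrite conj_sum; apply: eq_bigr => i _; rewrite conj_sum.
rewrite exchange_big -sumrN; apply: eq_bigr => j _.
rewrite -sumrN; apply: eq_bigr => i _.
rewrite (conjM (F i j)) (conjM (nu j p)^*%C) conjcK (FA i j) mulNr opprK.
by rewrite [nu j p * _]mulrC.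
Qed.

Lemma row_sum_conj N F l p : antiherm F ->
  (row_sum N F l p)^*%C = - \sum_(k < N) F k l * nu k p.
Proof.
move=> FA; rewrite /row_sum conj_sum -sumrN; apply: eq_bigr => k _.
by rewrite (conjM (F l k)) conjcK (FA l k) mulNr opprK.
Qed.

Lemma cint_sum4 N F G (A : nat -> nat -> nat -> nat -> R * R -> C) :
  (forall i j k l, cpoly (A i j k l)) ->
  \sum_(i < N) \sum_(j < N) F i j * (\sum_(k < N) \sum_(l < N) G k l *
    cint (A i j k l)) =
  cint (fun p => \sum_(i < N) \sum_(j < N) F i j *
    (\sum_(k < N) \sum_(l < N) G k l * A i j k l p)).
Proof.
move=> AP.
have P1 i j k : cpoly (fun p => \sum_(l < N) G k l * A i j k l p).
  by apply: cpoly_sum => l; have := AP i j k l => ?; cpoly_tac.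
have P2 i j : cpoly (fun p => \sum_(k < N) \sum_(l < N) G k l * A i j k l p).
  by apply: cpoly_sum => k; exact: P1.
rewrite cint_sum => [|i]; last first.
  by apply: cpoly_sum => j; have := P2 i j => ?; cpoly_tac.
apply: eq_bigr => i _; rewrite cint_sum => [|j]; last first.
  by have := P2 i j => ?; cpoly_tac.
apply: eq_bigr => j _; rewrite cintZ; last exact: P2.
congr (_ * _); rewrite cint_sum => [|k]; last exact: P1.
apply: eq_bigr => k _; rewrite cint_sum => [|l]; last first.
  by have := AP i j k l => ?; cpoly_tac.
by apply: eq_bigr => l _; rewrite cintZ.
Qed.

Lemma curv_form_energy N F : antiherm F ->
  complex.Re (curv_form N F F) = - (energy1 N F + energy2 N F).
Proof.
move=> FA; have tP := @cpoly_tC R.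
pose A i j k l p : C := 4 * tC p ^+ 4 * (Dnu i j p * nu k p * (nu l p)^*%C).
have AP i j k l : cpoly (A i j k l).
  have := cpoly_Dnu R i j => ?; have := cpoly_nu R k => ?.
  by have := cpoly_nu R l => ?; rewrite /A; cpoly_tac.
have -> : curv_form N F F =
    (\sum_(i < N) \sum_(j < N) F i j *
      \sum_(k < N) \sum_(l < N) F k l * cint (A i j k l)) +
    (\sum_(i < N) \sum_(j < N) F i j *
      \sum_(k < N) \sum_(l < N) F k l * cint (A i l k j)).
  rewrite -big_split /=; apply: eq_bigr => i _; rewrite -big_split /=.
  apply: eq_bigr => j _; rewrite -mulrDr -big_split /=; congr (_ * _).
  apply: eq_bigr => k _; rewrite -big_split /=; apply: eq_bigr => l _.
  by rewrite -mulrDr curv4E.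
rewrite cint_sum4 // (@cint_sum4 N F F (fun i j k l => A i l k j)) // raddfD
  opprD.
have wP := cpoly_Dpot N F; have hP := cpoly_diag_sum N F;
  have dP := cpoly_Dsum_row N F.
have NE (X Y : R * R -> C) : cpoly Y -> (forall p, X p = - Y p) ->
    complex.Re (cint X) = - complex.Re (cint Y).
  move=> YP XY; transitivity (complex.Re (- cint Y)); last exact: raddfN.
  congr complex.Re; rewrite -mulN1r -cintZ //; apply: cint_eq => p _.
  by rewrite mulN1r.
congr (_ + _); (apply: NE => [|p]; first by cpoly_tac).
- rewrite diag_sum_conj // mulrN mulrN opprK.
  rewrite /Dpot mulr_suml mulr_sumr; apply: eq_bigr => i _.
  rewrite mulr_suml !mulr_sumr; apply: eq_bigr => j _.
  rewrite /diag_sum /Msum !mulr_sumr; apply: eq_bigr => k _.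
  rewrite /row_sum mulr_suml !mulr_sumr; apply: eq_bigr => l _.
  by rewrite /A; move: (Dnu i j p) (nu k p) ((nu l p)^*%C) => x y z; cring.
- rewrite /Dsum mulr_sumr -sumrN; apply: eq_bigr => i _.
  (* In the second curvature term [D] couples [i] with [l]. The sums over [j] and [k] must come
     innermost, to form [row_sum] at [i] and the conjugate of [row_sum] at [l]. *)
  transitivity (\sum_(l < N) \sum_(j < N) \sum_(k < N)
      F i j * (F k l * A i l k j p)).
    rewrite exchange_big /=; apply: eq_bigr => j _.
    rewrite exchange_big /= mulr_sumr; apply: eq_bigr => l _.
    by rewrite mulr_sumr.
  rewrite mulr_sumr -sumrN; apply: eq_bigr => l _.
  rewrite row_sum_conj // /row_sum mulrN mulNr mulrN opprK.
  rewrite !mulr_suml mulr_sumr; apply: eq_bigr => j _.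
  rewrite mulr_sumr mulr_suml mulr_sumr; apply: eq_bigr => k _.
  by rewrite /A; move: (Dnu i l p) (nu k p) ((nu j p)^*%C) => x y z; cring.
Qed.

Definition qform N F : R := - complex.Re (curv_form N F F).

Lemma qformE N F : antiherm F -> qform N F = energy1 N F + energy2 N F.
Proof. by move=> FA; rewrite /qform curv_form_energy // opprK. Qed.

Lemma diag_norm_ge0 N F : 0 <= diag_norm N F.
Proof. by apply: rint_ge0 => p pD; rewrite mulr_ge0 ?tR_ge0 ?normsq_ge0. Qed.

Lemma qform_ge N F : antiherm F -> 4 / 3 * diag_norm N F <= qform N F.
Proof.
move=> FA; rewrite qformE //; apply: le_trans (energy2_ge N F) _.
by rewrite lerDr energy1_ge0.
Qed.

Lemma qform_ge0 N F : antiherm F -> 0 <= qform N F.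
Proof.
move=> FA; apply: le_trans (qform_ge N FA).
by rewrite mulr_ge0 // diag_norm_ge0.
Qed.

Definition qbound : R := 2 * (mu_sup R * mu_norm R).

Lemma qform_le N F : antiherm F -> qform N F <= qbound * hs_norm N F.
Proof.
move=> FA; rewrite qformE // /qbound.
have h1 := energy1_le N F; have h2 := energy2_le N F;
  have h3 := diag_norm_le N F.
have -> : 2 * (mu_sup R * mu_norm R) * hs_norm N F = mu_sup R * (mu_norm R *
  hs_norm N F) +
  mu_sup R * (mu_norm R * hs_norm N F) by ring.
by apply: lerD => //; apply: le_trans h3.
Qed.

Lemma qbound_ge0 : 0 <= qbound.
Proof.
rewrite mulr_ge0 // mulr_ge0 ?mu_sup_ge0 // divr_ge0 ?pi_ge0 //.
by rewrite mulr_ge0 // beta_int_ge0.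
Qed.

(** * Perturbation and truncation of the quadratic form *)

Lemma curv_form_lin N F X (a : C) :
  curv_form N (fun i j => F i j + a * X i j) (fun i j => F i j + a * X i j) =
  curv_form N F F + a * (curv_form N F X + curv_form N X F) + a ^+ 2 *
    curv_form N X X.
Proof.
have lin (f g h : nat -> nat -> C) :
    \sum_(i < N) \sum_(j < N) (f i j + a * g i j) * h i j =
    \sum_(i < N) \sum_(j < N) f i j * h i j +
    a * \sum_(i < N) \sum_(j < N) g i j * h i j.
  rewrite mulr_sumr -big_split /=; apply: eq_bigr => i _.
  rewrite mulr_sumr -big_split /=; apply: eq_bigr => j _.
  by rewrite mulrDl mulrA.
have lin2 (f g1 g2 : nat -> nat -> C) :
    \sum_(i < N) \sum_(j < N) f i j * (g1 i j + a * g2 i j) =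
    \sum_(i < N) \sum_(j < N) f i j * g1 i j +
    a * \sum_(i < N) \sum_(j < N) f i j * g2 i j.
  rewrite mulr_sumr -big_split /=; apply: eq_bigr => i _.
  rewrite mulr_sumr -big_split /=; apply: eq_bigr => j _.
  by rewrite mulrDr mulrCA.
have E (H : nat -> nat -> C) : curv_form N H (fun i j => F i j + a * X i j) =
    curv_form N H F + a * curv_form N H X.
  pose S (G : nat -> nat -> C) i j := \sum_(k < N) \sum_(l < N) G k l *
    curv4 (@mu R i) (@mu R j) (@mu R k) (@mu R l).
  rewrite /curv_form -(lin2 H (S F) (S X)); apply: eq_bigr => i _.
  apply: eq_bigr => j _; congr (_ * _).
  exact: (lin F X (fun k l => curv4 (@mu R i) (@mu R j) (@mu R k) (@mu R l))).
have E2 (H : nat -> nat -> C) : curv_form N (fun i j => F i j + a * X i j) H =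
    curv_form N F H + a * curv_form N X H.
  exact: (lin F X (fun i j => \sum_(k < N) \sum_(l < N) H k l *
    curv4 (@mu R i) (@mu R j) (@mu R k) (@mu R l))).
by rewrite E !E2; ring.
Qed.

Lemma antiherm_lin F X (a : R) : antiherm F -> antiherm X ->
  antiherm (fun i j => F i j + a%:C * X i j).
Proof.
move=> FA XA i j; rewrite FA XA.
case: (F i j) (X i j) => [x x'] [y y'].
by apply/eqP; rewrite eq_complex /=; apply/andP; split; apply/eqP; ring.
Qed.

Lemma qform_lin N F X (a : R) :
  qform N (fun i j => F i j + a%:C * X i j) = qform N F +
  a * - complex.Re (curv_form N F X + curv_form N X F) + a ^+ 2 * qform N X.
Proof.
rewrite /qform curv_form_lin;
  move: (curv_form N F F) (curv_form N X X) (curv_form N F X + curv_form N X F).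
move=> [x x'] [y y'] [w w']; rewrite (expr2 a%:C) -rcM /=; ring.
Qed.

(* The quadratic form being nonnegative at [F +/- X / e], its cross term is
   controlled by the AM-GM inequality. *)
Lemma qform_perturb N F X (e : R) : antiherm F -> antiherm X -> 0 < e ->
  `|qform N (fun i j => F i j + X i j) - qform N F| <=
  e * qform N F + (1 + e^-1) * qform N X.
Proof.
move=> FA XA e0.
have -> : (fun i j => F i j + X i j) = (fun i j => F i j + 1%:C * X i j).
  by apply/funext => i; apply/funext => j; rewrite mul1r.
have h1 := qform_ge0 N (antiherm_lin e^-1 FA XA).
have h2 := qform_ge0 N (antiherm_lin (- e^-1) FA XA).
have hX := qform_ge0 N XA.
rewrite qform_lin in h1; rewrite qform_lin in h2; rewrite qform_lin.
move: (qform N F) (qform N X) (- complex.Re _) h1 h2 hX => x y c h1 h2 y0.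
have k1 : - c <= e * x + e^-1 * y.
  have := mulr_ge0 (ltW e0) h1.
  have -> : e * (x + e^-1 * c + e^-1 ^+ 2 * y) = e * x + c + e^-1 * y.
    by field; rewrite gt_eqF.
  lra.
have k2 : c <= e * x + e^-1 * y.
  have := mulr_ge0 (ltW e0) h2.
  have -> : e * (x + - e^-1 * c + (- e^-1) ^+ 2 * y) = e * x - c + e^-1 * y.
    by field; rewrite gt_eqF.
  lra.
rewrite mulrDl mul1r ler_norml expr1n !mul1r; apply/andP; split; lra.
Qed.

(** Padding by zeros makes [qform N F] a value of the larger form [qform M], so both truncations are
    compared inside one quadratic form. *)
Definition truncF N F i j : C := if (i < N)%N && (j < N)%N then F i j else 0.

Lemma sum_truncF (V : zmodType) N M F (g : C -> nat -> nat -> V) : (N <= M)%N ->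
  (forall i j, g 0 i j = 0) ->
  \sum_(i < M) \sum_(j < M) g (truncF N F i j) i j =
  \sum_(i < N) \sum_(j < N) g (F i j) i j.
Proof.
move=> NM g0.
rewrite [RHS](big_ord_widen M (fun i => \sum_(j < N) g (F i j) i j) NM)
  [RHS]big_mkcond.
apply: eq_bigr => i _; case: ifP => iN; last first.
  by apply: big1 => j _; rewrite /truncF iN.
rewrite [RHS](big_ord_widen M (fun j => g (F i j) i j) NM) [RHS]big_mkcond.
by apply: eq_bigr => j _; rewrite /truncF iN /=; case: (j < N)%N.
Qed.

Lemma curv_form_truncF N M F : (N <= M)%N ->
  curv_form M (truncF N F) (truncF N F) = curv_form N F F.
Proof.
move=> NM.
pose S i j := \sum_(k < M) \sum_(l < M) truncF N F k l *
  curv4 (@mu R i) (@mu R j) (@mu R k) (@mu R l).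
transitivity (\sum_(i < N) \sum_(j < N) F i j * S i j).
  by apply: (@sum_truncF _ N M F (fun x i j => x * S i j)) => // i j;
    rewrite mul0r.
apply: eq_bigr => i _; apply: eq_bigr => j _; congr (_ * _).
apply: (@sum_truncF _ N M F (fun x k l => x *
  curv4 (@mu R i) (@mu R j) (@mu R k) (@mu R l))) => // k l.
by rewrite mul0r.
Qed.

Lemma normsq0 : normsq (0 : C) = 0.
Proof. by rewrite (normsq_real 0) expr0n. Qed.

Lemma hs_norm_truncF N M F : (N <= M)%N ->
  hs_norm M (fun i j => F i j - truncF N F i j) = hs_norm M F - hs_norm N F.
Proof.
move=> NM; apply/eqP; rewrite eq_sym subr_eq; apply/eqP.
have -> : hs_norm N F = \sum_(i < M) \sum_(j < M) normsq (truncF N F i j).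
  apply/esym/(@sum_truncF _ N M F (fun x i j => normsq x)) => // *.
  exact: normsq0.
rewrite -big_split /=; apply: eq_bigr => i _.
rewrite -big_split /=; apply: eq_bigr => j _; rewrite /truncF.
by case: ifP => _; rewrite ?subrr ?subr0 normsq0 ?add0r ?addr0.
Qed.

Lemma antiherm_truncF N F : antiherm F -> antiherm (truncF N F).
Proof.
move=> FA i j; rewrite /truncF andbC; case: ifP => _ //.
by rewrite rmorph0 oppr0.
Qed.

(** [qform_perturb] at the padded truncation, perturbed by the remainder. The tail carries the
    factor [e^-1], so [e] is to be fixed before [N]. *)
Lemma qform_truncation N M F (e : R) : antiherm F -> 0 < e -> (N <= M)%N ->
  `|qform M F - qform N F| <=
  e * (qbound * hs_norm N F) + (1 + e^-1) * (qbound * (hs_norm M F - hs_norm N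
    F)).
Proof.
move=> FA e0 NM; have TA := antiherm_truncF N FA.
have XA : antiherm (fun i j => F i j - truncF N F i j).
  move=> i j; rewrite FA TA; move: (F i j) (truncF _ _ _ _) => [a b] [c d].
  by apply/eqP; rewrite eq_complex /=; apply/andP; split; apply/eqP; ring.
have := qform_perturb M TA XA e0.
have -> : (fun i j => truncF N F i j + (F i j - truncF N F i j)) = F.
  by apply/funext => i; apply/funext => j; rewrite addrC subrK.
have -> : qform M (truncF N F) = qform N F by rewrite /qform curv_form_truncF.
move=> /le_trans; apply; apply: lerD.
  by apply: ler_wpM2l; [exact: ltW|exact: qform_le].
apply: ler_wpM2l; first by rewrite addr_ge0 // invr_ge0 ltW.
by apply: le_trans (qform_le M XA) _; rewrite hs_norm_truncF.
Qed.

End curvature_form.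

(** * Convergence and strictness *)

Section strictness.
Variable R : realType.
Local Notation C := R[i].
Implicit Types (p q : R * R) (N : nat) (F : nat -> nat -> C).

Lemma hs_norm_homo F : {homo (fun N => hs_norm N F) : n m / (n <= m)%N >-> n <=
  m}.
Proof.
move=> N M NM; rewrite -subr_ge0 -hs_norm_truncF //.
by apply: sumr_ge0 => i _; apply: sumr_ge0 => j _; exact: normsq_ge0.
Qed.

Lemma qform_cvg F (A : R) : antiherm F -> (forall N, hs_norm N F <= A) ->
  cvgn (fun N => qform N F).
Proof.
move=> FA FB; apply: cauchy_cvg; apply: cauchy_exP => e e0.
have A0 : 0 <= A.
  by apply: le_trans (FB 0%N); rewrite /hs_norm big_ord0.
have K0 := qbound_ge0 R; set K := qbound R in K0 *.
have KA : 0 < K * A + 1 by rewrite ltr_wpDl // mulr_ge0.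
(* [d] makes the first error term less than [e / 2]; [d'] is then the tail size that keeps the
   second at most [e / 2]. The added 1 in the denominators covers vanishing [K] or [A]. *)
pose d := e / (2 * (K * A + 1)).
have d0 : 0 < d by rewrite divr_gt0 // mulr_gt0.
have dV : 0 < 1 + d^-1 by rewrite addr_gt0 // invr_gt0.
have dK : 0 < (1 + d^-1) * (K + 1) by rewrite mulr_gt0 // ltr_wpDl.
pose d' := e / (2 * ((1 + d^-1) * (K + 1))).
have d'0 : 0 < d' by rewrite divr_gt0 // mulr_gt0.
have nd : nondecreasing_seq (fun N => hs_norm N F).
  by move=> n m nm; exact: hs_norm_homo.
have nc : cvgn (fun N => hs_norm N F).
  by apply: nondecreasing_is_cvgn => //; exists A => _ [n _ <-].
have /cvgrPdist_lt/(_ _ d'0)[N _ NP] := nc.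
exists (qform N F); exists N => // M /= NM.
rewrite /ball /= distrC; apply: le_lt_trans (qform_truncation FA d0 NM) _.
have h1 : d * (K * hs_norm N F) <= d * (K * A).
  by apply: ler_wpM2l; [exact: ltW|exact: ler_wpM2l].
have h2 : hs_norm M F - hs_norm N F < d'.
  have := NP N (leqnn N); have := nondecreasing_cvgn_le nd nc M.
  have := nondecreasing_cvgn_le nd nc N => /= h3 h4.
  by rewrite ger0_norm ?subr_ge0 //; lra.
have h3 : (1 + d^-1) * (K * (hs_norm M F - hs_norm N F)) <= (1 + d^-1) * (K *
  d').
  by apply: ler_wpM2l; [exact: ltW|apply: ler_wpM2l => //; exact: ltW].
have h4 : d * (K * A) < e / 2.
  rewrite /d [X in X < _](_ : _ = e / 2 * ((K * A) / (K * A + 1))); last first.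
    by field; rewrite gt_eqF.
  rewrite -[X in _ < X]mulr1 ltr_pM2l ?divr_gt0 // ltr_pdivrMr // mul1r; lra.
have h5 : (1 + d^-1) * (K * d') <= e / 2.
  rewrite /d' [X in X <= _](_ : _ = e / 2 * (K / (K + 1))); last first.
    have K1 : 0 < K + 1 by rewrite ltr_wpDl.
    by move: (1 + d^-1) dV => y y0; field; rewrite !gt_eqF.
  rewrite -[X in _ <= X]mulr1; apply: ler_wpM2l; first by rewrite divr_ge0 ?ltW.
  by rewrite ler_pdivrMr ?ltr_wpDl // mul1r; lra.
by rewrite -/K; lra.
Qed.

(** A shift of the index by [k0 + 1] enlarges [nu_coef ^+ 2] by at most [k0.+2 ^ 3]. Factoring out
    [|z|^(2 (k0 + 1))] leaves the sum of [|nu k|^2], and four of the powers of [t] pay for its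
    bound. *)
Lemma beta_int_tail (k0 b N : nat) :
  \sum_(k < N) nu_coef R (k0.+1 + k) ^+ 2 * beta_int R (k0.+1 + k) b.+4 <=
  k0.+2%:R ^+ 3 * mu_sup R * beta_int R k0.+1 b.
Proof.
have P j c : rpoly (fun p : R * R => tR p ^+ c * sqnorm p ^+ j)
  by exact: rpoly_tR_pow.
have -> : \sum_(k < N) nu_coef R (k0.+1 + k) ^+ 2 * beta_int R (k0.+1 + k) b.+4
  =
    rint (fun p : R * R => \sum_(k < N) nu_coef R (k0.+1 + k) ^+ 2 *
      (tR p ^+ b.+4 * sqnorm p ^+ (k0.+1 + k))).
  elim: N => [|N IH].
    rewrite big_ord0; transitivity (rint (fun p : R * R => 0 * 1)).
      by rewrite rintZ ?mul0r //; exact: rpoly_cst.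
    by apply: rint_eq => p _; rewrite big_ord0 mul0r.
  rewrite big_ord_recr /= IH /beta_int -rintZ // -rintD.
  - by apply: rint_eq => p _; rewrite big_ord_recr.
  - by apply: rpoly_sum => k; apply: rpolyM => //; exact: rpoly_cst.
  - by apply: rpolyM => //; exact: rpoly_cst.
rewrite /beta_int -rintZ //; apply: rint_le.
- by apply: rpoly_sum => k; apply: rpolyM => //; exact: rpoly_cst.
- by apply: rpolyM => //; exact: rpoly_cst.
move=> p pD; have s0 := sqnorm_ge0 p.
have t0 n : 0 <= tR p ^+ n by exact: tR_ge0.
have sn n : 0 <= sqnorm p ^+ n by rewrite exprn_ge0.
apply: (@le_trans _ _ (k0.+2%:R ^+ 3 * (tR p ^+ b * sqnorm p ^+ k0.+1) *
    (tR p ^+ 4 * \sum_(k < N) normsq (nu k p)))); last first.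
  rewrite [leRHS]mulrAC; apply: ler_wpM2l; last exact: sum_normsq_nu.
  by rewrite !mulr_ge0 // exprn_ge0.
rewrite !mulr_sumr; apply: ler_sum => k _; rewrite normsq_nu -(addn4 b) !exprD.
have h : nu_coef R (k0.+1 + k) ^+ 2 <= k0.+2%:R ^+ 3 * nu_coef R k ^+ 2.
  rewrite !nu_coef_sqr mulrA ler_wpM2r ?invr_ge0 ?mulr_ge0 ?pi_ge0 //.
  have -> : (k0.+2%:R : R) ^+ 3 * (k.+1 * k.+2 * k.+3)%:R =
    (k0.+2 ^ 3 * (k.+1 * k.+2 * k.+3))%:R by rewrite -natrX -natrM.
  rewrite ler_nat.
  have -> : (k0.+2 ^ 3 * (k.+1 * k.+2 * k.+3) =
    (k0.+2 * k.+1) * (k0.+2 * k.+2) * (k0.+2 * k.+3))%N by ring.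
  by rewrite !leq_mul // !addSn mulSn mulSn; lia.
have -> : k0.+2%:R ^+ 3 * (tR p ^+ b * sqnorm p ^+ k0.+1) *
    (tR p ^+ 4 * (nu_coef R k ^+ 2 * sqnorm p ^+ k)) =
  k0.+2%:R ^+ 3 * nu_coef R k ^+ 2 *
    (tR p ^+ b * tR p ^+ 4 * (sqnorm p ^+ k0.+1 * sqnorm p ^+ k)).
  by move: (tR p) (sqnorm p) => t s; ring.
by apply: ler_wpM2r => //; apply: mulr_ge0; apply: mulr_ge0.
Qed.

Lemma nu_coef_le i j : (i <= j)%N -> nu_coef R i <= nu_coef R j.
Proof.
move=> ij; have g0 k : 0 <= nu_coef R k by rewrite ltW // nu_coef_gt0.
rewrite -(ler_pXn2r (n := 2)) ?nnegrE // !nu_coef_sqr.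
rewrite ler_wpM2r ?invr_ge0 ?mulr_ge0 ?pi_ge0 // ler_nat.
by rewrite !leq_mul.
Qed.

Lemma beta_int_le_succ j b : beta_int R j b <= j.+2%:R * beta_int R j b.+1.
Proof.
rewrite beta_int_split; have := beta_int_shift R j b.
have := beta_int_ge0 R j.+1 b.
move: (beta_int R j b.+1) (beta_int R j.+1 b) => x y y0 E.
have : y <= b.+1%:R * y by rewrite ler_peMl // ler1n.
by rewrite E -[j.+2]addn1 natrD mulrDl mul1r; lra.
Qed.

(** Rotation invariance keeps only the entries with [i + m = j], so [zbar^m] isolates one
    off-diagonal of [F]. The test [m <= j] guards the truncated subtraction. *)
Lemma cint_diag_test F b m N : cint (fun p =>
    tC p ^+ b.+1 * (diag_sum N F p * (cplx p)^*%C ^+ m)) =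
  \sum_(j < N) (if (m <= j)%N then
     F (j - m)%N j * (nu_coef R (j - m) * nu_coef R j * beta_int R j b.+1)%:C
       else 0).
Proof.
have tP := @cpoly_tC R.
have E : cint (fun p => tC p ^+ b.+1 * (diag_sum N F p * (cplx p)^*%C ^+ m)) =
  cint (fun p => \sum_(j < N) \sum_(i < N) (F i j * (nu_coef R i * nu_coef R
    j)%:C) *
    (tC p ^+ b.+1 * (cplx p ^+ j * (cplx p)^*%C ^+ (i + m)))).
  apply: cint_eq => p _;
    rewrite exchange_big /diag_sum /Msum mulr_suml mulr_sumr.
  apply: eq_bigr => i _; rewrite /row_sum !mulr_suml mulr_sumr;
    apply: eq_bigr => j _.
  rewrite -[F i j * _ * _]mulrA [(nu j p)^*%C * _]mulrC nu_conj exprD.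
  move: (nu_coef R i * nu_coef R j)%:C => g; cring.
rewrite E cint_sum => [|j]; last by cpoly_tac.
apply: eq_bigr => j _; rewrite cint_sum => [|i]; last by cpoly_tac.
transitivity (\sum_(i < N | i == (j - m)%N :> nat) if (m <= j)%N then
    F i j * (nu_coef R i * nu_coef R j * beta_int R j b.+1)%:C else 0).
  rewrite [RHS]big_mkcond; apply: eq_bigr => i _.
  rewrite cintZ; last by cpoly_tac.
  have [ji|ji] := eqVneq (j : nat) (i + m)%N.
    rewrite -ji cint_monomial_diag -mulrA -rcM ji addnK eqxx leq_addl.
    by [].
  rewrite cint_monomial0 // mulr0; case: ifP => // /eqP im; case: ifP => // mj.
  by move: ji; rewrite im subnK ?eqxx.
rewrite (big_ord1_eq _ (fun i => if (m <= j)%N then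
    F i j * (nu_coef R i * nu_coef R j * beta_int R j b.+1)%:C else 0)).
by rewrite (leq_ltn_trans (leq_subr _ _) (ltn_ord j)).
Qed.

Lemma Re_mul_sum I (r : seq I) (f : I -> C) (c : C) :
  complex.Re (c * \sum_(i <- r) f i) = \sum_(i <- r) complex.Re (c * f i).
Proof. by rewrite mulr_sumr; exact: raddf_sum. Qed.

(** AM-GM with a free weight [l]: three powers of [t] form half of the weight of [diag_norm], and
    the other factors are at most 1. A large [l] makes the last term small before [diag_norm] tends
    to 0. *)
Lemma diag_test_le F b m N (c : C) (l : R) : 0 < l ->
  2 * complex.Re (c * cint (fun p =>
    tC p ^+ (b + 3) * (diag_sum N F p * (cplx p)^*%C ^+ m))) <=
  l * diag_norm N F + l^-1 * normsq c * rint (fun=> 1 : R).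
Proof.
move=> l0; have tP := @cpoly_tC R; have hP := cpoly_diag_sum N F.
have HP : cpoly (fun p => tC p ^+ (b + 3) * (diag_sum N F p * (cplx p)^*%C ^+
  m)).
  by cpoly_tac.
rewrite -cintZ // Re_cint /diag_norm.
have c1 (x : R) : rpoly (fun _ : R * R => x) by exact: rpoly_cst.
have r2 : rpoly (re_part (fun p => c * (tC p ^+ (b + 3) *
    (diag_sum N F p * (cplx p)^*%C ^+ m)))).
  have FP : cpoly (fun p => c * (tC p ^+ (b + 3) *
    (diag_sum N F p * (cplx p)^*%C ^+ m))) by cpoly_tac.
  by case: FP.
have r3 := rpoly_diag_norm N F.
rewrite -!rintZ // -rintD; try by apply: rpolyM.
apply: rint_le; first exact: rpolyM.
  by apply: rpolyD; apply: rpolyM.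
move=> p pD; rewrite /re_part.
have := Re_mul_conj_le ((Num.sqrt l)%:C * (tC p ^+ 3 * diag_sum N F p))
  ((Num.sqrt l^-1)%:C * (c^*%C * (tC p ^+ b * cplx p ^+ m))).
rewrite (normsqM (Num.sqrt l)%:C) (normsqM (Num.sqrt l^-1)%:C) !normsq_real.
rewrite (normsqM (tC p ^+ 3)) (normsqM c^*%C) normsq_conj (normsqM (tC p ^+ b)).
have lV0 : 0 < l^-1 by rewrite invr_gt0.
rewrite !normsq_tC normsqX normsq_cplx (sqr_sqrtr (ltW l0)) (sqr_sqrtr (ltW
  lV0)).
have -> : (Num.sqrt l)%:C * (tC p ^+ 3 * diag_sum N F p) *
    ((Num.sqrt l^-1)%:C * (c^*%C * (tC p ^+ b * cplx p ^+ m)))^*%C =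
  c * (tC p ^+ (b + 3) * (diag_sum N F p * (cplx p)^*%C ^+ m)).
  have l1 : (Num.sqrt l)%:C * (Num.sqrt l^-1)%:C = 1 :> C.
    by rewrite -rcM -(sqrtrM _ (ltW l0)) divff ?gt_eqF // sqrtr1.
  have -> : ((Num.sqrt l^-1)%:C * (c^*%C * (tC p ^+ b * cplx p ^+ m)))^*%C =
      (Num.sqrt l^-1)%:C * (c * (tC p ^+ b * (cplx p)^*%C ^+ m)).
    rewrite (conjM (Num.sqrt l^-1)%:C) (conjM c^*%C) conjcK conj_tCM.
    by congr (_ * (_ * (_ * _))); [rewrite /= oppr0|rewrite rmorphXn].
  rewrite -[RHS]mul1r -l1 exprD.
  move: (Num.sqrt l)%:C (Num.sqrt l^-1)%:C (diag_sum N F p) => x y z; cring.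
move=> /le_trans; apply; rewrite lerD2l -mulrA.
apply: ler_wpM2l; first exact: ltW.
apply: ler_wpM2l; first exact: normsq_ge0.
have tb : tR p ^+ (2 * b) <= 1.
  apply: exprn_ile1; first exact/ltW/disk_gt0.
  by rewrite /tR gerBl sqnorm_ge0.
have sm : sqnorm p ^+ m <= 1 by apply: exprn_ile1;
  [exact: sqnorm_ge0|exact: ltW].
rewrite -[leRHS]mulr1; apply: ler_pM => //; first exact: tR_ge0.
by rewrite exprn_ge0 // sqnorm_ge0.
Qed.

(* Testing the vanishing diagonal against [t^b zbar^m] and letting [b] go to
   infinity concentrates the integrals at the origin, where the first nonzero
   coefficient of the [m]-th Fourier mode dominates. *)
Lemma first_coef_eq0 F (A : R) m i0 : (forall i j, normsq (F i j) <= A) ->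
  (fun N => diag_norm N F) @ \oo --> (0 : R) ->
  (forall i, (i < i0)%N -> F i (i + m)%N = 0) -> F i0 (i0 + m)%N = 0.
Proof.
move=> FB d0 Flt; apply: normsq_eq0; set a := normsq _.
have a0 : 0 <= a by exact: normsq_ge0.
have A0 : 0 <= A by apply: le_trans (FB 0%N 0%N); exact: normsq_ge0.
pose k0 := (i0 + m)%N; pose G := nu_coef R i0 * nu_coef R k0.
have G0 : 0 < G by rewrite mulr_gt0 ?nu_coef_gt0.
(* The phase that turns the leading coefficient into [a = |F i0 k0|^2]. *)
pose c := (F i0 k0)^*%C.
pose V := rint (fun=> 1 : R).
have V0 : 0 < V := rint1_gt0 R.
pose D := A * (k0.+2%:R ^+ 3 * mu_sup R).
have D0 : 0 <= D.
  by apply: mulr_ge0 => //; apply: mulr_ge0;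
    [exact: exprn_ge0|exact: mu_sup_ge0].
pose T b N := complex.Re (c * cint (fun p =>
    tC p ^+ (b.+1 + 3) * (diag_sum N F p * (cplx p)^*%C ^+ m))).
have lower b N : a * G * beta_int R k0 b.+4 -
    D * beta_int R k0.+1 b <= T b (k0.+1 + N)%N.
  (* Columns below [k0] vanish by minimality, column [k0] gives the main term, and the columns
     beyond it are bounded by [beta_int_tail]. *)
  rewrite /T addn3 cint_diag_test big_split_ord /=.
  rewrite big_ord_recr /= big1 => [|j _]; last first.
    case: ifP => // mj; rewrite -{2}(subnK mj) Flt ?mul0r //.
    by rewrite -(ltn_add2r m) subnK // ltn_ord.
  rewrite add0r leq_addl addnK.
  rewrite mulrDr [leRHS]raddfD; apply: lerD.
    by rewrite mulrA [c * _]mulrC mul_conj -/a -rcM /= -/G mulrA.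
  rewrite [leRHS]Re_mul_sum -lerN2 opprK -sumrN.
  apply: (@le_trans _ _ (\sum_(k < N) A * (nu_coef R (k0.+1 + k) ^+ 2 *
      beta_int R (k0.+1 + k) b.+4))); last first.
    rewrite -mulr_sumr /D -mulrA ler_wpM2l //; exact: beta_int_tail.
  apply: ler_sum => k _; set j := (k0.+1 + k)%N.
  have mj : (m <= j)%N by rewrite /j /k0; lia.
  rewrite mj.
  set f := F _ _; set g := nu_coef R _ * _ * _.
  have g0 : 0 <= g by rewrite !mulr_ge0 ?beta_int_ge0 // ltW // nu_coef_gt0.
  have gle : g <= nu_coef R j ^+ 2 * beta_int R j b.+4.
    rewrite /g expr2 ler_wpM2r ?beta_int_ge0 //.
    by rewrite ler_wpM2r ?nu_coef_le ?leq_subr // ltW // nu_coef_gt0.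
  have cf : - complex.Re (c * f) <= A.
    have := Re_mul_conj_le (- f) (F i0 k0); rewrite normsqN.
    have := FB i0 k0; have := FB (j - m)%N j; rewrite -/f -/c.
    rewrite mulNr raddfN /= [f * _]mulrC; lra.
  have -> : complex.Re (c * (f * g%:C)) = complex.Re (c * f) * g.
    by rewrite mulrA; case: (c * f) => x y /=; ring.
  rewrite -mulNr; apply: (@le_trans _ _ (A * g)); first exact: ler_wpM2r.
  exact: ler_wpM2l.
have small b : a * G * beta_int R k0 b.+4 <= D * beta_int R k0.+1 b.
  apply/ler_addgt0Pr => e e0; rewrite -lerBlDl.
  (* With [b] fixed, [l] makes the constant term at most [e]; then [N0] is taken so large that
     [l * diag_norm] is at most [e] too. *)
  pose l := (normsq c * V + 1) / e.
  have cV : 0 < normsq c * V + 1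
    by rewrite ltr_wpDl // mulr_ge0 ?normsq_ge0 ?ltW.
  have l0 : 0 < l by rewrite divr_gt0.
  have el0 : 0 < e / l by rewrite divr_gt0.
  move/cvgrPdist_lt : d0 => /(_ _ el0)[N0 _ N0P].
  have := N0P (k0.+1 + N0)%N; rewrite /= leq_addl => /(_ isT).
  rewrite sub0r normrN ger0_norm ?diag_norm_ge0 // => h1.
  have h2 := @diag_test_le F b.+1 m (k0.+1 + N0) c l l0.
  rewrite -/V in h2.
  have h3 := lower b N0; rewrite /T in h3.
  have h4 : l * diag_norm (k0.+1 + N0) F <= e.
    by rewrite -ler_pdivlMl // mulrC ltW.
  have h5 : l^-1 * normsq c * V <= e.
    have -> : l^-1 * normsq c * V = e * (normsq c * V / (normsq c * V + 1)).
      by rewrite /l invf_div; ring.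
    rewrite -[leRHS]mulr1; apply: ler_wpM2l; first exact: ltW.
    by rewrite ler_pdivrMr // mul1r lerDl.
  by apply: le_trans h3 _; lra.
(* [B(k0 + 1, b)] is [(k0 + 1) / (b + 1)] times [B(k0, b + 1)], which is at most [k0.+2 ^ 3] times
   [B(k0, b + 4)]. The tail thus loses a factor [b + 1] against the main term. *)
have bound b : a * G * b.+1%:R <= D * (k0.+1%:R * k0.+2%:R ^+ 3).
  have B0 := beta_int_gt0 R k0 b.+4.
  rewrite -(ler_pM2r B0) mulrAC.
  apply: (@le_trans _ _ (D * beta_int R k0.+1 b * b.+1%:R)).
    by rewrite ler_wpM2r // small.
  rewrite -(mulrA D (beta_int R k0.+1 b)) (mulrC (beta_int R k0.+1 b)).
  rewrite beta_int_shift -(mulrA D); apply: ler_wpM2l => //.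
  rewrite -(mulrA k0.+1%:R); apply: ler_wpM2l => //.
  have k2 : 0 <= k0.+2%:R :> R by [].
  have -> : k0.+2%:R ^+ 3 * beta_int R k0 b.+4 =
    k0.+2%:R * (k0.+2%:R * (k0.+2%:R * beta_int R k0 b.+4)) by ring.
  apply: (le_trans (beta_int_le_succ k0 b.+1)); apply: ler_wpM2l => //.
  apply: (le_trans (beta_int_le_succ k0 b.+2)); apply: ler_wpM2l => //.
  exact: beta_int_le_succ.
apply/eqP; rewrite eq_le a0 andbT leNgt; apply/negP => a1.
have aG : 0 < a * G by rewrite mulr_gt0.
pose X := D * (k0.+1%:R * k0.+2%:R ^+ 3) / (a * G).
have := bound (Num.trunc X).
rewrite -ler_pdivlMl // mulrC -/X leNgt.
by rewrite truncnS_gt.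
Qed.

(** Strong induction along each superdiagonal; the entries below the diagonal follow by
    anti-Hermitian symmetry. *)
Lemma diag_norm_cvg0 F (A : R) : antiherm F -> (forall i j, normsq (F i j) <=
  A) ->
  (fun N => diag_norm N F) @ \oo --> (0 : R) -> forall i j, F i j = 0.
Proof.
move=> FA FB d0.
have H m i : F i (i + m)%N = 0.
  elim/ltn_ind: i => i IH; exact: (first_coef_eq0 FB d0 IH).
move=> i j; case: (leqP i j) => ij; first by rewrite -(subnKC ij) H.
by rewrite FA -(subnKC (ltnW ij)) H rmorph0 oppr0.
Qed.

End strictness.

(** * Bivectors *)

Section bivectors.
Variable R : realType.
Local Notation C := R[i].
Implicit Types (A : bivector R) (N : nat).

(* The coefficient of [d/dt_i /\ d/dtbar_j] in [A]. *)
Definition coef11 A (i j : nat) : C :=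
  (A (dx i, dx j) + A (dy i, dy j)) +i* (A (dy i, dx j) - A (dx i, dy j)).

Lemma antiherm_coef11 A : (forall e f, A (e, f) = - A (f, e)) ->
  antiherm (coef11 A).
Proof.
move=> AA i j; rewrite /coef11 (AA (dx j)) (AA (dy j) (dy i)).
rewrite (AA (dy j) (dx i)) (AA (dx j) (dy i)).
by apply/eqP; rewrite eq_complex /=; apply/andP; split; apply/eqP; ring.
Qed.

Lemma sum_truncated_basis (V : nmodType) N (f : rdir -> V) :
  \sum_(e <- truncated_basis N) f e = \sum_(i < N) (f (dx i) + f (dy i)).
Proof.
rewrite /truncated_basis big_cat !big_map big_split /=.
have E (g : nat -> V) : \sum_(i <- iota 0 N) g i = \sum_(i < N) g i.
  by rewrite -(big_mkord xpredT g) /index_iota subn0.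
by rewrite !E.
Qed.

(** The symmetry that the curvature tensor has in either pair of arguments: antisymmetric, of pure
    type (1,1). *)
Definition skew11 (X : cdir -> cdir -> C) := forall i j,
  [/\ X (dt i) (dt j) = 0, X (dtbar i) (dtbar j) = 0 &
      X (dtbar i) (dt j) = - X (dt j) (dtbar i)].

(** Change from the real to the complex frame in one pair of arguments. The factor 2 arises because
    each (1,1) component occurs in both orders. *)
Lemma sum_in_cdir A N (X : cdir -> cdir -> C) :
  (forall e f, A (e, f) = - A (f, e)) -> skew11 X ->
  \sum_(e <- truncated_basis N) \sum_(f <- truncated_basis N) (A (e, f))%:C *
    \sum_(a <- in_cdir R e) \sum_(b <- in_cdir R f) a.1 * b.1 * X a.2 b.2 =
  2 * \sum_(i < N) \sum_(j < N) coef11 A i j * X (dt i) (dtbar j).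
Proof.
move=> AA XS; have FA := antiherm_coef11 AA.
transitivity (\sum_(i < N) \sum_(j < N) (coef11 A i j * X (dt i) (dtbar j) +
    coef11 A j i * X (dt j) (dtbar i))).
  rewrite sum_truncated_basis; apply: eq_bigr => i _.
  rewrite !sum_truncated_basis -big_split; apply: eq_bigr => j _ /=.
  rewrite !big_cons !big_nil /=.
  have [-> -> ->] := XS i j.
  rewrite (FA i j) /coef11.
  move: (X _ _) (X _ _) => [x x'] [y y'].
  by apply/eqP; rewrite eq_complex /=; apply/andP; split; apply/eqP; ring.
have -> : \sum_(i < N) \sum_(j < N) (coef11 A i j * X (dt i) (dtbar j) +
    coef11 A j i * X (dt j) (dtbar i)) =
  \sum_(i < N) \sum_(j < N) coef11 A i j * X (dt i) (dtbar j) +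
  \sum_(i < N) \sum_(j < N) coef11 A j i * X (dt j) (dtbar i).
  by rewrite -big_split; apply: eq_bigr => i _; rewrite -big_split.
rewrite [X in _ + X = _]exchange_big /=.
by rewrite mulr_natl mulr2n.
Qed.

Lemma Qtrunc_qform A N : (forall e f, A (e, f) = - A (f, e)) ->
  Qtrunc N A A = - qform N (coef11 A).
Proof.
move=> AA.
(* The second pair is contracted first. [Y] inherits the skew (1,1) shape in the first pair, so the
   change of frame applies twice, and its factor [2 * 2] cancels the [4^-1] of [Qtrunc]. *)
pose Y u v : C := \sum_(g <- truncated_basis N) \sum_(h <- truncated_basis N)
  (A (g, h))%:C * \sum_(c <- in_cdir R g) \sum_(d <- in_cdir R h)
    c.1 * d.1 * curv_cplx R u v c.2 d.2.
have YE u v : Y u v = 2 * \sum_(k < N) \sum_(l < N) coef11 A k l *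
    curv_cplx R u v (dt k) (dtbar l).
  apply: sum_in_cdir => // k l.
  by case: u v => [i|i] [j|j] /=; split; rewrite ?oppr0 ?opprK.
have YS : skew11 Y.
  move=> i j; rewrite !YE; split.
  - by rewrite big1 ?mulr0 // => k _; rewrite big1 // => l _; rewrite mulr0.
  - by rewrite big1 ?mulr0 // => k _; rewrite big1 // => l _; rewrite mulr0.
  - rewrite -mulrN -sumrN; congr (_ * _); apply: eq_bigr => k _.
    by rewrite -sumrN; apply: eq_bigr => l _; rewrite /= mulrN.
have -> : Qtrunc N A A = 4^-1 * complex.Re (\sum_(e <- truncated_basis N)
    \sum_(f <- truncated_basis N) (A (e, f))%:C *
      \sum_(a <- in_cdir R e) \sum_(b <- in_cdir R f) a.1 * b.1 * Y a.2 b.2).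
  rewrite /Qtrunc; congr (_ * _).
  rewrite raddf_sum; apply: eq_bigr => e _; rewrite raddf_sum;
    apply: eq_bigr => f _.
  have -> : \sum_(a <- in_cdir R e) \sum_(b <- in_cdir R f) a.1 * b.1 * Y a.2
    b.2 =
      \sum_(g <- truncated_basis N) \sum_(h <- truncated_basis N) (A (g, h))%:C
        *
      \sum_(a <- in_cdir R e) \sum_(b <- in_cdir R f) \sum_(c <- in_cdir R g)
        \sum_(d <- in_cdir R h) a.1 * b.1 * c.1 * d.1 * curv_cplx R a.2 b.2 c.2
          d.2.
    transitivity (\sum_(a <- in_cdir R e) \sum_(b <- in_cdir R f)
      \sum_(g <- truncated_basis N) \sum_(h <- truncated_basis N)
      (A (g, h))%:C * \sum_(c <- in_cdir R g)
        \sum_(d <- in_cdir R h) a.1 * b.1 * c.1 * d.1 * curv_cplx R a.2 b.2 c.2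
          d.2).
      apply: eq_bigr => a _; apply: eq_bigr => b _; rewrite mulr_sumr.
      apply: eq_bigr => g _; rewrite mulr_sumr; apply: eq_bigr => h _.
      rewrite mulrCA; congr (_ * _); rewrite mulr_sumr; apply: eq_bigr => c _.
      by rewrite mulr_sumr; apply: eq_bigr => d _; rewrite !mulrA.
    under eq_bigr do rewrite exchange_big.
    rewrite exchange_big; apply: eq_bigr => g _.
    under eq_bigr do rewrite exchange_big.
    rewrite exchange_big; apply: eq_bigr => h _.
    rewrite mulr_sumr; apply: eq_bigr => a _.
    by rewrite mulr_sumr.
  rewrite mulr_sumr raddf_sum; apply: eq_bigr => g _.
  rewrite mulr_sumr raddf_sum; apply: eq_bigr => h _.
  by rewrite /curv_real mulrA -rcM; move: (\sum_(a <- _) _) => -[x y] /=; ring.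
rewrite sum_in_cdir // /qform opprK.
have -> : 2 * \sum_(i < N) \sum_(j < N) coef11 A i j * Y (dt i) (dtbar j) =
    4 * curv_form N (coef11 A) (coef11 A).
  rewrite /curv_form !mulr_sumr; apply: eq_bigr => i _.
  rewrite !mulr_sumr; apply: eq_bigr => j _.
  by rewrite YE /=; move: (\sum_(k < N) _) => S; ring.
by rewrite Re_natM mulKf.
Qed.

Lemma wedge2_bounded A : wedge2 A -> exists B, forall N, hs_norm N (coef11 A)
  <= B.
Proof.
move=> [AA AS].
pose S := esum [set: rdir * rdir] (fun p => `|(A p ^+ 2)%:E|%E).
have Sfin : S \is a fin_num.
  rewrite ge0_fin_numE //; apply: esum_ge0 => p _; exact: abse_ge0.
(* Each entry of [coef11] is built from four real coefficients, and its squared modulus is at most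
   twice the sum of their squares. *)
exists (2 * fine S) => N.
pose r := [seq (e, f) | e <- truncated_basis N, f <- truncated_basis N].
have un : uniq (truncated_basis N).
  rewrite cat_uniq !map_inj_uniq ?iota_uniq; try by move=> ? ? [].
  rewrite andbT /=; apply/hasPn => _ /mapP[i _ ->].
  by apply/negP => /mapP[].
have ur : uniq r by apply: allpairs_uniq => // -[? ?] [? ?] _ _ [-> ->].
have h1 : \sum_(e <- truncated_basis N) \sum_(f <- truncated_basis N)
    A (e, f) ^+ 2 <= fine S.
  rewrite -lee_fin fineK // /S.
  apply: esum_ge; exists [set` r]; first by split => //; exact: finite_seq.
  rewrite -fsbig_seq // big_allpairs -sumEFin lee_sum // => e _.
  rewrite -sumEFin lee_sum // => f _.
  by rewrite gee0_abs ?lee_fin // sqr_ge0.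
apply: le_trans (_ : 2 * (\sum_(e <- truncated_basis N)
    \sum_(f <- truncated_basis N) A (e, f) ^+ 2) <= _);
      last by rewrite ler_pM2l.
rewrite sum_truncated_basis mulr_sumr; apply: ler_sum => i _.
rewrite !sum_truncated_basis -big_split mulr_sumr; apply: ler_sum => j _ /=.
rewrite /normsq /coef11 /=.
move: (A (dx i, dx j)) (A (dy i, dy j)) (A (dx i, dy j)) (A (dy i, dx j)) => a
  b c d.
by have := sqr_ge0 (a - b); have := sqr_ge0 (c + d); nra.
Qed.

Lemma normsq_le_hs_norm (F : nat -> nat -> C) i j B :
  (forall N, hs_norm N F <= B) -> normsq (F i j) <= B.
Proof.
move=> FB; have [iM jM] : (i < (maxn i j).+1)%N /\ (j < (maxn i j).+1)%N.
  by rewrite !ltnS leq_maxl leq_maxr.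
apply: le_trans (FB (maxn i j).+1); rewrite /hs_norm.
rewrite (bigD1 (Ordinal iM)) //= (bigD1 (Ordinal jM)) //= -addrA lerDl addr_ge0
  //.
  by apply: sumr_ge0 => k _; exact: normsq_ge0.
by apply: sumr_ge0 => k _; apply: sumr_ge0 => l _; exact: normsq_ge0.
Qed.

(** For a divergent sequence [limn] is only a default value. Convergence is what allows the sign and
    the vanishing of [Qtilde] to be read off the truncations. *)
Lemma Qtilde_cvg A : wedge2 A ->
  (fun N => qform N (coef11 A)) @ \oo --> - Qtilde A A.
Proof.
move=> AW; have [B AB] := wedge2_bounded AW; case: AW => AA _.
have FA := antiherm_coef11 AA; have qc := qform_cvg FA AB.
rewrite /Qtilde.
have -> : (fun N => Qtrunc N A A) = (fun N => - qform N (coef11 A)).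
  by apply/funext => N; rewrite Qtrunc_qform.
by rewrite limN // opprK.
Qed.

Lemma Qtilde_le0 A : wedge2 A -> Qtilde A A <= 0.
Proof.
move=> AW; have qc := Qtilde_cvg AW.
rewrite -oppr_ge0; apply: (cvgr_to_ge qc); apply: nearW => N.
by apply/qform_ge0/antiherm_coef11; case: AW.
Qed.

Lemma Qtilde_eq0 A : wedge2 A -> Qtilde A A = 0 -> forall i j, coef11 A i j = 0.
Proof.
move=> AW Q0; have [B AB] := wedge2_bounded AW.
have FA : antiherm (coef11 A) by case: AW => AA _; exact: antiherm_coef11.
have := Qtilde_cvg AW; rewrite Q0 oppr0 => qc.
apply: (diag_norm_cvg0 (A := B)) => //.
  by move=> i j; exact: normsq_le_hs_norm.
apply: (@squeeze_cvgr _ _ _ _ (fun=> 0) (fun N => 3 / 4 * qform N (coef11 A))).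
- apply: nearW => N; rewrite diag_norm_ge0 /=.
  by have := qform_ge N FA; lra.
- exact: cvg_cst.
- rewrite -[X in _ --> X](mulr0 (3 / 4)); apply: cvgM => //; exact: cvg_cst.
Qed.

Lemma wedge2_half A : wedge2 A -> wedge2 (fun p => A p / 2).
Proof.
move=> [AA AS]; split=> [e f|]; first by rewrite AA mulNr.
apply: le_lt_trans AS; apply: le_esum => p _.
by rewrite !gee0_abs ?lee_fin ?sqr_ge0 // expr_div_n; have := sqr_ge0 (A p);
  lra.
Qed.

End bivectors.

Theorem theorem1p1 (R : realType) :
  (forall C : bivector R, wedge2 C -> Qtilde C C <= 0) /\
  (forall C : bivector R, wedge2 C ->
     (Qtilde C C = 0 <->
      exists E : bivector R, wedge2 E /\ C = E - Jact E)).
Proof.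
split=> [C|C CW]; first exact: Qtilde_le0.
split=> [/(Qtilde_eq0 CW) C0|[E [[EA _] CE]]].
(* A vanishing (1,1) part means [Jact C = - C], so [C / 2 - Jact (C / 2)] is [C]. *)
- exists (fun p => C p / 2); split; first exact: wedge2_half.
  have xy i j : C (dx i, dx j) = - C (dy i, dy j) /\ C (dy i, dx j) = C (dx i,
    dy j).
    by have /eqP := C0 i j; rewrite eq_complex /= => /andP[/eqP h1 /eqP h2];
      split; lra.
  apply/funext => p; transitivity (C p / 2 - Jact (fun p => C p / 2) p) => //.
  by case: p => [[i|i] [j|j]] /=; have [h1 h2] := xy i j;
    rewrite /dx /dy in h1 h2 *; lra.
(* [coef11] is invariant under [Jact], hence vanishes on [E - Jact E]; every truncation of the form
   is then 0. *)
- have C0 i j : coef11 C i j = 0.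
    rewrite /coef11 CE !fctE /Jact /=.
    by apply/eqP; rewrite eq_complex /=; apply/andP; split; apply/eqP;
      rewrite /dx /dy; ring.
  have qc := Qtilde_cvg CW.
  have q0 : (fun N => qform N (coef11 C)) = fun=> 0.
    apply/funext => N; rewrite /qform /curv_form big1 ?oppr0 // => i _.
    by rewrite big1 // => j _; rewrite C0 mul0r.
  move: qc; rewrite q0 => qc; apply/eqP; rewrite -oppr_eq0; apply/eqP.
  by rewrite -(cvg_lim _ qc) // lim_cst.
Qed.
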